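(* Let $k,A,M,\triangledown,E,K$ and $(X,b,d)$, $d'$, $t$ be as in the context. Let $(\overline X,\overline b,\overline d)$ be the cokernel of the morphism of double complexes $\mathrm{id}-t\colon(X,-b,-d')\to(X,b,d)$. Then the relative cyclic homology $\mathrm{HC}^K_*(E,M)$ is the homology of (the total complex of) $(\overline X,\overline b,\overline d)$.
   Context: **Setting.** $k$ is a commutative ring with $\mathbb Q\subseteq k$; $A$ is an associative unital $k$-algebra; $M$ is an $A$-bimodule with an associative $A$-bimodule map $\triangledown\colon M\otimes_A M\to M$; $E=A\ltimes_\triangledown M$ is $A\times M$ with product $(a,m)(a',m')=(aa',am'+ma'+m\triangledown m')$; $K$ is a $k$-subalgebra of $A$. $\otimes$ means $\otimes_K$; $\overline A=A/K$, $\overline E=E/K=\overline A\oplus M$. For a $K$-bimodule $V$, $V\otimes:=V/[V,K]$, where $[V,K]$ is the $k$-submodule spanned by all $v\lambda-\lambda v$. For $0\le w\le n$, $B^n_w\subseteq\overline E^{\otimes n}$ is the $k$-submodule spanned by simple tensors with exactly $w$ factors in $M$ and the others in $\overline A$; $B^0_0=K$, and $B^n_w=0$ if $w<0$ or $w>n$. Always $n=v+w$. For $v,w\ge0$, $X_{vw}:=M\otimes B^n_w\otimes$; $X_{vw}:=0$ otherwise. **Maps.** All maps are given on (classes of) simple tensors $x_0\otimes\cdots\otimes x_n$ with each $x_i\in A\cup M$ (elements of $A$ in positions $\ge1$ taken modulo $K$). For $x,y\in A\cup M$, $xy$ is the product in $A$ if both are in $A$, the bimodule action if exactly one is in $M$,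 and $0$ if both are in $M$; $x\triangledown y$ is as given if both are in $M$ and $0$ otherwise. For $0\le j<n$, $\mu_j(x_0\otimes\cdots\otimes x_n)=(-1)^jx_0\otimes\cdots\otimes x_jx_{j+1}\otimes\cdots\otimes x_n$, $\varrho_j(x_0\otimes\cdots\otimes x_n)=(-1)^jx_0\otimes\cdots\otimes (x_j\triangledown x_{j+1})\otimes\cdots\otimes x_n$; $\mu_n(x_0\otimes\cdots\otimes x_n)=(-1)^nx_nx_0\otimes x_1\otimes\cdots\otimes x_{n-1}$, $\varrho_n(x_0\otimes\cdots\otimes x_n)=(-1)^n(x_n\triangledown x_0)\otimes x_1\otimes\cdots\otimes x_{n-1}$. $b=\sum_{j=0}^n\mu_j\colon X_{vw}\to X_{v-1,w}$, $d'=\sum_{j=0}^{n-1}\varrho_j$ and $d=d'+\varrho_n\colon X_{vw}\to X_{v,w-1}$. $t\colon X_{vw}\to X_{vw}$ is $t(x_0\otimes\cdots\otimes x_n)=(-1)^{in}x_i\otimes\cdots\otimes x_n\otimes x_0\otimes\cdots\otimes x_{i-1}$, where $i$ is the last index with $x_i\in M$. (The identities $db=-bd$, $d'b=-bd'$, $tb=bt$, $d(\mathrm{id}-t)=(\mathrm{id}-t)d'$ hold.) **Relative cyclic homology.** $\mathrm{HC}^K_*(E,M)$ is the cyclic homology of the mixed complex that is the kernel of the canonical map of normalized mixed complexes $(E\otimes\overline E^{\otimes *}\otimes,b,B)\to(A\otimes\overline A^{\otimes *}\otimes,b,B)$, where $b$ is the Hochschild boundary and $B(x_0\otimes\cdots\otimes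 x_r)=\sum_{i=0}^r(-1)^{ir}1\otimes x_i\otimes\cdots\otimes x_r\otimes x_0\otimes\cdots\otimes x_{i-1}$. *)

(* Defs.v *)
From HB Require Import structures.
From mathcomp Require Import all_boot all_algebra.
From mathcomp.classical Require Import boolp.
From mathcomp.finmap Require Import finmap.
From mathcomp.multinomials Require Import monalg.

Set Implicit Arguments.
Unset Strict Implicit.
Unset Printing Implicit Defensive.

Import GRing.Theory.
Local Open Scope ring_scope.
Local Open Scope quotient_scope.

Section Modules.
Variable k : comNzRingType.

(* Subsets are Boolean predicates; [`[< _ >]] turns a proposition into one    *)
Definition submod (V : lmodType k) (P : submodClosed V) : Type :=
  {x : V | x \in P}.

HB.instance Definition _ (V : lmodType k) (P : submodClosed V) :=
  SubChoice.on (submod P).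
HB.instance Definition _ (V : lmodType k) (P : submodClosed V) :=
  [SubChoice_isSubLmodule of submod P by <:].

(* [P], as an additive subgroup *)
Definition addsub (V : lmodType k) (P : submodClosed V) : {pred V} :=
  [pred x | x \in P].
Lemma addsub_zmod_closed (V : lmodType k) (P : submodClosed V) :
  zmod_closed (addsub P).
Proof.
split; first by rewrite inE rpred0.
by move=> x y; rewrite !inE => hx hy; rewrite -scaleN1r rpredD ?rpredZ.
Qed.
HB.instance Definition _ (V : lmodType k) (P : submodClosed V) :=
  GRing.isZmodClosed.Build V (addsub P) (addsub_zmod_closed P).

Definition qmod (V : lmodType k) (P : submodClosed V) : Type :=
  {ideal_quot (addsub P)}.

Section QuotientModule.
Variables (V : lmodType k) (P : submodClosed V).

HB.instance Definition _ := GRing.Zmodule.on (qmod P).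

Definition qpi (x : V) : qmod P := \pi_({ideal_quot (addsub P)}) x.

Lemma qpi_eq x y : (qpi x = qpi y) <-> (x - y \in P).
Proof.
have := Quotient.idealrBE (addsub P) x y; rewrite inE => ->.
by split=> /eqP.
Qed.

Lemma qpi_surj (u : qmod P) : {x | u = qpi x}.
Proof. by exists (repr u); rewrite /qpi reprK. Qed.

Lemma qpiD x y : qpi (x + y) = qpi x + qpi y.
Proof. by rewrite /qpi (raddfD (\pi_({ideal_quot (addsub P)}))). Qed.

Definition qscale (c : k) (u : qmod P) : qmod P := qpi (c *: repr u).

Lemma qscaleE c x : qscale c (qpi x) = qpi (c *: x).
Proof.
apply/qpi_eq; rewrite -scalerBr rpredZ //; apply/qpi_eq.
by rewrite /qpi reprK.
Qed.

Lemma qscaleA a b u : qscale a (qscale b u) = qscale (a * b) u.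
Proof. by have [x ->] := qpi_surj u; rewrite !qscaleE scalerA. Qed.
Lemma qscale1 : left_id 1 qscale.
Proof. by move=> u; have [x ->] := qpi_surj u; rewrite !qscaleE scale1r. Qed.
Lemma qscaleDr : right_distributive qscale +%R.
Proof.
move=> a u v; have [x ->] := qpi_surj u; have [y ->] := qpi_surj v.
by rewrite -qpiD !qscaleE scalerDr qpiD.
Qed.
Lemma qscaleDl u : {morph qscale^~ u : a b / a + b}.
Proof.
by move=> a b /=; have [x ->] := qpi_surj u; rewrite !qscaleE scalerDl qpiD.
Qed.

HB.instance Definition _ := GRing.Zmodule_isLmodule.Build k (qmod P)
  qscaleA qscale1 qscaleDr qscaleDl.

Lemma qpi_linear : linear qpi.
Proof. by move=> c x y; rewrite qpiD -qscaleE. Qed.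
HB.instance Definition _ := GRing.isLinear.Build k V (qmod P) *:%R qpi qpi_linear.

Lemma qpi_eq0 x : (qpi x = 0) <-> (x \in P).
Proof. by rewrite -(linear0 qpi) qpi_eq subr0. Qed.

Section Lift.
Variables (W : lmodType k) (f : {linear V -> W}).
Hypothesis fP : forall x, x \in P -> f x = 0.

Definition qlift (u : qmod P) : W := f (repr u).

Lemma qliftE x : qlift (qpi x) = f x.
Proof.
apply/eqP; rewrite -subr_eq0 -linearB; apply/eqP/fP.
by apply/qpi_eq; rewrite /qpi reprK.
Qed.

Lemma qlift_linear : linear qlift.
Proof.
move=> c u v; have [x ->] := qpi_surj u; have [y ->] := qpi_surj v.
by rewrite -linearP !qliftE linearP.
Qed.
End Lift.
End QuotientModule.

Section Span.
Variables (V : lmodType k) (S : V -> Prop).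

Inductive in_span : V -> Prop :=
| in_span_gen x of S x : in_span x
| in_span0 : in_span 0
| in_spanP c x y of in_span x & in_span y : in_span (c *: x + y).

Definition span : {pred V} := [pred x | `[< in_span x >]].

Lemma spanP x : reflect (in_span x) (x \in span).
Proof. exact: asboolP. Qed.

Lemma span_submod_closed : submod_closed span.
Proof.
split; first exact/spanP/in_span0.
by move=> c x y /spanP hx /spanP hy; apply/spanP/in_spanP.
Qed.
HB.instance Definition _ :=
  GRing.isSubmodClosed.Build k V span span_submod_closed.
End Span.

Definition kerp (V W : lmodType k) (f : {linear V -> W}) : {pred V} :=
  [pred x | f x == 0].

Lemma kerp_submod_closed (V W : lmodType k) (f : {linear V -> W}) :
  submod_closed (kerp f).
Proof.
split; rewrite ?inE ?linear0 // => c x y; rewrite !inE linearP.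
by move=> /eqP-> /eqP->; rewrite scaler0 addr0.
Qed.
HB.instance Definition _ (V W : lmodType k) (f : {linear V -> W}) :=
  GRing.isSubmodClosed.Build k V (kerp f) (kerp_submod_closed f).

Definition imp (V W : lmodType k) (f : {linear V -> W}) : {pred W} :=
  [pred y | `[< exists x, f x = y >]].

Lemma imp_submod_closed (V W : lmodType k) (f : {linear V -> W}) :
  submod_closed (imp f).
Proof.
split; first by apply/asboolP; exists 0; rewrite linear0.
move=> c _ _ /asboolP[x <-] /asboolP[y <-]; apply/asboolP.
by exists (c *: x + y); rewrite linearP.
Qed.
HB.instance Definition _ (V W : lmodType k) (f : {linear V -> W}) :=
  GRing.isSubmodClosed.Build k W (imp f) (imp_submod_closed f).

Definition preimp (V W : lmodType k) (f : {linear V -> W}) (P : submodClosed W) :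
  {pred V} := [pred x | f x \in P].

Lemma preimp_submod_closed (V W : lmodType k) (f : {linear V -> W}) P :
  submod_closed (@preimp V W f P).
Proof.
split; rewrite ?inE ?linear0 ?rpred0 // => c x y; rewrite !inE linearP => hx hy.
by rewrite rpredD ?rpredZ.
Qed.
HB.instance Definition _ (V W : lmodType k) (f : {linear V -> W}) P :=
  GRing.isSubmodClosed.Build k V (@preimp V W f P) (@preimp_submod_closed V W f P).

Definition coker (V W : lmodType k) (f : {linear V -> W}) : lmodType k :=
  qmod (imp f).

Lemma linear_additive (V W : lmodType k) (f : V -> W) :
  linear f -> {morph f : x y / x + y}.
Proof. by move=> lf x y; have := lf 1 x y; rewrite !scale1r. Qed.

Lemma linear_scalable (V W : lmodType k) (f : V -> W) :
  linear f -> scalable f.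
Proof.
move=> lf c x; have := lf (-1) 0 0; rewrite scaler0 addr0 scaleN1r addNr => f0.
by have := lf c x 0; rewrite f0 !addr0.
Qed.

(* The linear map satisfying [P], or 0 if there is none. It is only used for  *)
(* [P] that prescribe the values on a generating set (classes of simple       *)
(* tensors), or that express a factorization through a quotient or through a  *)
(* submodule, so that there is at most one such map.                          *)
Definition the_linear (V W : lmodType k) (P : {linear V -> W} -> Prop) :
    {linear V -> W} :=
  if pselect (exists f, P f) is left h then projT1 (cid h)
  else (\0%R : {linear V -> W}).

Definition isomorphic (V W : lmodType k) : Prop :=
  exists f : {linear V -> W}, bijective f.

Definition dsum (I : finType) (V : I -> lmodType k) : Type :=
  {dffun forall i, V i}.

Section DirectSum.
Variables (I : finType) (V : I -> lmodType k).
HB.instance Definition _ := Choice.on (dsum V).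

Definition mkdsum (f : forall i, V i) : dsum V := finfun f.
Definition dcomp (x : dsum V) (i : I) : V i := (x : {dffun forall i, V i}) i.

Lemma dcompE f i : dcomp (mkdsum f) i = f i.
Proof. by rewrite /dcomp ffunE. Qed.
Lemma dcompP (x y : dsum V) : (forall i, dcomp x i = dcomp y i) -> x = y.
Proof. by move=> h; apply/ffunP. Qed.

Definition dzero := mkdsum (fun=> 0).
Definition dopp x := mkdsum (fun i => - dcomp x i).
Definition dadd x y := mkdsum (fun i => dcomp x i + dcomp y i).
Definition dscale (c : k) x := mkdsum (fun i => c *: dcomp x i).

Fact daddA : associative dadd.
Proof. by move=> x y z; apply: dcompP => i; rewrite !dcompE addrA. Qed.
Fact daddC : commutative dadd.
Proof. by move=> x y; apply: dcompP => i; rewrite !dcompE addrC. Qed.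
Fact dadd0 : left_id dzero dadd.
Proof. by move=> x; apply: dcompP => i; rewrite !dcompE add0r. Qed.
Fact daddN : left_inverse dzero dopp dadd.
Proof. by move=> x; apply: dcompP => i; rewrite !dcompE addNr. Qed.
HB.instance Definition _ := GRing.isZmodule.Build (dsum V) daddA daddC dadd0 daddN.

Fact dscaleA a b x : dscale a (dscale b x) = dscale (a * b) x.
Proof. by apply: dcompP => i; rewrite !dcompE scalerA. Qed.
Fact dscale1 : left_id 1 dscale.
Proof. by move=> x; apply: dcompP => i; rewrite !dcompE scale1r. Qed.
Fact dscaleDr : right_distributive dscale +%R.
Proof. by move=> a x y; apply: dcompP => i; rewrite !dcompE scalerDr. Qed.
Fact dscaleDl x : {morph dscale^~ x : a b / a + b}.
Proof. by move=> a b; apply: dcompP => i; rewrite !dcompE scalerDl. Qed.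
HB.instance Definition _ := GRing.Zmodule_isLmodule.Build k (dsum V)
  dscaleA dscale1 dscaleDr dscaleDl.

Lemma dcomp_linear i : linear (fun x : dsum V => dcomp x i).
Proof. by move=> c x y; rewrite !dcompE. Qed.
End DirectSum.


(* ker g / (ker g :&: im f), which is ker g / im f if g \o f = 0 *)
Definition homology_at (U V W : lmodType k)
    (f : {linear U -> V}) (g : {linear V -> W}) : lmodType k :=
  qmod (preimp (\val : {linear submod (kerp g) -> V}) (imp f)).

Definition homology (C : nat -> lmodType k)
    (D : forall n, {linear C n.+1 -> C n}) (n : nat) : lmodType k :=
  if n is m.+1 then homology_at (D m.+1) (D m)
  else homology_at (D 0) (\0%R : {linear C 0%N -> C 0%N}).

End Modules.

Arguments the_linear {k V W} P.
Arguments span {k V} S.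

(* b and B are arbitrary here: no identity between them is needed to state the
   definitions. *)
Section Mixed.
Variables (k : comNzRingType) (C : nat -> lmodType k).
Variables (b : forall n, {linear C n.+1 -> C n}).
Variables (B : forall n, {linear C n -> C n.+1}).

(* C_n (+) C_{n-2} (+) C_{n-4} (+) ... *)
Fixpoint mixed_tot (n : nat) : lmodType k :=
  match n with
  | 0 => C 0
  | 1 => C 1
  | p.+2 => (C p.+2 * mixed_tot p)%type
  end.

Definition mixed_top (n : nat) : mixed_tot n -> C n :=
  match n return mixed_tot n -> C n with
  | 0 => fun c => c
  | 1 => fun c => c
  | p.+2 => fun c : (C p.+2 * mixed_tot p)%type => c.1
  end.

(* (c_n, c_{n-2}, ...) |-> (b c_n + B c_{n-2}, b c_{n-2} + B c_{n-4}, ...) *)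
Fixpoint mixed_diff_fun (n : nat) : mixed_tot n.+1 -> mixed_tot n :=
  match n return mixed_tot n.+1 -> mixed_tot n with
  | 0 => fun c : C 1 => b 0 c
  | 1 => fun c : (C 2 * C 0)%type => b 1 c.1 + B 0 c.2
  | p.+2 => fun c : (C p.+3 * mixed_tot p.+1)%type =>
      (b p.+2 c.1 + B p.+1 (mixed_top c.2), mixed_diff_fun c.2)
  end.

Lemma mixed_top_linear n : linear (@mixed_top n).
Proof. by case: n => [|[|n]] c x y. Qed.

Lemma mixed_diff_linear n : linear (@mixed_diff_fun n).
Proof.
suff [] : linear (@mixed_diff_fun n) /\ linear (@mixed_diff_fun n.+1) by [].
have aux (U W Y : lmodType k) (f : {linear U -> Y}) (h : {linear W -> Y}) c
    (x y : U) (u v : W) :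
    f (c *: x + y) + h (c *: u + v) = c *: (f x + h u) + (f y + h v).
  by rewrite !linearP scalerDr addrACA.
elim: n => [|n [IH1 IH2]].
  split=> c; first exact: (linearP (b 0)).
  by move=> [x u] [y v]; apply: (aux _ _ _ (b 1) (B 0)).
split=> // c [x u] [y v]; congr (_, _); last exact: IH1.
apply: etrans (aux _ _ _ (b n.+2) (B n.+1) c _ _ _ _).
by congr (_ + B _ _); apply: mixed_top_linear.
Qed.
HB.instance Definition _ n := GRing.isLinear.Build k (mixed_tot n.+1) (mixed_tot n)
  *:%R (@mixed_diff_fun n) (@mixed_diff_linear n).
Definition mixed_diff n : {linear mixed_tot n.+1 -> mixed_tot n} :=
  @mixed_diff_fun n.

Definition cyclic_homology (n : nat) : lmodType k := homology mixed_diff n.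

End Mixed.

Section Words.
Variables (T : Type) (z : T) (op : T -> T -> T).

(* x_0 ... (x_j x_{j+1}) ... x_n *)
Definition merge_at (j : nat) (s : seq T) : seq T :=
  take j s ++ op (nth z s j) (nth z s j.+1) :: drop j.+2 s.

(* (x_n x_0) x_1 ... x_{n-1} *)
Definition merge_around (s : seq T) : seq T :=
  op (last z s) (head z s) :: behead (take (size s).-1 s).

End Words.

Section Bimodules.
Variables (k : comNzRingType) (R : algType k).

(* k acts centrally: both actions are k-bilinear *)
Record bimod := Bimod {
  bcar :> lmodType k;
  lact : R -> bcar -> bcar;
  ract : bcar -> R -> bcar;
  lact_linearl : forall v, linear (lact^~ v);
  lact_linearr : forall a, linear (lact a);
  ract_linearl : forall a, linear (ract^~ a);
  ract_linearr : forall v, linear (ract v);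
  lact1 : forall v, lact 1 v = v;
  ract1 : forall v, ract v 1 = v;
  lactM : forall a b v, lact (a * b) v = lact a (lact b v);
  ractM : forall a b v, ract v (a * b) = ract (ract v a) b;
  lract : forall a b v, ract (lact a v) b = lact a (ract v b)
}.

Definition rlact (V : bimod) (a : R) : V -> V := fun v => ract v a.
HB.instance Definition _ (V : bimod) a :=
  GRing.isLinear.Build k V V *:%R (@lact V a) (@lact_linearr V a).
HB.instance Definition _ (V : bimod) a :=
  GRing.isLinear.Build k V V *:%R (@rlact V a) (@ract_linearl V a).

Section BimodTheory.
Variable V : bimod.
Implicit Types (a b : R) (c : k) (v w : V).
Lemma lactDl a b v : lact (a + b) v = lact a v + lact b v.
Proof. exact: linear_additive (lact_linearl v) _ _. Qed.
Lemma lactZl c a v : lact (c *: a) v = c *: lact a v.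
Proof. exact: linear_scalable (lact_linearl v) _ _. Qed.
Lemma lact0l v : lact 0 v = 0.
Proof. by rewrite -[0 in LHS](scale0r 0) lactZl scale0r. Qed.
Lemma lactDr a v w : lact a (v + w) = lact a v + lact a w.
Proof. exact: linear_additive (lact_linearr a) _ _. Qed.
Lemma lactZr c a v : lact a (c *: v) = c *: lact a v.
Proof. exact: linear_scalable (lact_linearr a) _ _. Qed.
Lemma lact0r a : lact a 0 = 0 :> V.
Proof. by rewrite -[0 in LHS](scale0r 0) lactZr scale0r. Qed.
Lemma ractDl a v w : ract (v + w) a = ract v a + ract w a.
Proof. exact: linear_additive (ract_linearl a) _ _. Qed.
Lemma ractZl c a v : ract (c *: v) a = c *: ract v a.
Proof. exact: linear_scalable (ract_linearl a) _ _. Qed.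
Lemma ract0l a : ract 0 a = 0 :> V.
Proof. by rewrite -[0 in LHS](scale0r 0) ractZl scale0r. Qed.
Lemma ractDr a b v : ract v (a + b) = ract v a + ract v b.
Proof. exact: linear_additive (ract_linearr v) _ _. Qed.
Lemma ractZr c a v : ract v (c *: a) = c *: ract v a.
Proof. exact: linear_scalable (ract_linearr v) _ _. Qed.
Lemma ract0r v : ract v 0 = 0.
Proof. by rewrite -[0 in LHS](scale0r 0) ractZr scale0r. Qed.
End BimodTheory.

Definition regular_bimod : bimod.
Proof.
refine (@Bimod R (fun a v => a * v) (fun v a => v * a) _ _ _ _ _ _ _ _ _).
- abstract (by move=> v c x y; rewrite mulrDl scalerAl).
- abstract (by move=> v c x y; rewrite mulrDr scalerAr).
- abstract (by move=> v c x y; rewrite mulrDl scalerAl).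
- abstract (by move=> v c x y; rewrite mulrDr scalerAr).
- abstract (exact: mul1r).
- abstract (exact: mulr1).
- abstract (by move=> a b v; rewrite mulrA).
- abstract (by move=> a b v; rewrite mulrA).
- abstract (by move=> a b v; rewrite mulrA).
Defined.

Section Sub.
Variables (V : bimod) (P : submodClosed V).
Hypothesis lactP : forall a v, v \in P -> lact a v \in P.
Hypothesis ractP : forall a v, v \in P -> ract v a \in P.

Definition sub_lact a (v : submod P) : submod P :=
  Sub (lact a (val v)) (lactP a (valP v)).
Definition sub_ract (v : submod P) a : submod P :=
  Sub (ract (val v) a) (ractP a (valP v)).
Fact val_lact a v : val (sub_lact a v) = lact a (val v).
Proof. by []. Qed.
Fact val_ract v a : val (sub_ract v a) = ract (val v) a.
Proof. by []. Qed.

Fact val_linear c (x y : submod P) : val (c *: x + y) = c *: val x + val y.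
Proof. exact: (linearP (\val : {linear submod P -> V})). Qed.
Let valE := (val_lact, val_ract, val_linear).

Definition sub_bimod : bimod.
Proof.
refine (@Bimod (submod P) sub_lact sub_ract _ _ _ _ _ _ _ _ _).
- abstract (by move=> v c x y; apply: val_inj; rewrite !valE lact_linearl).
- abstract (by move=> v c x y; apply: val_inj; rewrite !valE lact_linearr).
- abstract (by move=> v c x y; apply: val_inj; rewrite !valE ract_linearl).
- abstract (by move=> v c x y; apply: val_inj; rewrite !valE ract_linearr).
- abstract (by move=> v; apply: val_inj; rewrite val_lact lact1).
- abstract (by move=> v; apply: val_inj; rewrite val_ract ract1).
- abstract (by move=> a b v; apply: val_inj; rewrite !val_lact lactM).
- abstract (by move=> a b v; apply: val_inj; rewrite !val_ract ractM).
- abstract (by move=> a b v; apply: val_inj; rewrite !(val_lact, val_ract) lract).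
Defined.

Let lq a := @qlift k V P (qmod P) (qpi P \o lact a).
Let rq a := @qlift k V P (qmod P) (qpi P \o @rlact V a).

Fact quot_lactE a v : lq a (qpi P v) = qpi P (lact a v).
Proof. by rewrite /lq qliftE // => x xP /=; apply/qpi_eq0/lactP. Qed.
Fact quot_ractE a v : rq a (qpi P v) = qpi P (ract v a).
Proof. by rewrite /rq qliftE // => x xP /=; apply/qpi_eq0/ractP. Qed.

Definition quot_bimod : bimod.
Proof.
refine (@Bimod (qmod P) lq (fun v a => rq a v) _ _ _ _ _ _ _ _ _).
- abstract (move=> u c x y; have [v ->] := qpi_surj u;
   by rewrite !quot_lactE -linearP lact_linearl).
- abstract (by move=> a; apply: qlift_linear => x xP /=; apply/qpi_eq0/lactP).
- abstract (by move=> a; apply: qlift_linear => x xP /=; apply/qpi_eq0/ractP).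
- abstract (move=> u c x y; have [v ->] := qpi_surj u;
   by rewrite !quot_ractE -linearP ract_linearr).
- abstract (by move=> u; have [v ->] := qpi_surj u; rewrite quot_lactE lact1).
- abstract (by move=> u; have [v ->] := qpi_surj u; rewrite quot_ractE ract1).
- abstract (by move=> a b u; have [v ->] := qpi_surj u; rewrite !quot_lactE lactM).
- abstract (by move=> a b u; have [v ->] := qpi_surj u; rewrite !quot_ractE ractM).
- abstract (move=> a b u; have [v ->] := qpi_surj u;
   by rewrite !(quot_lactE, quot_ractE) lract).
Defined.
End Sub.

(* V / [V, R]                                                                 *)
Definition is_commutator (V : bimod) (x : V) : Prop :=
  exists v a, x = ract v a - lact a v.

Definition cyc (V : bimod) : lmodType k := qmod (span (@is_commutator V)).
Definition cycpi (V : bimod) : {linear V -> cyc V} :=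
  qpi (span (@is_commutator V)).

Section Tensor.
Variables V W : bimod.
Notation free := {malg k[(V * W)%type]}.
Notation gen v w := (<< (v, w) >> : free).

Inductive tens_rel : free -> Prop :=
| tens_linl c v v' w :
    tens_rel (gen (c *: v + v') w - (c *: gen v w + gen v' w))
| tens_linr c v w w' :
    tens_rel (gen v (c *: w + w') - (c *: gen v w + gen v w'))
| tens_bal a v w : tens_rel (gen (ract v a) w - gen v (lact a w)).

Definition tens0 : lmodType k := qmod (span tens_rel).
Definition otimes0 (v : V) (w : W) : tens0 := qpi (span tens_rel) (gen v w).

Section TensorLift.
Variables (Y : lmodType k) (f : V -> W -> Y).

Definition free_ext (x : free) : Y := \sum_(t <- msupp x) x@_t *: f t.1 t.2.

Lemma free_extw (x : free) (d : {fset (V * W)%type}) : fsubset (msupp x) d ->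
  free_ext x = \sum_(t <- d) x@_t *: f t.1 t.2.
Proof.
move=> sd; rewrite /free_ext; apply/big_fset_incl=> // t _ tx.
by rewrite mcoeff_outdom // scale0r.
Qed.

Lemma free_ext_linear : linear free_ext.
Proof.
move=> c x y; pose d := fsetU (msupp (c *: x + y)) (fsetU (msupp x) (msupp y)).
rewrite !(@free_extw _ d) ?fsubsetUl //; last 2 first.
- by apply: fsubset_trans (fsubsetUr _ _); apply: fsubsetUr.
- by apply: fsubset_trans (fsubsetUr _ _); apply: fsubsetUl.
rewrite scaler_sumr -big_split /=; apply: eq_bigr => t _.
by rewrite mcoeffD mcoeffZ scalerDl scalerA.
Qed.
HB.instance Definition _ :=
  GRing.isLinear.Build k free Y *:%R free_ext free_ext_linear.

Lemma free_extE v w : free_ext (gen v w) = f v w.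
Proof. by rewrite /free_ext msuppU oner_eq0 big_seq_fset1 mcoeffUU scale1r. Qed.

Hypothesis f_linl : forall w, linear (f^~ w).
Hypothesis f_linr : forall v, linear (f v).
Hypothesis f_bal : forall a v w, f (ract v a) w = f v (lact a w).

Lemma free_ext_rel x : x \in span tens_rel -> free_ext x = 0.
Proof.
move/spanP; elim=> {x} [_ [c v v' w|c v w w'|a v w]||c x y _ hx _ hy].
- rewrite linearB linearP /= !free_extE.
  by have -> := f_linl w c v v'; rewrite subrr.
- by rewrite linearB linearP /= !free_extE f_linr subrr.
- by rewrite linearB /= !free_extE f_bal subrr.
- exact: linear0.
- by rewrite linearP /= hx hy scaler0 addr0.
Qed.

Definition tens_lift : tens0 -> Y := @qlift k _ (span tens_rel) Y free_ext.

Lemma tens_lift_linear : linear tens_lift.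
Proof. by apply: qlift_linear => x; apply: free_ext_rel. Qed.
Lemma tens_liftE v w : tens_lift (otimes0 v w) = f v w.
Proof.
rewrite /tens_lift /otimes0 (@qliftE k _ (span tens_rel) Y free_ext) ?free_extE //.
  exact: free_extE.
by move=> x; apply: free_ext_rel.
Qed.
End TensorLift.

Lemma otimes0_linl w : linear (otimes0^~ w).
Proof.
by move=> c v v'; rewrite /otimes0 -linearP; apply/qpi_eq/spanP/in_span_gen/tens_linl.
Qed.
Lemma otimes0_linr v : linear (otimes0 v).
Proof.
by move=> c w w'; rewrite /otimes0 -linearP; apply/qpi_eq/spanP/in_span_gen/tens_linr.
Qed.
Lemma otimes0_bal a v w : otimes0 (ract v a) w = otimes0 v (lact a w).
Proof. by apply/qpi_eq/spanP/in_span_gen/tens_bal. Qed.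

Lemma tens_eq (Y : lmodType k) (f g : {linear tens0 -> Y}) :
  (forall v w, f (otimes0 v w) = g (otimes0 v w)) -> f =1 g.
Proof.
move=> h u; have [x ->] := qpi_surj u; rewrite [x]monalgE !linear_sum.
apply: eq_bigr => -[v w] _; have -> : << x@_(v, w) *g (v, w) >> = x@_(v, w) *: gen v w.
  by apply/malgP => t; rewrite mcoeffZ !mcoeffU mulrnAr mulr1.
by rewrite !linearZ /=; congr (_ *: _); apply: h.
Qed.

Let lf a (v : V) (w : W) := otimes0 (lact a v) w.
Let rf a (v : V) (w : W) := otimes0 v (ract w a).
Let tl a := tens_lift (lf a).
Let tr a := tens_lift (rf a).

Fact lf_linl a w : linear ((lf a)^~ w).
Proof. by move=> c v v'; rewrite /lf linearP; apply: otimes0_linl. Qed.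
Fact lf_linr a v : linear (lf a v).
Proof. exact: otimes0_linr. Qed.
Fact lf_bal a r v w : lf a (ract v r) w = lf a v (lact r w).
Proof. by rewrite /lf -lract otimes0_bal. Qed.
Fact rf_linl a w : linear ((rf a)^~ w).
Proof. by move=> c v v'; apply: otimes0_linl. Qed.
Fact rf_linr a v : linear (rf a v).
Proof. by move=> c w w'; rewrite /rf ract_linearl; apply: otimes0_linr. Qed.
Fact rf_bal a r v w : rf a (ract v r) w = rf a v (lact r w).
Proof. by rewrite /rf otimes0_bal lract. Qed.
HB.instance Definition _ a := GRing.isLinear.Build k tens0 tens0 *:%R (tl a)
  (tens_lift_linear (lf_linl a) (lf_linr a) (lf_bal a)).
HB.instance Definition _ a := GRing.isLinear.Build k tens0 tens0 *:%R (tr a)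
  (tens_lift_linear (rf_linl a) (rf_linr a) (rf_bal a)).

Fact tlE a v w : tl a (otimes0 v w) = otimes0 (lact a v) w.
Proof. exact: (tens_liftE (lf_linl a) (lf_linr a) (lf_bal a)). Qed.
Fact trE a v w : tr a (otimes0 v w) = otimes0 v (ract w a).
Proof. exact: (tens_liftE (rf_linl a) (rf_linr a) (rf_bal a)). Qed.

Definition tens : bimod.
Proof.
refine (@Bimod tens0 tl (fun u a => tr a u) _ _ _ _ _ _ _ _ _).
- abstract (move=> u c a b; pose g : {linear tens0 -> tens0} := (c \*: tl a) \+ tl b;
   apply: (@tens_eq _ (tl (c *: a + b)) g) => v w;
   by rewrite /g /= !tlE lact_linearl otimes0_linl).
- abstract (by move=> a; apply: linearP).
- abstract (by move=> a; apply: linearP).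
- abstract (move=> u c a b; pose g : {linear tens0 -> tens0} := (c \*: tr a) \+ tr b;
   apply: (@tens_eq _ (tr (c *: a + b)) g) => v w;
   by rewrite /g /= !trE ract_linearr otimes0_linr).
- abstract (by move=> u; apply: (@tens_eq _ (tl 1) idfun) => v w; rewrite /= tlE lact1).
- abstract (by move=> u; apply: (@tens_eq _ (tr 1) idfun) => v w; rewrite /= trE ract1).
- abstract (move=> a b u; apply: (@tens_eq _ (tl (a * b)) (tl a \o tl b)) => v w;
   by rewrite /= !tlE lactM).
- abstract (move=> a b u; apply: (@tens_eq _ (tr (a * b)) (tr b \o tr a)) => v w;
   by rewrite /= !trE ractM).
- abstract (move=> a b u; apply: (@tens_eq _ (tr b \o tl a) (tl a \o tr b)) => v w;
   by rewrite /= !(tlE, trE)).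
Defined.

Definition otimes (v : V) (w : W) : tens := otimes0 v w.

Lemma lact_otimes a v w : lact a (otimes v w) = otimes (lact a v) w.
Proof. exact: tlE. Qed.
Lemma ract_otimes a v w : ract (otimes v w) a = otimes v (ract w a).
Proof. exact: trE. Qed.

End Tensor.

(* V^{(x) n}: V (x) (V (x) ... (V (x) R)), which is R for n = 0 *)
Fixpoint tpow (V : bimod) (n : nat) : bimod :=
  if n is m.+1 then tens V (tpow V m) else regular_bimod.

(* s_0 (x) ... (x) s_{n-1} (x) c; only meant for size s = n *)
Fixpoint tword (V : bimod) (n : nat) (s : seq V) (c : R) : tpow V n :=
  match n with
  | 0 => c
  | m.+1 => otimes (head 0 s) (tword m (behead s) c)
  end.

Lemma lact_tword (V : bimod) n x (s : seq V) c a :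
  lact a (tword n.+1 (x :: s) c) = tword n.+1 (lact a x :: s) c.
Proof. exact: lact_otimes. Qed.
Lemma ract_tword (V : bimod) n (s : seq V) c a :
  ract (tword n s c) a = tword n s (c * a).
Proof.
elim: n s => [|n IHn] s; first by [].
by apply: etrans (ract_otimes _ _ _) _; rewrite IHn.
Qed.

End Bimodules.

Section Restriction.
Variables (k : comNzRingType) (S R : algType k) (f : {lrmorphism S -> R}).

Definition restr (V : bimod R) : bimod S.
Proof.
refine (@Bimod k S V (fun a v => lact (f a) v) (fun v a => ract v (f a))
  _ _ _ _ _ _ _ _ _).
- abstract (by move=> v c x y; rewrite linearP lact_linearl).
- abstract (by move=> v c x y; rewrite lact_linearr).
- abstract (by move=> v c x y; rewrite ract_linearl).
- abstract (by move=> v c x y; rewrite linearP ract_linearr).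
- abstract (by move=> v; rewrite rmorph1 lact1).
- abstract (by move=> v; rewrite rmorph1 ract1).
- abstract (by move=> a b v; rewrite rmorphM lactM).
- abstract (by move=> a b v; rewrite rmorphM ractM).
- abstract (by move=> a b v; rewrite lract).
Defined.
End Restriction.

Section Hochschild.
Variables (k : comNzRingType) (K R : algType k) (f : {lrmorphism K -> R}).

Definition algK : bimod K := restr f (regular_bimod R).

Lemma imK_lact a (v : algK) : v \in imp f -> lact a v \in imp f.
Proof.
by move=> /asboolP[l <-]; apply/asboolP; exists (a * l); rewrite rmorphM.
Qed.
Lemma imK_ract a (v : algK) : v \in imp f -> ract v a \in imp f.
Proof.
by move=> /asboolP[l <-]; apply/asboolP; exists (l * a); rewrite rmorphM.
Qed.

(* R / K *)
Definition algbar : bimod K :=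
  @quot_bimod k K algK (imp f : submodClosed algK) imK_lact imK_ract.
Definition bar (x : R) : algbar := qpi (imp f) x.

Lemma lact_bar a x : lact a (bar x) = bar (f a * x).
Proof. exact: (quot_lactE imK_lact). Qed.
Lemma ract_bar a x : ract (bar x) a = bar (x * f a).
Proof. exact: (quot_ractE imK_ract). Qed.

Definition hochschild (n : nat) : lmodType k := cyc (tens algK (tpow algbar n)).

(* the class of x_0 (x) ... (x) x_n, for s = [:: x_0; ...; x_n] *)
Definition hword (n : nat) (s : seq R) : hochschild n :=
  cycpi _ (otimes (head 0 s : algK) (tword n (map bar (behead s)) 1)).

Definition hochschild_b (n : nat) : {linear hochschild n.+1 -> hochschild n} :=
  the_linear (fun g => forall s : seq R, size s = n.+2 ->
    g (hword n.+1 s) =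
      \sum_(j < n.+1) (-1) ^+ j *: hword n (merge_at 0 *%R j s)
      + (-1) ^+ n.+1 *: hword n (merge_around 0 *%R s)).

Definition connes_B (n : nat) : {linear hochschild n -> hochschild n.+1} :=
  the_linear (fun g => forall s : seq R, size s = n.+1 ->
    g (hword n s) =
      \sum_(i < n.+1) (-1) ^+ (i * n) *: hword n.+1 (1 :: rot i s)).

End Hochschild.

Section Extension.
Variables (k : comNzRingType) (A : algType k).

Record bimod_product (M : bimod A) := BimodProduct {
  prod_map : {linear tens M M -> M};
  prod_lact : forall a u, prod_map (lact a u) = lact a (prod_map u);
  prod_ract : forall a u, prod_map (ract u a) = ract (prod_map u) a;
  prod_assoc : forall x y z, prod_map (otimes (prod_map (otimes x y)) z) =
                             prod_map (otimes x (prod_map (otimes y z)))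
}.

Variables (M : bimod A) (nabla : bimod_product M).

Definition nab (x y : M) : M := prod_map nabla (otimes x y).

Lemma nab_linearl y : linear (nab^~ y).
Proof. by move=> c u v; rewrite /nab /otimes otimes0_linl linearP. Qed.
Lemma nab_linearr x : linear (nab x).
Proof. by move=> c u v; rewrite /nab /otimes otimes0_linr linearP. Qed.
Lemma nabDl x y z : nab (x + y) z = nab x z + nab y z.
Proof. exact: linear_additive (nab_linearl z) _ _. Qed.
Lemma nabZl c x y : nab (c *: x) y = c *: nab x y.
Proof. exact: linear_scalable (nab_linearl y) _ _. Qed.
Lemma nab0l x : nab 0 x = 0.
Proof. by rewrite -[0 in LHS](scale0r 0) nabZl scale0r. Qed.
Lemma nabDr x y z : nab x (y + z) = nab x y + nab x z.
Proof. exact: linear_additive (nab_linearr x) _ _. Qed.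
Lemma nabZr c x y : nab x (c *: y) = c *: nab x y.
Proof. exact: linear_scalable (nab_linearr x) _ _. Qed.
Lemma nab0r x : nab x 0 = 0.
Proof. by rewrite -[0 in LHS](scale0r 0) nabZr scale0r. Qed.
Lemma nab_lact a x y : nab (lact a x) y = lact a (nab x y).
Proof. by rewrite /nab -prod_lact lact_otimes. Qed.
Lemma nab_ract a x y : nab x (ract y a) = ract (nab x y) a.
Proof. by rewrite /nab -prod_ract ract_otimes. Qed.
Lemma nab_bal a x y : nab (ract x a) y = nab x (lact a y).
Proof. by rewrite /nab /otimes otimes0_bal. Qed.
Lemma nab_assoc x y z : nab (nab x y) z = nab x (nab y z).
Proof. exact: prod_assoc. Qed.

Definition ext of bimod_product M : Type := (A * M)%type.
Local Notation E := (ext nabla).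

HB.instance Definition _ := GRing.Lmodule.copy E (A * M)%type.

Definition ext_one : E := (1, 0).
Definition ext_mul (x y : E) : E :=
  (x.1 * y.1, lact x.1 y.2 + ract x.2 y.1 + nab x.2 y.2).

Fact ext_mulA : associative ext_mul.
Proof.
case=> [a x] [b y] [c z]; rewrite /ext_mul /=; congr (_, _); first exact: mulrA.
rewrite !(lactDr, ractDl, nabDl, nabDr) lactM ractM lract.
rewrite nab_lact nab_ract nab_bal nab_assoc -!addrA; do 2!congr (_ + _).
by rewrite addrCA; congr (_ + _); rewrite [X in _ + X = _]addrCA; apply: addrCA.
Qed.
Fact ext_mul1l : left_id ext_one ext_mul.
Proof.
by case=> a x; rewrite /ext_mul /= mul1r lact1 ract0l nab0l !addr0.
Qed.
Fact ext_mul1r : right_id ext_one ext_mul.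
Proof.
by case=> a x; rewrite /ext_mul /= mulr1 ract1 lact0r nab0r add0r addr0.
Qed.
Fact ext_mulDl : left_distributive ext_mul +%R.
Proof.
case=> [a x] [b y] [c z]; rewrite /ext_mul /=; congr (_, _); first exact: mulrDl.
by rewrite lactDl ractDl nabDl [RHS]addrACA [X in X + _ = _]addrACA.
Qed.
Fact ext_mulDr : right_distributive ext_mul +%R.
Proof.
case=> [a x] [b y] [c z]; rewrite /ext_mul /=; congr (_, _); first exact: mulrDr.
by rewrite lactDr ractDr nabDr [RHS]addrACA [X in X + _ = _]addrACA.
Qed.
Fact ext_one_neq0 : ext_one != 0.
Proof. by apply/eqP => -[] /eqP; rewrite oner_eq0. Qed.
HB.instance Definition _ := GRing.Zmodule_isNzRing.Build E
  ext_mulA ext_mul1l ext_mul1r ext_mulDl ext_mulDr ext_one_neq0.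
Fact ext_scaleAl (c : k) (x y : E) : c *: (x * y) = (c *: x) * y.
Proof.
case: x y => [a x] [b y]; congr (_, _); first exact: scalerAl.
by rewrite /= !scalerDr -lactZl -ractZl -nabZl.
Qed.
HB.instance Definition _ := GRing.Lmodule_isLalgebra.Build k E ext_scaleAl.
Fact ext_scaleAr (c : k) (x y : E) : c *: (x * y) = x * (c *: y).
Proof.
case: x y => [a x] [b y]; congr (_, _); first exact: scalerAr.
by rewrite /= !scalerDr -lactZr -ractZr -nabZr.
Qed.
HB.instance Definition _ := GRing.Lalgebra_isAlgebra.Build k E ext_scaleAr.

Definition ext_in (a : A) : E := (a, 0).
Definition ext_out (x : E) : A := x.1.

Fact ext_in_linear : linear ext_in.
Proof. by move=> c a b; congr (_, _); rewrite /= scaler0 addr0. Qed.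
Fact ext_in_monoid : monoid_morphism ext_in.
Proof.
split=> // a b; congr (_, _).
by rewrite /= lact0r ract0l nab0l !addr0.
Qed.
HB.instance Definition _ := GRing.isLinear.Build k A E *:%R ext_in ext_in_linear.
HB.instance Definition _ := GRing.isMonoidMorphism.Build A E ext_in ext_in_monoid.

(* K is given by its inclusion [f] into A                                     *)
Section Relative.
Variables (K : algType k) (f : {lrmorphism K -> A}).

Definition fE : {lrmorphism K -> E} := ext_in \o f.

Local Notation CE := (hochschild fE).
Local Notation CA := (hochschild f).

(* the canonical map induced by E -> A *)
Definition ext_to_base (n : nat) : {linear CE n -> CA n} :=
  the_linear (fun g => forall s : seq E, size s = n.+1 ->
    g (hword fE n s) = hword f n (map ext_out s)).

Definition relC (n : nat) : lmodType k := submod (kerp (ext_to_base n)).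

Definition rel_b (n : nat) : {linear relC n.+1 -> relC n} :=
  the_linear (fun g => forall x, val (g x) = hochschild_b fE n (val x)).
Definition rel_B (n : nat) : {linear relC n -> relC n.+1} :=
  the_linear (fun g => forall x, val (g x) = connes_B fE n (val x)).

Definition relative_HC (n : nat) : lmodType k := cyclic_homology rel_b rel_B n.

(* Words x_0 ... x_n with letters in A or M *)
Definition letter : Type := (A + M)%type.
Definition inM (x : letter) : bool := if x is inr _ then true else false.
Definition letter_ext (x : letter) : E :=
  match x with inl a => (a, 0) | inr m => (0, m) end.
Local Notation lbar x := (bar fE (letter_ext x)).

(* The simple tensors that span B^n_w; the factor c in K (see [tpow]) can be  *)
(* absorbed in the last letter if n > 0, and gives B^0_0 = K if n = 0.        *)
Definition is_weighted (n w : nat) (u : tpow (algbar fE) n) : Prop :=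
  exists (s : seq letter) (c : K),
    [/\ size s = n, count inM s = w & u = tword n [seq lbar x | x <- s] c].

Lemma lact_lbar a x : exists2 y, inM y = inM x & lact a (lbar x) = lbar y.
Proof.
rewrite lact_bar; case: x => [a'|m];
  [exists (inl (f a * a')) | exists (inr (lact (f a) m))] => //.
- by congr bar; congr (_, _); rewrite /= lact0r ract0l nab0l !addr0.
- by congr bar; congr (_, _); rewrite /= ?mulr0 ?ract0l ?nab0l ?addr0.
Qed.
Lemma weighted_lact n w a u :
  u \in span (@is_weighted n w) -> lact a u \in span (@is_weighted n w).
Proof.
move/spanP; elim=> {u} [_ [s [c [ss sw ->]]]||c x y _ hx _ hy]; last 2 first.
- by rewrite lact0r rpred0.
- by rewrite lactDr lactZr rpredD ?rpredZ.
apply/spanP/in_span_gen.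
case: n s ss sw => [|n] [|x s] //= ss sw; first by exists [::], (a * c).
have [y yx lxy] := lact_lbar a x; exists (y :: s), c; split=> //=.
  by rewrite yx.
by have := lact_tword n (lbar x) [seq lbar z | z <- s] c a; rewrite lxy.
Qed.
Lemma weighted_ract n w a u :
  u \in span (@is_weighted n w) -> ract u a \in span (@is_weighted n w).
Proof.
move/spanP; elim=> {u} [_ [s [c [ss sw ->]]]||c x y _ hx _ hy]; last 2 first.
- by rewrite ract0l rpred0.
- by rewrite ractDl ractZl rpredD ?rpredZ.
apply/spanP/in_span_gen; exists s, (c * a); split=> //.
exact: ract_tword.
Qed.

Definition Bnw (n w : nat) : bimod K :=
  @sub_bimod k K (tpow (algbar fE) n) (span (@is_weighted n w))
    (@weighted_lact n w) (@weighted_ract n w).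

(* [insubd] returns its default 0 only if the tensor is not in B^n_w          *)
Definition Bword (n w : nat) (s : seq letter) : Bnw n w :=
  insubd (0 : submod (span (@is_weighted n w))) (tword n [seq lbar x | x <- s] 1).

(* [X n w] is X_{vw} with v = n - w (and 0 if w > n, as B^n_w = 0) *)
Definition X (n w : nat) : lmodType k := cyc (tens (restr f M) (Bnw n w)).

Definition xform (n w : nat) (s : seq letter) : bool :=
  [&& size s == n.+1, inM (head (inl 0) s) & count inM (behead s) == w].

(* the class of x_0 (x) ... (x) x_n in [X n w], if it has the form [xform]   *)
Definition xword (n w : nat) (s : seq letter) : X n w :=
  if s is inr m :: s' then
    if xform n w s then
      cycpi _ (otimes (m : restr f M) (Bword n w s'))
    else 0
  else 0.

(* A word with a zero letter, or not of the form [xform], has class 0, so the *)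
(* side of the 0 returned below does not matter                               *)
Definition letter_mul (x y : letter) : letter :=
  match x, y with
  | inl a, inl a' => inl (a * a')
  | inl a, inr m => inr (lact a m)
  | inr m, inl a => inr (ract m a)
  | inr _, inr _ => inl 0
  end.
Definition letter_nab (x y : letter) : letter :=
  match x, y with
  | inr m, inr m' => inr (nab m m')
  | _, _ => inr 0
  end.

Definition Xb (n w : nat) : {linear X n.+1 w -> X n w} :=
  the_linear (fun g => forall s, xform n.+1 w s ->
    g (xword n.+1 w s) =
      \sum_(j < n.+1) (-1) ^+ j *: xword n w (merge_at (inl 0) letter_mul j s)
      + (-1) ^+ n.+1 *: xword n w (merge_around (inl 0) letter_mul s)).

Definition Xd (n w : nat) : {linear X n.+1 w.+1 -> X n w} :=
  the_linear (fun g => forall s, xform n.+1 w.+1 s ->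
    g (xword n.+1 w.+1 s) =
      \sum_(j < n.+1) (-1) ^+ j *: xword n w (merge_at (inl 0) letter_nab j s)
      + (-1) ^+ n.+1 *: xword n w (merge_around (inl 0) letter_nab s)).

Definition lastM (s : seq letter) : nat :=
  \max_(i < size s | inM (nth (inl 0) s i)) i.

Definition Xt (n w : nat) : {linear X n w -> X n w} :=
  the_linear (fun g => forall s, xform n w s ->
    g (xword n w s) = (-1) ^+ (lastM s * n) *: xword n w (rot (lastM s) s)).

Definition Xid_sub_t (n w : nat) : {linear X n w -> X n w} :=
  idfun \- Xt n w.

Definition Xbar (n w : nat) : lmodType k := coker (Xid_sub_t n w).
Definition Xpi (n w : nat) : {linear X n w -> Xbar n w} :=
  qpi (imp (Xid_sub_t n w)).

Definition Xbarb (n w : nat) : {linear Xbar n.+1 w -> Xbar n w} :=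
  the_linear (fun g => forall x, g (Xpi n.+1 w x) = Xpi n w (Xb n w x)).
Definition Xbard (n w : nat) : {linear Xbar n.+1 w.+1 -> Xbar n w} :=
  the_linear (fun g => forall x, g (Xpi n.+1 w.+1 x) = Xpi n w (Xd n w x)).

(* the sum of the X_{vw} / (id - t) with v + w = n *)
Definition Xtot (n : nat) : lmodType k := dsum (fun w : 'I_n.+1 => Xbar n w).

Definition Xtot_diff_fun (n : nat) (x : Xtot n.+1) : Xtot n :=
  mkdsum (fun w : 'I_n.+1 => Xbarb n w (dcomp x (widen_ord (leqnSn _) w))
                           + Xbard n w (dcomp x (lift ord0 w))).
Lemma Xtot_diff_linear n : linear (@Xtot_diff_fun n).
Proof.
move=> c x y; apply: dcompP => i; apply: etrans (dcompE _ _) _.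
apply: esym; apply: etrans (dcomp_linear _ _ _ _) _.
have := dcompE; rewrite /Xtot_diff_fun => ->; rewrite dcompE.
have lin := @dcomp_linear k _ (fun w : 'I_n.+2 => Xbar n.+1 w).
have lw := lin (widen_ord (leqnSn _) i) c x y.
have ll := lin (lift ord0 i) c x y.
apply: esym; apply: etrans (congr2 +%R (congr1 (Xbarb n i) lw) (congr1 (Xbard n i) ll)) _.
by rewrite (linearP (Xbarb n i)) (linearP (Xbard n i)) scalerDr addrACA.
Qed.
HB.instance Definition _ n := GRing.isLinear.Build k (Xtot n.+1) (Xtot n)
  *:%R (@Xtot_diff_fun n) (@Xtot_diff_linear n).
Definition Xtot_diff n : {linear Xtot n.+1 -> Xtot n} := @Xtot_diff_fun n.

End Relative.
End Extension.

Section Subalgebra.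
Variables (k : comNzRingType) (A : algType k) (P : subalgClosed A).

Definition subalg : Type := {x : A | x \in P}.
HB.instance Definition _ := SubChoice.on subalg.
HB.instance Definition _ := [SubChoice_isSubAlgebra of subalg by <:].

Definition subalg_incl (x : subalg) : A := val x.
HB.instance Definition _ := GRing.isLinear.Build k subalg A *:%R subalg_incl
  (linearP (\val : {linear subalg -> A})).
HB.instance Definition _ := GRing.isMonoidMorphism.Build subalg A subalg_incl
  (rmorphism_monoidP (\val : {rmorphism subalg -> A})).

End Subalgebra.

Arguments subalg_incl {k A} P x.

(* Main.v *)
From HB Require Import structures.
From mathcomp Require Import all_boot all_algebra.
From mathcomp.classical Require Import boolp.
From mathcomp Require Import zify.
Require Import Defs.

Set Implicit Arguments.
Unset Strict Implicit.
Unset Printing Implicit Defensive.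

Import GRing.Theory.
Local Open Scope ring_scope.

(* Simplification would unfold these modules down to quotients of free ones. *)
#[local] Arguments tens : simpl never.
#[local] Arguments otimes : simpl never.
#[local] Arguments cyc : simpl never.
#[local] Arguments cycpi : simpl never.
#[local] Arguments algK : simpl never.
#[local] Arguments algbar : simpl never.
#[local] Arguments restr : simpl never.

(** Write [x_0 ... x_n] for the class of a tensor in the normalized Hochschild
    module of [E], and let [th] be the projection of [E] onto [A], which is a
    ring morphism over [K]. The letters in [M] cut a cyclic word into blocks, and
    the proof compares the rotation [t] of the blocks with Connes' operator [B].
    It uses the following operators:
    - [b], the Hochschild boundary, and [b0], the same sum with [x_n x_0]
      replaced by [th x_n x_0] in the last face;
    - [T], which rotates the last letter in [M], and the letters of [A] that
      follow it, to the front; it is [t] on the words that start in [M];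
    - [N], the signed sum of all rotations that start with a letter in [M];
    - [h], which puts [1] in front of the word and sums over the rotations of
      the final letters in [A];
    - [Pi], which applies [th] to all letters, and [P], which projects the first
      letter onto [M]. The kernel of [Pi] is the relative complex, and the image
      of [P] is the direct sum of the modules [X_vw].

    Telescoping sums over rotations give
      [b h + h b0 = id - T - Pi],  [h N = B (id - Pi)],  [N T = N].
    Moreover [h h = 0] and [T h = 0], because [1] has class zero in [E / K] and
    no component in [M], and multiplying the first letter by the [M]-component of the second one is
    a left inverse of [h] on the image of [P], which contains that of [N]. Also
    [N] is [t + t^2 + ... + t^(w + 1)] on [X_vw], where [t^(w + 1) = id]. Since
    [w + 1] is invertible in [k], averaging shows that the kernel of [N] on the
    relative complex is the image of [id - T] ([phi_zero_1T], [N_phi_zero]) and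
    that the elements fixed by [T] are values of [N] ([fix_N]).

    On the relative complex, [B = h N] with [h] injective on the image of [N],
    so the kernel of [B] is the image of [id - T]; equivalently ([ker_B]),
    [B z = 0] if and only if [T z] has class zero in the quotient of the columns
    by [id - t]. As [B B = 0] and [b (id - T) = (id - T) b0], sending
    [(c_n, c_(n-2), ...)] to the class of [T c_n] is a surjective chain map from
    the total complex of the relative mixed complex to the total complex of these
    quotients, and its kernel is the subcomplex [B c_n = 0].

    This kernel is acyclic. For a cycle [c] in it, [b c_n = - B c_(n-2)], so [h]
    and [T] vanish on [b c_n]. Write [c_n = u - T u]. Then [b0 u - b c_n] is
    fixed by [T], hence is [N v] for some [v], and
      [c_n = b (h u) + h (b0 u) = b (h u) + h (N v) + h (b c_n) = b (h u) + B v]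
    with [B (h u) = 0] ([key_decomp]). Subtracting the boundary of
    [(h u, v, 0, ...)] from [c] leaves a shorter cycle of the same kind
    ([mixed_acyclic]). So the chain map induces an isomorphism in homology
    ([homology_iso]).

    The identities are proved for an arbitrary retraction [th] and for arbitrary
    modules with the universal property of the Hochschild modules ([words]). A
    word is a function [g : nat -> R] of which only the values at [0, ..., n]
    matter. *)

(** * Linear maps and tensor powers *)

Section LinearMaps.
Variable k : comNzRingType.

Lemma the_linearP (V W : lmodType k) (P : {linear V -> W} -> Prop) :
  (exists f, P f) -> P (the_linear P).
Proof.
by rewrite /the_linear; case: pselect => // h _; exact: projT2 (cid h).
Qed.

Lemma linear_ext (V W : lmodType k) (f : V -> W) (lf : linear f) :
  exists g : {linear V -> W}, forall x, g x = f x.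
Proof.
pose m := GRing.isLinear.Build k V W *:%R f lf.
pose g : {linear V -> W} := HB.pack f m.
by exists g.
Qed.

Lemma inj_surj_bij (V W : Type) (f : V -> W) :
  injective f -> (forall y, exists x, f x = y) -> bijective f.
Proof.
move=> finj fsurj; exists (fun y => projT1 (cid (fsurj y))) => x.
  by apply: finj; case: cid.
by case: cid.
Qed.

Lemma sum_linear_ex (V W : lmodType k) (I : finType) (F : I -> {linear V -> W}) :
  exists G : {linear V -> W}, forall z, G z = \sum_i F i z.
Proof.
apply: (linear_ext (f := fun z => \sum_i F i z)) => c x y.
by rewrite scaler_sumr -big_split; apply: eq_bigr => i _; rewrite linearP.
Qed.

Lemma qlift_ex (V W : lmodType k) (P : submodClosed V) (f : {linear V -> W}) :
  (forall x, x \in P -> f x = 0) ->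
  exists g : {linear qmod P -> W}, forall x, g (qpi P x) = f x.
Proof.
move=> fP; have [g gE] := linear_ext (qlift_linear fP).
by exists g => x; rewrite gE qliftE.
Qed.

End LinearMaps.

(** The word [g] with its [i]-th letter replaced by [x]. *)
Definition upd (T : Type) (g : nat -> T) (i : nat) (x : T) : nat -> T :=
  fun j => if j == i then x else g j.

Section Tensors.
Variables (k : comNzRingType) (K : algType k).

Lemma tens_lift_ex (V W : bimod K) (Y : lmodType k) (F : V -> W -> Y) :
  (forall w, linear (F^~ w)) -> (forall v, linear (F v)) ->
  (forall a v w, F (ract v a) w = F v (lact a w)) ->
  exists G : {linear tens V W -> Y}, forall v w, G (otimes v w) = F v w.
Proof.
move=> h1 h2 h3; have [G GE] := linear_ext (tens_lift_linear h1 h2 h3).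
by exists G => v w; rewrite GE; apply: tens_liftE.
Qed.

Lemma otimes_linl (V W : bimod K) w : linear ((@otimes _ _ V W)^~ w).
Proof. exact: otimes0_linl. Qed.
Lemma otimes_linr (V W : bimod K) v : linear (@otimes _ _ V W v).
Proof. exact: otimes0_linr. Qed.
Lemma otimes_bal (V W : bimod K) a v w :
  @otimes _ _ V W (ract v a) w = otimes v (lact a w).
Proof. exact: otimes0_bal. Qed.

Lemma otimes_0l (V W : bimod K) w : @otimes _ _ V W 0 w = 0.
Proof.
by have := @otimes_linl V W w (-1) 0 0; rewrite !scaleN1r !addNr.
Qed.
Lemma otimes_0r (V W : bimod K) v : @otimes _ _ V W v 0 = 0.
Proof.
by have := @otimes_linr V W v (-1) 0 0; rewrite !scaleN1r !addNr.
Qed.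

Lemma tens_ext (V W : bimod K) (Y : lmodType k)
    (f g : {linear tens V W -> Y}) :
  (forall v w, f (otimes v w) = g (otimes v w)) -> forall u, f u = g u.
Proof. by move=> h; apply: tens_eq. Qed.

Section Power.
Variable V : bimod K.

Lemma tpow_ext (Y : lmodType k) n (f g : {linear tpow V n -> Y}) :
  (forall s c, size s = n -> f (tword n s c) = g (tword n s c)) ->
  forall u, f u = g u.
Proof.
elim: n f g => [|n IHn] f g h; first by move=> c; apply: (h [::] c).
apply: tens_ext => v; have [fv fvE] := linear_ext (otimes_linr (W := tpow V n) v).
move=> w; rewrite -fvE; apply: (IHn (f \o fv) (g \o fv)) => s c ss /=.
by rewrite fvE; apply: (h (v :: s) c); rewrite /= ss.
Qed.

(** [F g c] is [k]-multilinear in [g 0, ..., g (n - 1)] and [c], and balanced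
    over [K] between consecutive arguments. *)
Record multilin n (Y : lmodType k) (F : (nat -> V) -> K -> Y) : Prop := Multilin {
  ml_ext : forall g g' c, (forall i, (i < n)%N -> g i = g' i) -> F g c = F g' c;
  ml_lin : forall g c i a x y, (i < n)%N ->
    F (upd g i (a *: x + y)) c = a *: F (upd g i x) c + F (upd g i y) c;
  ml_linc : forall g, linear (F g);
  ml_bal : forall g c i a, (i.+1 < n)%N ->
    F (upd g i (ract (g i) a)) c = F (upd g i.+1 (lact a (g i.+1))) c;
  ml_balc : forall g c a i, n = i.+1 -> F (upd g i (ract (g i) a)) c = F g (a * c)
}.

(** The word [v, g 0, g 1, ...]. *)
Definition wcons (T : Type) (v : T) (g : nat -> T) : nat -> T :=
  fun i => if i is j.+1 then g j else v.

Lemma lact_tword_size n (s : seq V) c a : size s = n ->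
  lact a (tword n s c) =
    if s is x :: s' then tword n (lact a x :: s') c else tword n s (a * c).
Proof.
by case: n s => [|n] [|x s] //= _; exact: lact_otimes.
Qed.

Lemma tword_cons n (u : nat -> V) c : tword n.+1 (mkseq u n.+1) c =
  otimes (u 0%N) (tword n (mkseq (fun i => u i.+1) n) c).
Proof. by rewrite /mkseq /= -[1%N]addn0 iotaDl -map_comp. Qed.

(** The universal property of the tensor power; see also [multilin_tword]. *)
Lemma tpow_lift_ex n (Y : lmodType k) (F : (nat -> V) -> K -> Y) :
  multilin n F -> exists G : {linear tpow V n -> Y},
    forall g c, G (tword n (mkseq g n) c) = F g c.
Proof.
elim: n F => [|n IHn] F mF.
  have [G GE] := linear_ext (ml_linc mF (fun=> 0)).
  by exists G => g c; rewrite GE; apply: (ml_ext mF).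
have updS v g i x : (fun j => wcons v (upd g i x) j) =1 upd (wcons v g) i.+1 x.
  by case.
have mFv v : multilin n (fun g => F (wcons v g)).
  split.
  - by move=> g g' c h; apply: (ml_ext mF) => -[|i] //; apply: h.
  - move=> g c i a x y lin.
    have e z : F (wcons v (upd g i z)) c = F (upd (wcons v g) i.+1 z) c.
      by apply: (ml_ext mF) => j _; apply: updS.
    by rewrite !e (ml_lin mF).
  - by move=> g; apply: (ml_linc mF).
  - move=> g c i a lin.
    have e j z : F (wcons v (upd g j z)) c = F (upd (wcons v g) j.+1 z) c.
      by apply: (ml_ext mF) => l _; apply: updS.
    by rewrite !e; apply: (ml_bal mF (wcons v g)).
  - move=> g c a i ni.
    have e z : F (wcons v (upd g i z)) c = F (upd (wcons v g) i.+1 z) c.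
      by apply: (ml_ext mF) => l _; apply: updS.
    by rewrite e; apply: (@ml_balc _ _ _ mF (wcons v g)); rewrite ni.
pose G v := projT1 (cid (IHn _ (mFv v))).
have GE v g c : G v (tword n (mkseq g n) c) = F (wcons v g) c.
  by rewrite /G; case: cid.
have Gs v s c : size s = n -> G v (tword n s c) = F (wcons v (nth 0 s)) c.
  move=> ss; rewrite -GE; congr (G v (tword n _ c)).
  by rewrite -ss mkseq_nth.
have upd0 (v x : V) g : (fun j => wcons x g j) =1 upd (wcons v g) 0 x by case.
have w0 v x g c : F (wcons x g) c = F (upd (wcons v g) 0 x) c.
  by apply: (ml_ext mF) => l _; apply: upd0.
have [|||H HE] := @tens_lift_ex V (tpow V n) Y (fun v u => G v u).
- move=> u a x y; pose g : {linear tpow V n -> Y} := (a \*: G x) \+ G y.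
  apply: (tpow_ext (f := G (a *: x + y)) (g := g)) => s c ss /=.
  rewrite !Gs // (w0 0) (w0 0 x) (w0 0 y); exact: (ml_lin mF).
- by move=> v; apply: linearP.
- move=> a v u; have [l lE] := linear_ext (@lact_linearr _ _ (tpow V n) a).
  rewrite -lE; apply: (tpow_ext (f := G _) (g := G v \o l)) => s c ss /=.
  rewrite lE (lact_tword_size _ _ ss).
  case: s ss => [|x s] ss; rewrite !Gs // (w0 v).
    exact: (@ml_balc _ _ _ mF (wcons v (nth 0 [::])) c a 0%N (congr1 S (esym ss))).
  have lin : (1 < n.+1)%N by rewrite -ss.
  have := @ml_bal _ _ _ mF (wcons v (nth 0 (x :: s))) c 0%N a lin => /= ->.
  by apply: (ml_ext mF) => -[|[|j]].
exists H => g c.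
have -> : tword n.+1 (mkseq g n.+1) c =
    otimes (g 0) (tword n (mkseq (fun i => g i.+1) n) c).
  by rewrite /mkseq /= -[1%N]addn0 iotaDl -map_comp.
by rewrite HE GE; apply: (ml_ext mF) => -[|i].
Qed.

Lemma multilin_tword n :
  @multilin n (tpow V n) (fun u c => tword n (mkseq u n) c).
Proof.
have updS (u : nat -> V) i x m :
    mkseq (fun j => upd u i.+1 x j.+1) m = mkseq (upd (fun j => u j.+1) i x) m.
  by apply: eq_mkseq => j; rewrite /upd eqSS.
elim: n => [|n IHn]; first by split=> // g a x y.
have [o oE] : exists o : V -> {linear tpow V n -> tens V (tpow V n)},
    forall v w, o v w = otimes v w.
  pose o v := projT1 (cid (linear_ext (@otimes_linr V (tpow V n) v))).
  by exists o => v; rewrite /o; case: cid.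
split.
- move=> g g' c h; rewrite !tword_cons h //.
  by rewrite (ml_ext IHn c (g' := fun i => g' i.+1)) // => i li; apply: h.
- move=> g c [|i] a x y li; rewrite !tword_cons.
    by rewrite /upd /= otimes_linl.
  by rewrite !updS (ml_lin IHn) // -!oE linearP.
- move=> g a x y; rewrite !tword_cons.
  by rewrite (ml_linc IHn) -!oE linearP.
- move=> g c [|i] a li; rewrite !tword_cons.
    rewrite /upd /= otimes_bal; congr otimes.
    by case: n li {IHn o oE} => [//|n] li; rewrite !tword_cons lact_otimes.
  by rewrite !updS (ml_bal IHn (fun j => g j.+1)).
- move=> g c a i ni; rewrite !tword_cons.
  case: i ni => [|i] [ni]; last first.
    by rewrite !updS (ml_balc IHn (fun j => g j.+1)).
  by rewrite /upd /= otimes_bal; congr otimes; rewrite ni.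
Qed.

End Power.

Lemma cyc_lift_ex (V : bimod K) (Y : lmodType k) (F : {linear V -> Y}) :
  (forall a v, F (ract v a) = F (lact a v)) ->
  exists G : {linear cyc V -> Y}, forall v, G (cycpi V v) = F v.
Proof.
move=> h; apply: qlift_ex => x /spanP; elim=> {x} [_ [v [a ->]]||c x y _ hx _ hy].
- by rewrite linearB /= h subrr.
- exact: linear0.
- by rewrite linearP hx hy scaler0 addr0.
Qed.

Lemma cyc_ext (V : bimod K) (Y : lmodType k) (f g : {linear cyc V -> Y}) :
  (forall v, f (cycpi V v) = g (cycpi V v)) -> forall u, f u = g u.
Proof. by move=> h u; have [v ->] := qpi_surj u; apply: h. Qed.

Lemma cycpi_comm (V : bimod K) v a : cycpi V (ract v a) = cycpi V (lact a v).
Proof. by apply/qpi_eq/spanP/in_span_gen; exists v, a. Qed.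

End Tensors.

(** * The universal property of the normalized Hochschild modules *)

Section HochschildLift.
Variables (k : comNzRingType) (K R : algType k) (f : {lrmorphism K -> R}).

(** The class of [g 0 (x) ... (x) g n] in the normalized Hochschild module. *)
Definition hw n (g : nat -> R) : hochschild f n := hword f n (mkseq g n.+1).

(** The cyclic successor in [0 .. n]. *)
Definition csucc (n i : nat) : nat := if i == n then 0%N else i.+1.

(** [F] is a function of the words [g 0 ... g n] that is [k]-multilinear and
    balanced over [K], including between the last letter and the first. *)
Record cmf n (Y : lmodType k) (F : (nat -> R) -> Y) : Prop := Cmf {
  cm_ext : forall g g', (forall i, (i <= n)%N -> g i = g' i) -> F g = F g';
  cm_lin : forall g i c x y, (i <= n)%N ->
    F (upd g i (c *: x + y)) = c *: F (upd g i x) + F (upd g i y);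
  cm_bal : forall g i a, (i <= n)%N ->
    F (upd g i (g i * f a)) = F (upd g (csucc n i) (f a * g (csucc n i)))
}.

(** [F] vanishes on the words with a letter from [K] in a position [>= m]. *)
Definition van (m n : nat) (Y : lmodType k) (F : (nat -> R) -> Y) : Prop :=
  forall g i a, (m <= i <= n)%N -> F (upd g i (f a)) = 0.

Lemma barP x y : bar f x = bar f y -> exists a, x = f a + y.
Proof.
by move/qpi_eq => /asboolP [a e]; exists a; rewrite e subrK.
Qed.

Lemma bar_linear : linear (bar f).
Proof. exact: qpi_linear. Qed.

Section CmfTheory.
Variables (n : nat) (Y : lmodType k) (F : (nat -> R) -> Y).
Hypothesis cF : cmf n F.

Lemma cm_add g i x y : (i <= n)%N -> F (upd g i (x + y)) = F (upd g i x) + F (upd g i y).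
Proof. by move=> lin; have := cm_lin cF g 1 x y lin; rewrite !scale1r. Qed.
Lemma cm_zero g i : (i <= n)%N -> F (upd g i 0) = 0.
Proof.
move=> lin; have := cm_lin cF g (-1) 0 0 lin.
by rewrite scaler0 addr0 scaleN1r addNr.
Qed.
Lemma cm_sub g i x y : (i <= n)%N -> F (upd g i (x - y)) = F (upd g i x) - F (upd g i y).
Proof.
move=> lin; have := cm_lin cF g (-1) y x lin.
by rewrite !scaleN1r addrC => ->; rewrite addrC.
Qed.
Lemma upd_id (T : Type) (g : nat -> T) i : upd g i (g i) =1 g.
Proof. by move=> j; rewrite /upd; case: eqP => // ->. Qed.
Lemma cm_upd g i : F (upd g i (g i)) = F g.
Proof. by apply: (cm_ext cF) => j _; apply: upd_id. Qed.
Lemma cm_eq0 g i : (i <= n)%N -> g i = 0 -> F g = 0.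
Proof. by move=> lin g0; rewrite -(cm_upd g i) g0 cm_zero. Qed.
Lemma van_eq0 m g i a : van m n F -> (m <= i <= n)%N -> g i = f a -> F g = 0.
Proof. by move=> vF lin ga; rewrite -(cm_upd g i) ga vF. Qed.

Hypothesis vF : van 1 n F.

(** If [F] vanishes on degenerate words, then it depends on the letters in
    positive positions only through their classes modulo [K]. *)
Lemma van_bar1 g i x y : (0 < i <= n)%N -> bar f x = bar f y ->
  F (upd g i x) = F (upd g i y).
Proof.
move=> /[dup] li /andP[_ lin] /barP [a ->].
by rewrite cm_add // vF // add0r.
Qed.

Lemma van_bar g g' : g 0%N = g' 0%N ->
  (forall i, (0 < i <= n)%N -> bar f (g i) = bar f (g' i)) -> F g = F g'.
Proof.
move=> g0 gg; pose hyb j : nat -> R := fun i => if (i < j)%N then g i else g' i.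
(* [hyb j] has the letters of [g] before [j] and those of [g'] from [j] on *)
have step j : (0 < j <= n)%N -> F (hyb j) = F (hyb j.+1).
  move=> lj.
  have -> : F (hyb j) = F (upd (hyb j) j (g' j)).
    by apply: (cm_ext cF) => i _; rewrite /upd /hyb; case: eqP => // ->; rewrite ltnn.
  have -> : F (hyb j.+1) = F (upd (hyb j) j (g j)).
    apply: (cm_ext cF) => i _; rewrite /upd /hyb ltnS leq_eqVlt.
    by case: eqP => // ->.
  by apply/esym/van_bar1/gg.
have e0 : F g' = F (hyb 1%N) by apply: (cm_ext cF) => -[|i].
have en : F g = F (hyb n.+1) by apply: (cm_ext cF) => i; rewrite /hyb ltnS => ->.
rewrite e0 en; have : (n < n.+1)%N by [].
elim: {-2}n => // j IHj lj; rewrite -step; last exact: lj.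
by apply: IHj; apply: ltnW.
Qed.
End CmfTheory.

Lemma hw_ext n g g' : (forall i, (i <= n)%N -> g i = g' i) -> hw n g = hw n g'.
Proof.
move=> gg; congr (hword f n _); apply/eq_in_map => i.
by rewrite mem_iota add0n => /andP[_ li]; apply: gg.
Qed.

(** The class of [x (x) u]. *)
Definition hcls n (x : R) (u : tpow (algbar f) n) : hochschild f n :=
  cycpi _ (otimes (x : algK f) u).

Lemma hcls_linl n (u : tpow (algbar f) n) : linear (fun x => hcls x u).
Proof. by move=> c x y; rewrite /hcls (@otimes_linl _ _ (algK f)) linearP. Qed.
Lemma hcls_linr n x : linear (@hcls n x).
Proof.
by move=> c u v; rewrite /hcls (@otimes_linr _ _ (algK f) (tpow (algbar f) n)) linearP.
Qed.
Lemma hcls_bal n x a (u : tpow (algbar f) n) : hcls (x * f a) u = hcls x (lact a u).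
Proof. by rewrite /hcls -otimes_bal. Qed.
Lemma hcls_cyc n x a (u : tpow (algbar f) n) : hcls x (ract u a) = hcls (f a * x) u.
Proof. by rewrite /hcls -ract_otimes cycpi_comm lact_otimes. Qed.

Lemma hwE n g : hw n g =
  hcls (g 0%N) (tword n (mkseq (fun i => bar f (g i.+1)) n) 1).
Proof.
have e : map (bar f) (behead (mkseq g n.+1)) = mkseq (fun i => bar f (g i.+1)) n.
  by rewrite /mkseq -[iota 0 n.+1]/(0%N :: iota (1 + 0) n) iotaDl -!map_comp.
by rewrite /hw /hword e.
Qed.

Lemma cmf_hw n : cmf n (hw n).
Proof.
have mt := @multilin_tword k K (algbar f) n.
have bu g i x : mkseq (fun j => bar f (upd g i.+1 x j.+1)) n =
    mkseq (upd (fun j => bar f (g j.+1)) i (bar f x)) n.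
  by apply: eq_mkseq => j; rewrite /upd eqSS; case: eqP.
have bu0 g x : mkseq (fun j => bar f (upd g 0 x j.+1)) n =
    mkseq (fun j => bar f (g j.+1)) n by apply: eq_mkseq.
have u0 (g : nat -> R) x : upd g 0 x 0%N = x by [].
have uS (g : nat -> R) i x : upd g i.+1 x 0%N = g 0%N by [].
split.
- exact: hw_ext.
- move=> g [|i] c x y li; rewrite !hwE.
    by rewrite !bu0 !u0 hcls_linl.
  by rewrite !bu bar_linear (ml_lin mt) // !uS hcls_linr.
- move=> g i a; rewrite leq_eqVlt => /predU1P[->|li].
    rewrite /csucc eqxx !hwE bu0 u0 -hcls_cyc ract_tword mul1r.
    case: n bu {bu0} mt => [|m] bu mt.
      rewrite u0 hcls_bal (@lact_tword_size _ _ (algbar f) 0 [::] 1 a erefl).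
      by rewrite (mulr1 a).
    rewrite uS (bu g m (g m.+1 * f a)) -(ract_bar f a (g m.+1)).
    by rewrite (@ml_balc _ _ _ _ _ _ mt (fun j => bar f (g j.+1)) 1 a m erefl) (mulr1 a).
  have -> : csucc n i = i.+1 by rewrite /csucc ltn_eqF.
  rewrite !hwE; case: i li => [|i] li.
    rewrite u0 uS bu0 (bu g 0%N (f a * g 1%N)) -(lact_bar f a (g 1%N)) hcls_bal.
    congr (hcls _ _).
    by case: n li {bu bu0} mt => [//|n] li mt; rewrite !tword_cons lact_otimes.
  rewrite !uS (bu g i) (bu g i.+1) -(ract_bar f a (g i.+1)) -(lact_bar f a (g i.+2)).
  by rewrite (ml_bal mt (fun j => bar f (g j.+1))).
Qed.

Lemma van_hw n : van 1 n (hw n).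
Proof.
move=> g [//|i] a /andP[_ li].
have fa0 : bar f (f a) = 0 by apply/qpi_eq0/asboolP; exists a.
rewrite -(cm_zero (cmf_hw n) g li) !hwE.
congr (hcls _ (tword _ _ _)); apply: eq_mkseq => j.
rewrite /upd; case: eqP => // _; rewrite fa0.
by apply/esym/qpi_eq0/asboolP; exists 0; rewrite linear0.
Qed.

(** Words generate the normalized Hochschild modules. *)
Lemma hoch_ext n (Y : lmodType k) (F G : {linear hochschild f n -> Y}) :
  (forall g, F (hw n g) = G (hw n g)) -> forall z, F z = G z.
Proof.
move=> h; apply: cyc_ext => u.
pose q := cycpi (tens (algK f) (tpow (algbar f) n)).
apply: (tens_ext (f := F \o q) (g := G \o q)) => v w.
have [l lE] := linear_ext (@otimes_linr _ _ (algK f) (tpow (algbar f) n) v).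
rewrite -lE; apply: (tpow_ext (f := (F \o q) \o l) (g := (G \o q) \o l)) => s c ss.
change (F (q (l (tword n s c))) = G (q (l (tword n s c)))); rewrite lE.
(* the coefficient in [K] is moved around the cycle into the first letter *)
have -> : tword n s c = ract (tword n s 1) c by rewrite ract_tword mul1r.
rewrite -ract_otimes /q cycpi_comm lact_otimes.
have [t [st ts]] : exists t : seq R, size t = n /\ s = map (bar f) t.
  exists (map (fun u => projT1 (qpi_surj u)) s); rewrite size_map ss; split=> //.
  rewrite -map_comp -[LHS]map_id; apply: eq_map => x /=.
  by case: (qpi_surj x).
have := h (nth 0 ((f c * v) :: t)); rewrite /hw -[X in mkseq _ X.+1]st.
by rewrite (mkseq_nth 0 (f c * v :: t)) /hword /= ts.
Qed.

(** Conversely, every balanced multilinear function of words that vanishes on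
    the degenerate ones factors through the normalized Hochschild module. *)
Lemma hoch_lift_ex n (Y : lmodType k) (F : (nat -> R) -> Y) :
  cmf n F -> van 1 n F ->
  exists G : {linear hochschild f n -> Y}, forall g, G (hw n g) = F g.
Proof.
move=> cF vF.
(* letters of [R / K] are lifted to [R]; [F] does not see the choice *)
pose rep (u : algbar f) : R := projT1 (qpi_surj u).
have repK u : bar f (rep u) = u by rewrite /rep; case: (qpi_surj u).
pose F1 (v : R) (u : nat -> algbar f) (c : K) := F (wcons (f c * v) (rep \o u)).
have F1u v u i x c : F1 v (upd u i x) c = F (upd (wcons (f c * v) (rep \o u)) i.+1 (rep x)).
  by apply: (cm_ext cF) => -[|j] //=; rewrite /upd eqSS; case: eqP.
have F10 v x u c : F1 x u c = F (upd (wcons v (rep \o u)) 0 (f c * x)).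
  by apply: (cm_ext cF) => -[|j].
have mF1 v : multilin n (F1 v).
  split.
  - by move=> g g' c h; apply: (cm_ext cF) => -[|i] //= li; rewrite h.
  - move=> g c i a x y li; rewrite !F1u -(cm_lin cF) //.
    apply: (van_bar1 cF vF) => //.
    by rewrite bar_linear !repK.
  - move=> g a x y; rewrite !(F10 0) linearP mulrDl -scalerAl.
    exact: (cm_lin cF).
  - move=> g c i a li; rewrite !F1u.
    set g' := wcons _ _.
    rewrite (@van_bar1 _ _ _ cF vF _ _ (rep _) (g' i.+1 * f a)) //; last 2 first.
    + exact: ltnW li.
    + by rewrite -ract_bar !repK.
    rewrite (cm_bal cF) ?(ltnW li) // /csucc ltn_eqF //.
    apply: (van_bar1 cF vF) => //.
    by rewrite -lact_bar !repK.
  - move=> g c a i ni; rewrite F1u.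
    set g' := wcons _ _.
    rewrite (@van_bar1 _ _ _ cF vF _ _ (rep _) (g' i.+1 * f a)) //; last 2 first.
    + by rewrite ni ltnSn.
    + by rewrite -ract_bar !repK.
    rewrite (cm_bal cF) ?ni // /csucc eqxx (F10 (f c * v)).
    by rewrite rmorphM -mulrA.
pose G v := projT1 (cid (tpow_lift_ex (mF1 v))).
have GE v s c : size s = n -> G v (tword n s c) = F1 v (nth 0 s) c.
  move=> ss; rewrite /G; case: cid => H /= <-; congr (H (tword n _ c)).
  by rewrite -ss mkseq_nth.
have [|||H HE] := @tens_lift_ex _ _ (algK f) (tpow (algbar f) n) Y (fun v u => G v u).
- move=> u a x y; pose g : {linear tpow (algbar f) n -> Y} := (a \*: G x) \+ G y.
  apply: (tpow_ext (f := G (a *: x + y)) (g := g)) => s c ss /=.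
  rewrite !GE // !(F10 0) mulrDr -scalerAr; exact: (cm_lin cF).
- by move=> v; apply: linearP.
- move=> a v u; have [l lE] := linear_ext (@lact_linearr _ _ (tpow (algbar f) n) a).
  rewrite -lE; apply: (tpow_ext (f := G _) (g := G v \o l)) => s c ss /=.
  rewrite lE (lact_tword_size _ _ ss).
  have e : F1 (v * f a) (nth 0 s) c =
      F (upd (wcons (f c * v) (rep \o nth 0 s)) 0 ((f c * v) * f a)).
    by rewrite (F10 (f c * v)) mulrA.
  have := @cm_bal _ _ _ cF (wcons (f c * v) (rep \o nth 0 s)) 0 a isT.
  case: s ss e => [|x s] ss; rewrite !GE // => -> /= ->.
    by rewrite /csucc -ss /= (F10 (f c * v)) rmorphM mulrA.
  have -> : csucc n 0 = 1%N by rewrite -ss.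
  have -> : F1 v (nth 0 (lact a x :: s)) c = F1 v (upd (nth 0 (x :: s)) 0 (lact a x)) c.
    by apply: (cm_ext cF) => -[|[|j]].
  rewrite F1u; apply: (van_bar1 cF vF); first by rewrite -ss.
  by rewrite -lact_bar !repK.
have [|H' HE'] := @cyc_lift_ex _ _ _ _ H.
  move=> a; have [l lE] := linear_ext (@lact_linearr _ _ (tens (algK f) (tpow (algbar f) n)) a).
  have [r rE] := linear_ext (@ract_linearl _ _ (tens (algK f) (tpow (algbar f) n)) a).
  move=> u; rewrite -lE -rE; apply: (tens_ext (f := H \o r) (g := H \o l)) => v w /=.
  rewrite lE rE ract_otimes lact_otimes !HE.
  have [r' rE'] := linear_ext (@ract_linearl _ _ (tpow (algbar f) n) a).
  rewrite -rE'; apply: (tpow_ext (f := G _ \o r') (g := G _)) => s c ss /=.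
  by rewrite rE' ract_tword !GE // /F1 rmorphM mulrA.
exists H' => g; rewrite /hw /hword HE' HE GE; last by rewrite size_map size_behead size_mkseq.
apply: (van_bar cF vF); first by rewrite /= rmorph1 mul1r.
case=> // i li /=; rewrite repK (nth_map 0); last by rewrite size_map size_iota.
have := nth_mkseq 0 g (n := n.+1) (i := i.+1) li; by rewrite /mkseq /= => ->.
Qed.

End HochschildLift.

Arguments van_hw {k K R} f n g i a _.

(** The universal property of the modules [H n] of classes [word n g] of words;
    it characterizes the normalized Hochschild modules. *)
Record words (k : comNzRingType) (K R : algType k) (f : {lrmorphism K -> R})
    (H : nat -> lmodType k) := Words {
  word n : (nat -> R) -> H n;
  cmf_word n : cmf f n (word n);
  van_word n : van f 1 n (word n);
  word_ext n (Y : lmodType k) (F G : {linear H n -> Y}) :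
    (forall g, F (word n g) = G (word n g)) -> forall z, F z = G z;
  word_lift n (Y : lmodType k) (F : (nat -> R) -> Y) : cmf f n F -> van f 1 n F ->
    exists G : {linear H n -> Y}, forall g, G (word n g) = F g
}.
Arguments word {k K R f H} _ n g.
Arguments van_word {k K R f H} _ n g i a _.

Definition hoch_words (k : comNzRingType) (K R : algType k)
    (f : {lrmorphism K -> R}) : words f (hochschild f) :=
  Words (@cmf_hw k K R f) (van_hw f) (@hoch_ext k K R f) (@hoch_lift_ex k K R f).

(** * Rotations and faces of words *)

(** [weq] proves equalities between products of letters up to equal indices;
    [wcase] first decides all the index comparisons. *)
Ltac weq := first
  [ reflexivity | lia
  | match goal with
    | |- GRing.mul ?a ?b = GRing.mul ?c ?d =>
        apply (f_equal2 (@GRing.mul _) (x1 := a) (y1 := c) (x2 := b) (y2 := d)); weq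
    | |- ?g ?a = ?g ?b => apply (f_equal g); weq
    end ].
Ltac wcase := repeat (match goal with
    | |- context[if ?b then _ else _] => let E := fresh "E" in case E: b
    end); first [exfalso; lia | weq | idtac].

Section Words.
Variables (R : nzRingType) (phi : R -> R).
Hypothesis phiM : {morph phi : x y / x * y}.
Implicit Types (g : nat -> R) (n m i j l : nat).

(** The rotated word [q (g n), g 0, ..., g (n - 1)]. *)
Definition rot1 n (q : R -> R) g : nat -> R := wcons (q (g n)) g.

Lemma rot1E n q g l : rot1 n q g l = if l == 0%N then q (g n) else g l.-1.
Proof. by case: l. Qed.

(** The [i]-th iterate of [rot1 n q], for [i <= n + 1]. *)
Definition rt n (q : R -> R) i g : nat -> R :=
  fun l => if (l < i)%N then q (g (n.+1 - i + l)%N) else g (l - i)%N.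

(** The [j]-th face of a word of [n + 2] letters; the last face,
    [q (g (n + 1)) * g 0, g 1, ..., g n], is twisted by [q]. *)
Definition face n (q : R -> R) j g : nat -> R := fun i =>
  if j == n.+1 then (if i == 0%N then q (g n.+1) * g 0%N else g i)
  else if (i < j)%N then g i else if i == j then g j * g j.+1 else g i.+1.

Lemma rt0 n q g : rt n q 0 g =1 g.
Proof. by move=> l; rewrite /rt ltn0 subn0. Qed.

Lemma rtS n q i g l : (i <= n)%N -> (l <= n)%N ->
  rt n q i.+1 g l = rot1 n q (rt n q i g) l.
Proof.
move=> li; case: l => [|l] ll; rewrite /rt /rot1 /=; wcase.
Qed.

Lemma rtSr n q i g l : (i <= n)%N -> (l <= n)%N ->
  rt n q i.+1 g l = rt n q i (rot1 n q g) l.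
Proof. by move=> li ll; rewrite /rt !rot1E; wcase. Qed.

Lemma rt_full n q g l : (l <= n)%N -> rt n q n.+1 g l = q (g l).
Proof. by move=> ll; rewrite /rt; wcase. Qed.

Lemma face_rt_le m i j g l : (i <= j)%N -> (j <= m)%N -> (l <= m)%N ->
  face m phi j (rt m.+1 phi i g) l = rt m phi i (face m phi (j - i) g) l.
Proof. by move=> lij ljm llm; rewrite /face /rt; wcase. Qed.

Lemma face_rt_gt m i j g l : (j < i)%N -> (i <= m.+1)%N -> (l <= m)%N ->
  face m phi j (rt m.+1 phi i g) l =
  rt m phi i.-1 (face m phi (m.+2 - i + j) g) l.
Proof.
by move=> lij lim llm; rewrite /face /rt; wcase; rewrite ?phiM; weq.
Qed.

Lemma face_face m i j g l : (i < j)%N -> (j <= m.+2)%N -> (l <= m)%N ->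
  face m phi i (face m.+1 phi j g) l = face m phi j.-1 (face m.+1 phi i g) l.
Proof.
move=> lij ljm llm; rewrite /face; wcase; rewrite -?mulrA ?phiM -?mulrA; try weq.
Qed.

Lemma face_rot0 n q g l : (l <= n)%N -> face n q n.+1 g l = face n q 0 (rot1 n.+1 q g) l.
Proof. by move=> ll; rewrite /face eqxx; case: l ll => [|l]. Qed.

Lemma face_cons0 n q y l : face n q 0 (wcons 1 y) l = y l.
Proof. by rewrite /face /=; case: l => [|l] //=; rewrite mul1r. Qed.

Lemma face_consS m q j y l : (j <= m)%N ->
  face m.+1 q j.+1 (wcons 1 y) l = wcons 1 (face m q j y) l.
Proof. by move=> lj; rewrite /face; case: l => [|l] /=; wcase. Qed.

Lemma face_cons_last n q y l : (l <= n)%N ->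
  face n q n.+1 (wcons 1 y) l = rot1 n q y l.
Proof. by rewrite /face eqxx; case: l => [|l] //= _; rewrite mulr1. Qed.

End Words.

(** * Balanced multilinear functions of words *)

Section Closure.
Variables (k : comNzRingType) (K R : algType k) (f : {lrmorphism K -> R}).
Variable (Y : lmodType k).
Local Notation cmf := (cmf f).
Local Notation van := (van f).
Implicit Types (g : nat -> R) (n m i j l : nat) (F : (nat -> R) -> Y).

(** A [k]-linear map of [K]-bimodules from [R] to itself. *)
Record bilin (q : R -> R) : Prop := Bilin {
  bl_lin : linear q;
  bl_l : forall a x, q (f a * x) = f a * q x;
  bl_r : forall a x, q (x * f a) = q x * f a
}.

Lemma cmf_rot1 n q F : bilin q -> cmf n F -> cmf n (fun g => F (rot1 n q g)).
Proof.
move=> bq cF.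
have updn g x : F (rot1 n q (upd g n x)) = F (upd (rot1 n q g) 0 (q x)).
  apply: (cm_ext cF) => -[|j] lj; first by rewrite /rot1 /upd /= eqxx.
  by rewrite /rot1 /upd /=; case: eqP => // jn; rewrite jn ltnn in lj.
have updi g i x : (i < n)%N -> F (rot1 n q (upd g i x)) = F (upd (rot1 n q g) i.+1 x).
  move=> li; apply: (cm_ext cF) => -[|j] lj; rewrite /rot1 /upd //=.
  by case: eqP => // ni; rewrite -ni ltnn in li.
split.
- move=> g g' h; apply: (cm_ext cF) => -[|i] li; rewrite /rot1 /= h //.
  exact: ltnW.
- move=> g i c x y; rewrite leq_eqVlt => /predU1P[->|li].
    by rewrite !updn (bl_lin bq) (cm_lin cF).
  by rewrite !updi // (cm_lin cF).
- move=> g i a; rewrite leq_eqVlt => /predU1P[->|li].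
    rewrite updn (bl_r bq) /csucc eqxx.
    have -> : q (g n) = rot1 n q g 0 by [].
    rewrite (cm_bal cF) //; case: n cF updn updi => [|n] cF updn updi.
      by rewrite updn (bl_l bq).
    by rewrite updi.
  have -> : csucc n i = i.+1 by rewrite /csucc ltn_eqF.
  rewrite updi //.
  have -> : g i = rot1 n q g i.+1 by [].
  rewrite (cm_bal cF) // /csucc; case: (eqVneq i.+1 n) => [ni|ni].
    by rewrite ni updn (bl_l bq).
  by rewrite updi // ltn_neqAle ni.
Qed.

Lemma rot1_upd_lt n q g i x l : (i < n)%N ->
  rot1 n q (upd g i x) l = upd (rot1 n q g) i.+1 x l.
Proof.
move=> li; rewrite /rot1 /upd; case: l => [|l] //=.
by case: eqP => // ni; rewrite -ni ltnn in li.
Qed.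

Lemma rot1_upd_n n q g x l : (l <= n)%N ->
  rot1 n q (upd g n x) l = upd (rot1 n q g) 0 (q x) l.
Proof.
case: l => [|l] ll; rewrite /rot1 /upd /= ?eqxx //.
by case: eqP => // ln; rewrite ln ltnn in ll.
Qed.

Lemma van_rot1 n q F : cmf n F -> (forall a, q (f a) = f a) ->
  van 0 n F -> van 0 n (fun g => F (rot1 n q g)).
Proof.
move=> cF qf vF g i a; rewrite /= leq_eqVlt => /predU1P[->|li].
  by rewrite (cm_ext cF (rot1_upd_n q g _)) qf vF.
by rewrite (cm_ext cF (fun l _ => rot1_upd_lt q g _ l li)) vF.
Qed.

Lemma van_rot1_proj n q F : cmf n F -> (forall a, q (f a) = 0) ->
  van 1 n F -> van 0 n (fun g => F (rot1 n q g)).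
Proof.
move=> cF qf vF g i a; rewrite /= leq_eqVlt => /predU1P[->|li].
  by rewrite (cm_ext cF (rot1_upd_n q g _)) qf (cm_zero cF).
by rewrite (cm_ext cF (fun l _ => rot1_upd_lt q g _ l li)) vF.
Qed.

Lemma cmf_rt n q F i : bilin q -> (i <= n.+1)%N -> cmf n F ->
  cmf n (fun g => F (rt n q i g)).
Proof.
move=> bq + cF; elim: i => [|i IHi] li.
  have -> : (fun g => F (rt n q 0 g)) = F; last by [].
  by apply/funext => g; apply: (cm_ext cF) => l _; rewrite rt0.
have -> : (fun g => F (rt n q i.+1 g)) = (fun g => F (rt n q i (rot1 n q g))).
  apply/funext => g; apply: (cm_ext cF) => l ll.
  exact: rtSr.
by apply: (cmf_rot1 (F := fun g => F (rt n q i g))) => //; apply: IHi; apply: ltnW.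
Qed.

Lemma van_rt n q F i : bilin q -> (forall a, q (f a) = f a) -> (i <= n.+1)%N ->
  cmf n F -> van 0 n F -> van 0 n (fun g => F (rt n q i g)).
Proof.
move=> bq qf + cF vF; elim: i => [|i IHi] li.
  have -> : (fun g => F (rt n q 0 g)) = F; last by [].
  by apply/funext => g; apply: (cm_ext cF) => l _; rewrite rt0.
have -> : (fun g => F (rt n q i.+1 g)) = (fun g => F (rt n q i (rot1 n q g))).
  apply/funext => g; apply: (cm_ext cF) => l ll.
  exact: rtSr.
apply: (van_rot1 (F := fun g => F (rt n q i g))) => //.
  by apply: cmf_rt => //; apply: ltnW.
by apply: IHi; apply: ltnW.
Qed.

Lemma wcons_upd (g : nat -> R) i x y l :
  wcons y (upd g i x) l = upd (wcons y g) i.+1 x l.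
Proof. by case: l. Qed.

Lemma cmf_cons1 n F : cmf n.+1 F -> cmf n (fun g => F (wcons 1 g)).
Proof.
move=> cF; split.
- by move=> g g' h; apply: (cm_ext cF) => -[|i] li //; apply: h.
- move=> g i c x y li; rewrite !(cm_ext cF (fun l _ => wcons_upd g i _ 1 l)).
  exact: (cm_lin cF).
- move=> g i a li; rewrite !(cm_ext cF (fun l _ => wcons_upd g _ _ 1 l)).
  rewrite (cm_bal cF (wcons 1 g)) // /csucc eqSS; case: eqP => // _ /=.
  rewrite mulr1 -[f a in LHS]mul1r.
  exact: (cm_bal cF (wcons 1 g) (i := 0)).
Qed.

Lemma van_cons1 n F : cmf n.+1 F -> van 1 n.+1 F -> van 0 n (fun g => F (wcons 1 g)).
Proof.
by move=> cF vF g i a li; rewrite (cm_ext cF (fun l _ => wcons_upd g i _ 1 l)) vF.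
Qed.

Lemma cmf_map n q F : bilin q -> cmf n F -> cmf n (fun g => F (q \o g)).
Proof.
move=> bq cF.
have e g i x l : (q \o upd g i x) l = upd (q \o g) i (q x) l.
  by rewrite /upd /=; case: eqP.
split.
- by move=> g g' h; apply: (cm_ext cF) => i li /=; rewrite h.
- by move=> g i c x y li; rewrite !(cm_ext cF (fun l _ => e g i _ l)) (bl_lin bq) (cm_lin cF).
- move=> g i a li; rewrite !(cm_ext cF (fun l _ => e g _ _ l)) (bl_r bq) (bl_l bq).
  exact: (cm_bal cF (q \o g)).
Qed.

Lemma van_map n q F m : (forall a, q (f a) = f a) -> cmf n F -> van m n F ->
  van m n (fun g => F (q \o g)).
Proof.
move=> qf cF vF g i a li.
have e l : (q \o upd g i (f a)) l = upd (q \o g) i (f a) l.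
  by rewrite /upd /=; case: eqP.
by rewrite (cm_ext cF (fun l _ => e l)) vF.
Qed.

Lemma cmf_at n q F m : bilin q -> cmf n F -> cmf n (fun g => F (upd g m (q (g m)))).
Proof.
move=> bq cF.
have e g j x l : upd (upd g j x) m (q (upd g j x m)) l =
    upd (upd g m (q (g m))) j (if j == m then q x else x) l.
  rewrite /upd (eq_sym m j); case: (eqVneq j m) => [<-|jm]; first by case: eqP.
  by case: (eqVneq l m) => // ->; rewrite eq_sym (negPf jm).
have eF g j x := cm_ext cF (fun l _ => e g j x l).
split.
- move=> g g' h; apply: (cm_ext cF) => i li; rewrite /upd.
  by case: (eqVneq i m) => [<-|_]; rewrite h.
- move=> g i c x y li; rewrite !eF -(cm_lin cF) //.
  by case: ifP => // _; rewrite (bl_lin bq).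
- move=> g i a li; set g' := upd g m (q (g m)).
  have -> : F (upd (upd g i (g i * f a)) m (q (upd g i (g i * f a) m))) =
      F (upd g' i (g' i * f a)).
    rewrite eF; congr (F (upd _ _ _)); rewrite /g' /upd.
    by case: (eqVneq i m) => [->|//]; rewrite (bl_r bq).
  rewrite (cm_bal cF) // eF; congr (F (upd _ _ _)); rewrite /g' /upd.
  by case: (eqVneq (csucc n i) m) => [->|//]; rewrite (bl_l bq).
Qed.

Lemma van_at0 n q F : cmf n F -> van 1 n F ->
  van 1 n (fun g => F (upd g 0 (q (g 0%N)))).
Proof.
move=> cF vF g [//|i] a li.
have e l : upd (upd g i.+1 (f a)) 0 (q (upd g i.+1 (f a) 0%N)) l =
    upd (upd g 0 (q (g 0%N))) i.+1 (f a) l by case: l.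
by rewrite (cm_ext cF (fun l _ => e l)) vF.
Qed.

Lemma cmf_face_lt n q F j : (j <= n)%N -> cmf n F -> cmf n.+1 (fun g => F (face n q j g)).
Proof.
move=> lj cF.
have nj : (j == n.+1) = false by rewrite ltn_eqF.
have e1 g i x l : (i < j)%N -> face n q j (upd g i x) l = upd (face n q j g) i x l.
  by move=> lij; rewrite /face /upd nj; wcase.
have e2 g x l : face n q j (upd g j x) l = upd (face n q j g) j (x * g j.+1) l.
  by rewrite /face /upd nj; wcase.
have e3 g x l : face n q j (upd g j.+1 x) l = upd (face n q j g) j (g j * x) l.
  by rewrite /face /upd nj; wcase.
have e4 g i x l : (j < i)%N -> face n q j (upd g i.+1 x) l = upd (face n q j g) i x l.
  by move=> lij; rewrite /face /upd nj; wcase.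
split.
- move=> g g' h; apply: (cm_ext cF) => i li; rewrite /face nj.
  rewrite !h //; lia.
- move=> g i c x y li; case: (ltngtP i j) => [lij|lji|->].
  + by rewrite !(cm_ext cF (fun l _ => e1 g i _ l lij)) (cm_lin cF) //; lia.
  + case: i li lji => [//|i] li; rewrite ltnS leq_eqVlt => /predU1P[<-{i li}|lji].
      rewrite !(cm_ext cF (fun l _ => e3 g _ l)) mulrDr -scalerAr.
      by rewrite (cm_lin cF).
    by rewrite !(cm_ext cF (fun l _ => e4 g i _ l lji)) (cm_lin cF).
  + by rewrite !(cm_ext cF (fun l _ => e2 g _ l)) mulrDl -scalerAl (cm_lin cF).
- move=> g i a li.
  have fE1 i' : (i' < j)%N -> g i' = face n q j g i' by move=> h; rewrite /face nj h.
  have fE4 i' : (j < i')%N -> g i'.+1 = face n q j g i'.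
    by move=> h; rewrite /face nj; wcase.
  have fE2 : face n q j g j = g j * g j.+1 by rewrite /face nj ltnn eqxx.
  case: (ltngtP i j) => [lij|lji|->{i li}].
  + rewrite (cm_ext cF (fun l _ => e1 g i _ l lij)) fE1 // (cm_bal cF); last by lia.
    have -> : csucc n i = i.+1 by rewrite /csucc; case: eqP => //; lia.
    have -> : csucc n.+1 i = i.+1 by rewrite /csucc; case: eqP => //; lia.
    move: lij; rewrite leq_eqVlt => /predU1P[->|lij].
      by rewrite (cm_ext cF (fun l _ => e2 g _ l)) fE2 mulrA.
    by rewrite (cm_ext cF (fun l _ => e1 g i.+1 _ l lij)) -fE1.
  + case: i li lji => [//|i] li; rewrite ltnS leq_eqVlt => /predU1P[<-{i li}|lji].
      rewrite (cm_ext cF (fun l _ => e3 g _ l)) mulrA -fE2 (cm_bal cF) //.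
      rewrite /csucc eqSS; case: (eqVneq j n) => [jn|jn].
        case: j lj nj e1 e2 e3 e4 fE1 fE4 fE2 jn => [|j] lj nj e1 e2 e3 e4 fE1 fE4 fE2 jn.
          by rewrite (cm_ext cF (fun l _ => e2 g _ l)) fE2 mulrA.
        by rewrite (cm_ext cF (fun l _ => e1 g 0%N _ l isT)) -fE1.
      by rewrite (cm_ext cF (fun l _ => e4 g j.+1 _ l (ltnSn _))) -fE4.
    rewrite (cm_ext cF (fun l _ => e4 g i _ l lji)) fE4 // (cm_bal cF) //.
    rewrite /csucc eqSS; case: (eqVneq i n) => [jn|jn].
      case: j lj lji nj e1 e2 e3 e4 fE1 fE4 fE2 => [|j] lj lji nj e1 e2 e3 e4 fE1 fE4 fE2.
        by rewrite (cm_ext cF (fun l _ => e2 g _ l)) fE2 mulrA.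
      by rewrite (cm_ext cF (fun l _ => e1 g 0%N _ l isT)) -fE1.
    have lji' : (j < i.+1)%N by lia.
    by rewrite (cm_ext cF (fun l _ => e4 g i.+1 _ l lji')) -fE4.
  + rewrite (cm_ext cF (fun l _ => e2 g _ l)).
    have -> : csucc n.+1 j = j.+1 by rewrite /csucc; case: eqP => //; lia.
    by rewrite (cm_ext cF (fun l _ => e3 g _ l)) mulrA.
Qed.

Lemma cmf_face n q F j : bilin q -> (j <= n.+1)%N -> cmf n F ->
  cmf n.+1 (fun g => F (face n q j g)).
Proof.
move=> bq; rewrite leq_eqVlt => /predU1P[->|lj] cF; last exact: cmf_face_lt.
have -> : (fun g => F (face n q n.+1 g)) = (fun g => F (face n q 0 (rot1 n.+1 q g))).
  by apply/funext => g; apply: (cm_ext cF) => l; apply: face_rot0.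
apply: (cmf_rot1 (F := fun g => F (face n q 0 g))) => //.
exact: cmf_face_lt.
Qed.

Lemma cmf_sum n (I : Type) (r : seq I) (P : pred I) (c : I -> k)
    (F : I -> (nat -> R) -> Y) :
  (forall t, P t -> cmf n (F t)) ->
  cmf n (fun g => \sum_(t <- r | P t) c t *: F t g).
Proof.
move=> cF; split.
- by move=> g g' h; apply: eq_bigr => t Pt; rewrite (cm_ext (cF t Pt) h).
- move=> g j a x y lj; rewrite scaler_sumr -big_split /=; apply: eq_bigr => t Pt.
  by rewrite (cm_lin (cF t Pt)) // scalerDr !scalerA mulrC.
- by move=> g j a lj; apply: eq_bigr => t Pt; rewrite (cm_bal (cF t Pt)).
Qed.

Lemma van_sum n m (I : Type) (r : seq I) (P : pred I) (c : I -> k)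
    (F : I -> (nat -> R) -> Y) :
  (forall t, P t -> van m n (F t)) ->
  van m n (fun g => \sum_(t <- r | P t) c t *: F t g).
Proof.
by move=> vF g j a lj; apply: big1 => t Pt; rewrite vF // scaler0.
Qed.

Lemma van_weaken n F : van 0 n F -> van 1 n F.
Proof. by move=> vF g i a /andP[_ li]; apply: vF. Qed.

(** A letter from [K] in the middle of a word cancels between the two faces
    that multiply it with its neighbours. *)
Lemma van_bsum n q F : (forall a, q (f a) = f a) ->
  cmf n F -> van 1 n F ->
  van 1 n.+1 (fun g => \sum_(j < n.+2) (-1) ^+ j *: F (face n q j g)).
Proof.
move=> qf cF vF g i0 a /andP[i0_gt0 li0].
set g' := upd g i0 (f a).
have l1 : (i0.-1 < n.+2)%N by lia.
have l2 : (i0 < n.+2)%N by lia.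
rewrite (bigD1 (Ordinal l1)) //= (bigD1 (Ordinal l2)) /=; last first.
  by rewrite -val_eqE /=; case: eqP => //; lia.
rewrite [X in _ + (_ + X)]big1 ?addr0; last first.
  move=> j /andP[]; rewrite -!val_eqE /= => j1 j2.
  have lj := ltn_ord j.
  suff [l ll e] : exists2 l, (0 < l <= n)%N & face n q j g' l = f a.
    by rewrite (van_eq0 cF vF ll e) scaler0.
  exists (if (i0 < j)%N then i0 else i0.-1); first by case: (ltnP i0 j) => h; lia.
  rewrite /face /g' /upd; case: (ltnP i0 j) => h.
    have -> : (i0 == 0%N) = false by lia.
    by rewrite ?h ?eqxx; case: (j == n.+1 :> nat).
  have -> : (j == n.+1 :> nat) = false by lia.
  have -> : (i0.-1 < j)%N = false by lia.
  have -> : (i0.-1 == j) = false by lia.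
  by have -> : i0.-1.+1 == i0 by lia.
have -> : (-1) ^+ i0 = - (-1) ^+ i0.-1 :> k.
  by rewrite -{1}(prednK i0_gt0) exprS mulN1r.
rewrite scaleNr -scalerBr; apply/eqP; rewrite -[X in _ == X](scaler0 _ ((-1) ^+ i0.-1)).
apply/eqP; congr (_ *: _); apply/eqP; rewrite subr_eq0; apply/eqP.
pose g1 : nat -> R := fun l => if (l < i0)%N then g l else g l.+1.
have -> : F (face n q i0.-1 g') = F (upd g1 i0.-1 (g1 i0.-1 * f a)).
  by apply: (cm_ext cF) => l ll; rewrite /face /g' /g1 /upd; wcase.
rewrite (cm_bal cF); last by lia.
apply: (cm_ext cF) => l ll; rewrite /face /g' /g1 /upd /csucc.
case: (eqVneq i0 n.+1) => [-> /=|ni].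
  by rewrite !eqxx /= qf; wcase.
have -> : (i0.-1 == n) = false by lia.
by rewrite prednK // ltnn eqxx; wcase.
Qed.

End Closure.

(** * The Hochschild boundary and Connes' operator *)

Lemma signr_mod2 (k : pzRingType) (a b : nat) : odd a = odd b ->
  (-1) ^+ a = (-1) ^+ b :> k.
Proof. by move=> e; rewrite -signr_odd e signr_odd. Qed.

Lemma signr_double (k : pzRingType) (a b c : nat) : a = (b + c.*2)%N ->
  (-1) ^+ a = (-1) ^+ b :> k.
Proof. by move=> ->; apply: signr_mod2; rewrite oddD odd_double addbF. Qed.

Section BigSums.
Variables (k : comNzRingType) (Y : lmodType k).

(** The cancellation in the square of an alternating sum of faces. *)
Lemma alternating_square m (x : nat -> nat -> Y) :
  (forall i j, (i < j <= m)%N -> x i j = - x j.-1 i) ->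
  \sum_(j < m.+1) \sum_(i < m) x i j = 0.
Proof.
move=> hx.
have -> : \sum_(j < m.+1) \sum_(i < m) x i j =
    \sum_(j < m.+1) \sum_(i < m | (i < j)%N) x i j +
    \sum_(j < m.+1) \sum_(i < m | (j <= i)%N) x i j.
  rewrite -big_split; apply: eq_bigr => j _ /=.
  rewrite (bigID (fun i : 'I_m => (i < j)%N)) /=; congr (_ + _).
  by apply: eq_bigl => i; rewrite -leqNgt.
rewrite big_ord_recl /= big1 ?add0r; last by move=> i.
have -> : \sum_(j < m.+1) \sum_(i < m | (j <= i)%N) x i j =
   \sum_(j < m) \sum_(i < m | (j <= i)%N) x i j.
  rewrite big_ord_recr /= [X in _ + X]big1 ?addr0 // => i.
  by rewrite leqNgt ltn_ord.
rewrite (exchange_big_dep xpredT) //= -big_split big1 // => j _ /=.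
have -> : \sum_(i < m | (j < bump 0 i)%N) x j (bump 0 i) =
          - \sum_(i < m | (j <= i)%N) x i j.
  rewrite -sumrN; apply: eq_big => i; first by rewrite /bump /= add1n.
  by move=> h; rewrite hx //; have := ltn_ord i; rewrite /bump /= in h *; lia.
by rewrite addNr.
Qed.

(** Reindexing the sum over the faces of all rotations as the sum over the
    rotations of all faces; the hypotheses are those given by [face_rt_le] and
    [face_rt_gt]. *)
Lemma cyclic_square m (y z : nat -> nat -> Y) :
  (forall i j, (i <= j <= m)%N -> y i j = z i (j - i)%N) ->
  (forall i j, (j < i <= m.+1)%N -> y i j = z i.-1 (m.+2 - i + j)%N) ->
  \sum_(i < m.+2) \sum_(j < m.+1) y i j = \sum_(i < m.+1) \sum_(l < m.+2) z i l.
Proof.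
move=> h1 h2.
pose A i := \sum_(0 <= l < m.+1 - i) z i l.
pose C i := \sum_(m.+2 - i <= l < m.+2) z i.-1 l.
have rowS i : (i <= m.+1)%N -> \sum_(j < m.+1) y i j = C i + A i.
  move=> li; rewrite -(big_mkord xpredT (y i)) (@big_cat_nat _ _ _ i) //=.
  congr (_ + _); last first.
    rewrite /A -{1}[i]add0n big_addn; apply: eq_big_nat => j lj.
    by rewrite h1 ?addnK //; lia.
  rewrite /C -{1}[(m.+2 - i)%N]add0n.
  have e : (m.+2 - (m.+2 - i))%N = i by lia.
  rewrite big_addn e; apply: eq_big_nat => j lj.
  by rewrite h2 1?addnC //; lia.
have rowT i : (i <= m)%N -> \sum_(l < m.+2) z i l = A i + C i.+1.
  move=> li; rewrite -(big_mkord xpredT (z i)) (@big_cat_nat _ _ _ (m.+1 - i)) //=; lia.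
rewrite (eq_bigr (fun i : 'I_m.+2 => C i + A i)); last first.
  by move=> i _; apply: rowS; rewrite -ltnS.
rewrite [RHS](eq_bigr (fun i : 'I_m.+1 => A i + C i.+1)); last first.
  by move=> i _; apply: rowT; rewrite -ltnS.
rewrite !big_split /= addrC big_ord_recr /= [X in _ + X]big_ord_recl /=.
rewrite {2}/A subnn big_geq // addr0; congr (_ + _).
by rewrite {1}/C big_geq // add0r; apply: eq_bigr => i _; rewrite /bump.
Qed.
End BigSums.


Lemma face_untwist (R : nzRingType) n (q q' : R -> R) j g : (j <= n)%N ->
  face n q j g = face n q' j g.
Proof. by move=> lj; apply/funext => l; rewrite /face ltn_eqF. Qed.

Section Operators.
Variables (k : comNzRingType) (K R : algType k) (f : {lrmorphism K -> R}).
Variables (H : nat -> lmodType k) (W : words f H).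
Local Notation hw := (word W).
Implicit Types (g : nat -> R) (n m i j l : nat) (q : R -> R).

Lemma eq_word n g g' : (forall i, (i <= n)%N -> g i = g' i) -> hw n g = hw n g'.
Proof. exact: cm_ext (cmf_word W n) g g'. Qed.

Lemma bilin_id : bilin f id.
Proof. by split. Qed.

Lemma op_ex n m (I : finType) (c : I -> k) (w : I -> (nat -> R) -> nat -> R) :
  (forall t, cmf f n (fun g => hw m (w t g))) ->
  van f 1 n (fun g => \sum_t c t *: hw m (w t g)) ->
  exists G : {linear H n -> H m}, forall g, G (hw n g) = \sum_t c t *: hw m (w t g).
Proof.
move=> cF vF; apply: (word_lift W) vF.
by apply: (@cmf_sum k K R f _ n I _ xpredT c (fun t g => hw m (w t g))) => t _; apply: cF.
Qed.

(** The Hochschild boundary, with its last face twisted by [q]. *)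
Definition opb q n : {linear H n.+1 -> H n} :=
  the_linear (fun G => forall g, G (hw n.+1 g) =
    \sum_(j < n.+2) (-1) ^+ j *: hw n (face n q j g)).

Lemma opbE q n g : bilin f q -> (forall a, q (f a) = f a) ->
  opb q n (hw n.+1 g) = \sum_(j < n.+2) (-1) ^+ j *: hw n (face n q j g).
Proof.
move=> bq qf; rewrite /opb; set P := (X in the_linear X).
suff e : exists G, P G by exact: (the_linearP e g).
have [||G GE] := @op_ex n.+1 n _ (fun j : 'I_n.+2 => (-1) ^+ j)
  (fun j : 'I_n.+2 => face n q j); last by exists G.
    by move=> t; apply: (cmf_face bq _ (cmf_word W n)); rewrite -ltnS.
exact: (van_bsum qf (cmf_word W n) (van_word W n)).
Qed.

(** Connes' operator. *)
Definition opB n : {linear H n -> H n.+1} :=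
  the_linear (fun G => forall g, G (hw n g) =
    \sum_(i < n.+1) (-1) ^+ (n * i) *: hw n.+1 (wcons 1 (rt n id i g))).

Lemma opBE n g : opB n (hw n g) =
  \sum_(i < n.+1) (-1) ^+ (n * i) *: hw n.+1 (wcons 1 (rt n id i g)).
Proof.
rewrite /opB; set P := (X in the_linear X).
suff e : exists G, P G by exact: (the_linearP e g).
have cF : cmf f n (fun g => hw n.+1 (wcons 1 g)).
  exact: (cmf_cons1 (cmf_word W n.+1)).
have [t||G GE] := @op_ex n n.+1 _ (fun i : 'I_n.+1 => (-1) ^+ (n * i))
  (fun (i : 'I_n.+1) g => wcons 1 (rt n id i g)); last by exists G.
  exact: (cmf_rt bilin_id (ltnW (ltn_ord t)) cF).
apply: (@van_sum k K R f _ n 1 _ _ xpredT _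
  (fun (i : 'I_n.+1) g => hw n.+1 (wcons 1 (rt n id i g)))).
move=> t _; apply: van_weaken.
exact: (van_rt bilin_id (fun a => erefl) (ltnW (ltn_ord t)) cF
  (van_cons1 (cmf_word W n.+1) (van_word W n.+1))).
Qed.

(** The boundary of [1 (x) y]: the first and the last face are [y] and its
    rotation, and the other ones start with [1]. *)
Lemma opb_cons q n y : bilin f q -> (forall a, q (f a) = f a) ->
  opb q n (hw n.+1 (wcons 1 y)) =
  hw n y - \sum_(j < n) (-1) ^+ j *: hw n (wcons 1 (face n.-1 q j y))
  - (-1) ^+ n *: hw n (rot1 n q y).
Proof.
move=> bq qf; rewrite (opbE _ _ bq qf) big_ord_recl /= big_ord_recr /= scale1r addrA.
rewrite (@eq_word n _ y); last by move=> l _; apply: face_cons0.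
congr (_ + _ + _).
  rewrite -sumrN; apply: eq_bigr => j _; rewrite /bump /= add1n exprS mulN1r scaleNr.
  congr (- (_ *: _)); apply: eq_word => l _.
  by case: n y l j => [|n] y l j; [case: j|apply: face_consS; rewrite -ltnS].
rewrite /bump /= add1n exprS mulN1r scaleNr.
by congr (- (_ *: _)); apply: eq_word => l; apply: face_cons_last.
Qed.

(** The faces of the rotations of [g] are the rotations of the faces of [g]. *)
Lemma face_rotation_sum (Y : lmodType k) m q (G : (nat -> R) -> Y) g :
  {morph q : x y / x * y} ->
  (forall g g', (forall i, (i <= m)%N -> g i = g' i) -> G g = G g') ->
  \sum_(i < m.+2) \sum_(j < m.+1)
     (-1) ^+ (j + m.+1 * i) *: G (face m q j (rt m.+1 q i g)) =
  \sum_(i < m.+1) \sum_(l < m.+2)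
     (-1) ^+ (l + m * i) *: G (rt m q i (face m q l g)).
Proof.
move=> qM eG.
apply: (cyclic_square (y := fun i j => (-1) ^+ (j + m.+1 * i) *: G (face m q j (rt m.+1 q i g)))
   (z := fun i l => (-1) ^+ (l + m * i) *: G (rt m q i (face m q l g)))) => i j /andP[h1 h2].
  congr (_ *: _); last by apply: eG => l; apply: face_rt_le.
  by apply: (@signr_double _ _ _ i); rewrite mulSn; lia.
congr (_ *: _); last by apply: eG => l; apply: face_rt_gt.
case: i h1 h2 => [//|i] h1 h2; apply: (@signr_double _ _ _ i).
by rewrite mulSn mulnS /=; lia.
Qed.

Lemma opb_opb q n z : bilin f q -> (forall a, q (f a) = f a) ->
  {morph q : x y / x * y} -> opb q n (opb q n.+1 z) = 0.
Proof.
move=> bq qf qM.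
apply: (word_ext (w := W) (F := opb q n \o opb q n.+1) (G := \0)) => {z} g /=.
rewrite (opbE _ _ bq qf) linear_sum.
under eq_bigr => j _ do rewrite linearZ /= (opbE _ _ bq qf) scaler_sumr.
apply: (alternating_square (x := fun i j =>
  (-1) ^+ j *: ((-1) ^+ i *: hw n (face n q i (face n.+1 q j g))))) => i j /andP[lij lj].
rewrite (@eq_word n _ (face n q j.-1 (face n.+1 q i g))); last first.
  by move=> l ll; apply: face_face.
rewrite !scalerA -scaleNr; congr (_ *: _).
by case: j lij lj => [//|j] _ _; rewrite /= exprS mulN1r mulNr mulrC.
Qed.

Lemma opb_opB n z : opb id n.+1 (opB n.+1 z) + opB n (opb id n z) = 0.
Proof.
have [bi fi] : bilin f id /\ (forall a, id (f a) = f a) by split=> //; apply: bilin_id.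
apply: (word_ext (w := W) (F := (opb id n.+1 \o opB n.+1) \+ (opB n \o opb id n))
  (G := \0)) => {z} g /=.
rewrite opBE (opbE _ _ bi fi) !linear_sum /=.
have -> : \sum_(i < n.+2) opB n ((-1) ^+ i *: hw n (face n id i g)) =
    \sum_(i < n.+2) \sum_(j < n.+1)
       (-1) ^+ (j + n.+1 * i) *: hw n.+1 (wcons 1 (face n id j (rt n.+1 id i g))).
  rewrite (@face_rotation_sum _ n id (fun y => hw n.+1 (wcons 1 y))) //; last first.
    by move=> y y' e; apply: eq_word => -[|i] // li; apply: e.
  rewrite exchange_big /=; apply: eq_bigr => i _.
  rewrite linearZ /= opBE scaler_sumr; apply: eq_bigr => j _.
  by rewrite scalerA -exprD.
under [X in X + _ = _]eq_bigr => i _ do rewrite linearZ /= (@opb_cons id n.+1 _ bi fi).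
rewrite -big_split /=.
pose t i := (-1) ^+ (n.+1 * i) *: hw n.+1 (rt n.+1 id i g).
rewrite (eq_bigr (fun i : 'I_n.+2 => - (t i.+1 - t i))) => [|i _]; last first.
  have <- : (-1) ^+ (n.+1 * i) *: (\sum_(j < n.+1) (-1) ^+ j *:
       hw n.+1 (wcons 1 (face n id j (rt n.+1 id i g)))) =
     \sum_(j < n.+1) (-1) ^+ (j + n.+1 * i) *:
        hw n.+1 (wcons 1 (face n id j (rt n.+1 id i g))).
    by rewrite scaler_sumr; apply: eq_bigr => j _; rewrite scalerA -exprD addnC.
  rewrite opprB /t !scalerBr addrAC subrK; congr (_ - _).
  rewrite scalerA -exprD mulnS addnC; congr (_ *: _).
  by apply: eq_word => l ll; rewrite rtS // -ltnS.
rewrite sumrN -(big_mkord xpredT (fun i => t i.+1 - t i)) telescope_sumr // /t.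
rewrite muln0 (@eq_word _ (rt n.+1 id n.+2 g) g) => [|l ll]; last by rewrite rt_full.
rewrite (@eq_word _ (rt n.+1 id 0 g) g) => [|l ll]; last by rewrite rt0.
rewrite (@signr_mod2 _ (n.+1 * n.+2) 0) ?subrr ?oppr0 //.
by rewrite oddM /= negbK; case: odd.
Qed.

Lemma opb_opB0 z : opb id 0 (opB 0 z) = 0.
Proof.
apply: (word_ext (w := W) (F := opb id 0 \o opB 0) (G := \0)) => {z} g /=.
rewrite opBE big_ord1 muln0 scale1r (@opb_cons id 0 _ bilin_id (fun=> erefl)).
rewrite big_ord0 subr0 scale1r (@eq_word 0 (rot1 0 id _) (rt 0 id 0 g)) ?subrr //.
by case.
Qed.

End Operators.

(** * Operators attached to a retraction *)

Section Retraction.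
Variables (k : comNzRingType) (K R : algType k) (f : {lrmorphism K -> R}).

(** A retraction [th] of [R] onto a subalgebra that contains the image of [K];
    its kernel is a complementary ideal, with projection [compl th]. *)
Record retraction (th : R -> R) : Prop := Retraction {
  re_bilin : bilin f th;
  re_f : forall a, th (f a) = f a;
  re_M : {morph th : x y / x * y};
  re_idem : forall x, th (th x) = th x
}.

(** The projection onto the kernel of [th]. *)
Definition compl (th : R -> R) (x : R) : R := x - th x.

Variables (th : R -> R) (rth : retraction th).
Local Notation pr := (compl th).
Let bth := re_bilin rth.

Lemma reB x y : th (x - y) = th x - th y.
Proof.
have := bl_lin bth (-1) y x; rewrite !scaleN1r => e.
by rewrite [x - y]addrC e addrC.
Qed.
Lemma bilin_compl : bilin f pr.
Proof.
split.
- move=> c x y; rewrite /compl (bl_lin bth) scalerBr opprD addrACA.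
  by [].
- by move=> a x; rewrite /compl (bl_l bth) mulrBr.
- by move=> a x; rewrite /compl (bl_r bth) mulrBl.
Qed.
Lemma re_compl x : th (pr x) = 0.
Proof. by rewrite /compl reB (re_idem rth) subrr. Qed.
Lemma compl_re x : pr (th x) = 0.
Proof. by rewrite /compl (re_idem rth) subrr. Qed.
Lemma compl_f a : pr (f a) = 0.
Proof. by rewrite /compl (re_f rth) subrr. Qed.
Lemma compl_idem x : pr (pr x) = pr x.
Proof. by rewrite {1}/compl re_compl subr0. Qed.
Lemma compl_Ml x y : pr (pr x * y) = pr x * y.
Proof. by rewrite {1}/compl (re_M rth) re_compl mul0r subr0. Qed.
Lemma compl_Mr x y : pr (x * pr y) = x * pr y.
Proof. by rewrite {1}/compl (re_M rth) re_compl mulr0 subr0. Qed.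
Lemma re1 : th 1 = 1.
Proof. by rewrite -(rmorph1 f) (re_f rth). Qed.
Lemma compl1 : pr 1 = 0.
Proof. by rewrite /compl re1 subrr. Qed.

Section Telescopes.
Variables (Y : lmodType k) (n : nat) (G : (nat -> R) -> Y).
Hypothesis cG : cmf f n G.
Implicit Types (g y : nat -> R).

Lemma rot1_compl y : G (rot1 n pr y) = G (rot1 n id y) - G (rot1 n th y).
Proof.
have e q : rot1 n q y =1 upd (rot1 n id y) 0 (q (y n)) by case.
rewrite !(cm_ext cG (fun l _ => e _ l)); exact: (cm_sub cG).
Qed.

Lemma subDB (Z : zmodType) (s x z : Z) : s - (s + x - z) = z - x.
Proof. by rewrite opprB opprD addrCA addNKr. Qed.

(** A full rotation has sign [1]. *)
Lemma even_full : (-1) ^+ (n * n.+1) = 1 :> k.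
Proof. by rewrite (@signr_mod2 _ _ 0) // oddM /=; case: odd. Qed.

Lemma sum_shift (a : nat -> Y) :
  \sum_(i < n.+1) a i.+1 = \sum_(i < n.+1) a i + a n.+1 - a 0%N.
Proof.
rewrite [in RHS]big_ord_recl big_ord_recr /= [in RHS]addrC addrA addKr; congr (_ + _).
Qed.

(** Rotating by [th] what [pr] has brought to the front: the double sum
    telescopes along the diagonals to the untwisted rotations of [g], minus
    those of [th \o g]. It is the source of [h_N]. *)
Lemma telescope_left g :
  \sum_(j < n.+1) (-1) ^+ (n * j.+1) *:
    (\sum_(i < n.+1) (-1) ^+ (n * i) *: G (rt n th i (rot1 n pr (rt n id j g)))) =
  \sum_(j < n.+1) (-1) ^+ (n * j) *: G (rt n id j g)
  - \sum_(j < n.+1) (-1) ^+ (n * j) *: G (th \o rt n id j g).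
Proof.
pose a i j := (-1) ^+ (n * i + n * j) *: G (rt n th i (rt n id j g)).
have eij (j i : 'I_n.+1) : (-1) ^+ (n * j.+1) *: ((-1) ^+ (n * i) *:
    G (rt n th i (rot1 n pr (rt n id j g)))) = a i j.+1 - a i.+1 j.
  have lj := ltn_ord j; have li := ltn_ord i.
  have cGi := cmf_rt bth (ltnW li) cG.
  have -> : G (rt n th i (rot1 n pr (rt n id j g))) =
     G (rt n th i (rot1 n id (rt n id j g))) - G (rt n th i (rot1 n th (rt n id j g))).
    have e q : rot1 n q (rt n id j g) =1 upd (rot1 n id (rt n id j g)) 0 (q (rt n id j g n)).
      by case.
    by rewrite !(cm_ext cGi (fun l _ => e _ l)) (cm_sub cGi).
  rewrite scalerA -exprD addnC scalerBr; congr (_ - _).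
    by congr (_ *: _); apply: (cm_ext cGi) => l ll; rewrite rtS.
  rewrite /a mulnS mulnS addnA [(_ + n)%N]addnC; congr (_ *: _).
  by apply: (cm_ext cG) => l ll; rewrite rtSr.
under eq_bigr => j _ do rewrite scaler_sumr (eq_bigr _ (fun i _ => eij j i)) sumrB.
rewrite sumrB exchange_big /=.
under eq_bigr => i _ do rewrite (sum_shift (a i)).
under [X in _ - X]eq_bigr => j _ do rewrite (sum_shift (a ^~ j)).
have a0 i : (i <= n)%N -> a i n.+1 = a i 0%N.
  move=> li; have cGi := cmf_rt bth (leq_trans li (leqnSn n)) cG.
  rewrite /a exprD even_full muln0 addn0 mulr1; congr (_ *: _).
  by apply: (cm_ext cGi) => l ll; rewrite rt_full // rt0.
rewrite (eq_bigr (fun i : 'I_n.+1 => \sum_(j < n.+1) a i j)); last first.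
  by move=> i _; rewrite a0 ?addrK // -ltnS.
rewrite exchange_big sumrB big_split /= subDB; congr (_ - _); apply: eq_bigr => j _.
  by rewrite /a muln0 add0n; congr (_ *: _); apply: (cm_ext cG) => l ll; rewrite rt0.
rewrite /a exprD even_full mul1r; congr (_ *: _).
by apply: (cm_ext cG) => l ll; rewrite rt_full.
Qed.

(** The signed sum of all rotations is invariant under rotation. *)
Lemma cyclic_sum_rot y :
  (-1) ^+ n *: \sum_(j < n.+1) (-1) ^+ (n * j) *: G (rt n id j (rot1 n id y)) =
  \sum_(j < n.+1) (-1) ^+ (n * j) *: G (rt n id j y).
Proof.
pose a j := (-1) ^+ (n * j) *: G (rt n id j y).
rewrite scaler_sumr (eq_bigr (fun j : 'I_n.+1 => a j.+1)) => [|j _]; last first.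
  rewrite scalerA -exprD /a mulnS; congr (_ *: _).
  by apply: (cm_ext cG) => l ll; rewrite rtSr // -ltnS.
rewrite sum_shift /a even_full muln0 expr0.
rewrite (cm_ext cG (g' := y)) => [|l ll]; last by rewrite rt_full.
by rewrite (cm_ext cG (g := rt n id 0 y) (g' := y)) => [|l _]; rewrite ?addrK ?rt0.
Qed.

(** The source of [N_T]. *)
Lemma telescope_right g :
  let N y := \sum_(j < n.+1) (-1) ^+ (n * j) *: G (rt n id j y) in
  \sum_(i < n.+1) (-1) ^+ (n * i.+1) *: N (rot1 n pr (rt n th i g)) = N g - N (th \o g).
Proof.
move=> N.
have cN : cmf f n N.
  apply: (@cmf_sum k K R f Y n _ _ xpredT _ (fun (j : 'I_n.+1) y => G (rt n id j y))) => j _.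
  exact: (cmf_rt (bilin_id f) (ltnW (ltn_ord j)) cG).
pose t i := (-1) ^+ (n * i) *: N (rt n th i g).
rewrite (eq_bigr (fun i : 'I_n.+1 => - (t i.+1 - t i))) => [|i _]; last first.
  have -> : N (rot1 n pr (rt n th i g)) =
     N (rot1 n id (rt n th i g)) - N (rot1 n th (rt n th i g)).
    have e q : rot1 n q (rt n th i g) =1 upd (rot1 n id (rt n th i g)) 0 (q (rt n th i g n)).
      by case.
    by rewrite !(cm_ext cN (fun l _ => e _ l)) (cm_sub cN).
  rewrite opprB scalerBr /t; congr (_ - _).
    by rewrite mulnS addnC exprD -scalerA cyclic_sum_rot.
  by congr (_ *: _); apply: (cm_ext cN) => l ll; rewrite rtS // -ltnS.
rewrite sumrN -(big_mkord xpredT (fun i => t i.+1 - t i)) telescope_sumr // /t opprB.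
rewrite muln0 expr0 even_full !scale1r; congr (_ - _).
  by apply: (cm_ext cN) => l _; rewrite rt0.
by apply: (cm_ext cN) => l ll; rewrite rt_full.
Qed.

End Telescopes.

Section RetractionOperators.
Variables (H : nat -> lmodType k) (W : words f H).
Local Notation hw := (word W).
Implicit Types (g : nat -> R) (n m i j l : nat).

(** The operator given on words by a linear combination of word maps. *)
Definition opw n m (I : finType) (c : I -> k) (w : I -> (nat -> R) -> nat -> R) :
    {linear H n -> H m} :=
  the_linear (fun G => forall g, G (hw n g) = \sum_t c t *: hw m (w t g)).

Lemma opwE n m (I : finType) (c : I -> k) w g :
  (forall t, cmf f n (fun g => hw m (w t g))) ->
  (forall t, van f 1 n (fun g => hw m (w t g))) ->
  @opw n m I c w (hw n g) = \sum_t c t *: hw m (w t g).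
Proof.
move=> cF vF; rewrite /opw; set P := (X in the_linear X).
suff e : exists G, P G by exact: (the_linearP e g).
have [//||G GE] := @op_ex k K R f H W n m I c w; last by exists G.
apply: (@van_sum k K R f _ n 1 _ _ xpredT _ (fun t g => hw m (w t g))).
by move=> t _; apply: vF.
Qed.

(** The rotation by [i + 1] letters, of which the last [i] are projected by [th]
    and the one that becomes the first by [compl th], summed over [i]. On a word
    with letters in the image or in the kernel of [th], at most one summand
    is not zero: the last letter in the kernel is rotated to the front. *)
Definition opT n : {linear H n -> H n} :=
  opw n n (fun i : 'I_n.+1 => (-1) ^+ (n * i.+1)) (fun (i : 'I_n.+1) g => rot1 n pr (rt n th i g)).
(** The sum of all rotations, with the first letter projected onto the kernel of
    [th]. *)
Definition opN n : {linear H n -> H n} :=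
  opw n n (fun i : 'I_n.+1 => (-1) ^+ (n * i.+1)) (fun (i : 'I_n.+1) g => rot1 n pr (rt n id i g)).
(** [1 (x) -], summed over the rotations by [i <= n] letters, with these letters
    projected by [th]. *)
Definition oph n : {linear H n -> H n.+1} :=
  opw n n.+1 (fun i : 'I_n.+1 => (-1) ^+ (n * i)) (fun (i : 'I_n.+1) g => wcons 1 (rt n th i g)).
(** [th] on all letters. *)
Definition opPi n : {linear H n -> H n} :=
  opw n n (fun _ : 'I_1 => 1) (fun _ g => th \o g).
(** [compl th] on the first letter. *)
Definition opP n : {linear H n -> H n} :=
  opw n n (fun _ : 'I_1 => 1) (fun _ g => upd g 0 (pr (g 0%N))).
(** The product of the first letter with the component of the second one in
    the kernel of [th]. *)
Definition opRho n : {linear H n.+1 -> H n} :=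
  opw n.+1 n (fun _ : 'I_1 => 1) (fun=> fun g => face n id 0 (upd g 1 (pr (g 1%N)))).

Let cmf_rotpr n := cmf_rot1 bilin_compl (cmf_word W n).
Let van_rotpr n := van_rot1_proj (cmf_word W n) compl_f (van_word W n).
Let cmf_cons n := cmf_cons1 (cmf_word W n.+1).
Let van_cons n := van_cons1 (cmf_word W n.+1) (van_word W n.+1).

Lemma opTE n g : opT n (hw n g) =
  \sum_(i < n.+1) (-1) ^+ (n * i.+1) *: hw n (rot1 n pr (rt n th i g)).
Proof.
apply: opwE => i; first exact: (cmf_rt bth (ltnW (ltn_ord i)) (cmf_rotpr n)).
apply: van_weaken.
exact: (van_rt bth (re_f rth) (ltnW (ltn_ord i)) (cmf_rotpr n) (@van_rotpr n)).
Qed.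

Lemma opNE n g : opN n (hw n g) =
  \sum_(i < n.+1) (-1) ^+ (n * i.+1) *: hw n (rot1 n pr (rt n id i g)).
Proof.
apply: opwE => i.
  exact: (cmf_rt (bilin_id f) (ltnW (ltn_ord i)) (cmf_rotpr n)).
apply: van_weaken.
exact: (van_rt (bilin_id f) (fun=> erefl) (ltnW (ltn_ord i)) (cmf_rotpr n) (@van_rotpr n)).
Qed.

Lemma ophE n g : oph n (hw n g) =
  \sum_(i < n.+1) (-1) ^+ (n * i) *: hw n.+1 (wcons 1 (rt n th i g)).
Proof.
apply: opwE => i; first exact: (cmf_rt bth (ltnW (ltn_ord i)) (cmf_cons n)).
apply: van_weaken.
exact: (van_rt bth (re_f rth) (ltnW (ltn_ord i)) (cmf_cons n) (@van_cons n)).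
Qed.

Lemma opPiE n g : opPi n (hw n g) = hw n (th \o g).
Proof.
rewrite /opPi opwE ?big_ord1 ?scale1r // => _.
  exact: (cmf_map bth (cmf_word W n)).
exact: (van_map (re_f rth) (cmf_word W n) (van_word W n)).
Qed.

Lemma opPE n g : opP n (hw n g) = hw n (upd g 0 (pr (g 0%N))).
Proof.
rewrite /opP opwE ?big_ord1 ?scale1r // => _.
  exact: (cmf_at _ bilin_compl (cmf_word W n)).
exact: (van_at0 _ (cmf_word W n) (van_word W n)).
Qed.

Lemma opRhoE n g : opRho n (hw n.+1 g) = hw n (face n id 0 (upd g 1 (pr (g 1%N)))).
Proof.
rewrite /opRho opwE ?big_ord1 ?scale1r // => _.
  exact: (cmf_at 1 bilin_compl (cmf_face_lt id (leq0n n) (cmf_word W n))).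
move=> y [//|[|i]] a li.
  apply: (cm_eq0 (cmf_word W n) (i := 0)) => //.
  by rewrite /face /upd /= compl_f mulr0.
apply: (van_eq0 (cmf_word W n) (van_word W n) (i := i.+1) (a := a)) => //.
by rewrite /face /upd /= eqxx.
Qed.

End RetractionOperators.
End Retraction.

(** * Identities between the operators *)

Section Identities.
Variables (k : comNzRingType) (K R : algType k) (f : {lrmorphism K -> R}).
Variables (th : R -> R) (rth : retraction f th).
Variables (H : nat -> lmodType k) (W : words f H).
Local Notation pr := (compl th).
Local Notation hw := (word W).
Local Notation b := (opb W id).
Local Notation b0 := (opb W th).
Local Notation T := (opT th W).
Local Notation N := (opN th W).
Local Notation h := (oph th W).
Local Notation Pi := (opPi th W).
Local Notation P := (opP th W).
Local Notation B := (opB W).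
Implicit Types (g : nat -> R) (n m i j l : nat).
Let bth := re_bilin rth.
Let bi := bilin_id f.
Let fi (a : K) : id (f a) = f a := erefl.

Lemma h_telescope n g :
  \sum_(i < n.+1) (-1) ^+ (n * i) *: (hw n (rt n th i g)
     - (-1) ^+ n *: hw n (rot1 n id (rt n th i g))) =
  hw n g - T n (hw n g) - Pi n (hw n g).
Proof.
pose t i := (-1) ^+ (n * i) *: hw n (rt n th i g).
rewrite (eq_bigr (fun i : 'I_n.+1 => - (t i.+1 - t i) -
   (-1) ^+ (n * i.+1) *: hw n (rot1 n pr (rt n th i g)))) => [|i _]; last first.
  rewrite (rot1_compl th (cmf_word W n)) !scalerBr scalerA -exprD.
  have -> : t i.+1 = (-1) ^+ (n * i.+1) *: hw n (rot1 n th (rt n th i g)).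
    by congr (_ *: _); apply: eq_word => l ll; rewrite rtS // -ltnS.
  by rewrite [in RHS]opprB opprB addrA subrK mulnS addnC.
rewrite sumrB sumrN -(big_mkord xpredT (fun i => t i.+1 - t i)) telescope_sumr // /t.
rewrite opprB muln0 expr0 even_full !scale1r -(opTE rth) addrAC (opPiE rth).
by congr (_ - _ - _); apply: eq_word => l ll; rewrite ?rt0 ?rt_full.
Qed.

(** The homotopy formula. The boundary applied before [h] has its last face
    twisted by [th], since [h] projects the letters that it rotates. *)
Lemma b_h n z : b n.+1 (h n.+1 z) + h n (b0 n z) = z - T n.+1 z - Pi n.+1 z.
Proof.
apply: (word_ext (w := W) (F := (b n.+1 \o h n.+1) \+ (h n \o b0 n))
  (G := (idfun \- T n.+1) \- Pi n.+1)) => {z} g /=.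
rewrite -h_telescope (ophE rth) (opbE W _ _ bth (re_f rth)) !linear_sum /=.
have -> : \sum_(i < n.+2) h n ((-1) ^+ i *: hw n (face n th i g)) =
    \sum_(i < n.+2) \sum_(j < n.+1)
       (-1) ^+ (j + n.+1 * i) *: hw n.+1 (wcons 1 (face n id j (rt n.+1 th i g))).
  transitivity (\sum_(i < n.+2) \sum_(j < n.+1)
       (-1) ^+ (j + n.+1 * i) *: hw n.+1 (wcons 1 (face n th j (rt n.+1 th i g)))).
    rewrite (@face_rotation_sum _ _ _ n th (fun y => hw n.+1 (wcons 1 y)) g (re_M rth)); last first.
      by move=> y y' e; apply: eq_word => -[|i] // li; apply: e.
    rewrite exchange_big /=; apply: eq_bigr => i _.
    rewrite linearZ /= (ophE rth) scaler_sumr; apply: eq_bigr => j _.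
    by rewrite scalerA -exprD.
  apply: eq_bigr => i _; apply: eq_bigr => j _.
  by rewrite (face_untwist th id) // -ltnS.
rewrite -big_split /=; apply: eq_bigr => i _.
rewrite linearZ /= (@opb_cons _ _ _ f H W id _ _ bi fi) /=.
have -> : \sum_(j < n.+1) (-1) ^+ (j + n.+1 * i) *:
        hw n.+1 (wcons 1 (face n id j (rt n.+1 th i g))) =
    (-1) ^+ (n.+1 * i) *: (\sum_(j < n.+1) (-1) ^+ j *:
       hw n.+1 (wcons 1 (face n id j (rt n.+1 th i g)))).
  by rewrite scaler_sumr; apply: eq_bigr => j _; rewrite scalerA -exprD addnC.
by rewrite -scalerDr addrAC subrK.
Qed.

(** The case of degree 0, where there is no [b0]. *)
Lemma b_h0 z : b 0 (h 0 z) = z - T 0 z - Pi 0 z.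
Proof.
apply: (word_ext (w := W) (F := b 0 \o h 0) (G := (idfun \- T 0) \- Pi 0)) => {z} g /=.
rewrite -h_telescope (ophE rth) !linear_sum /=; apply: eq_bigr => i _.
by rewrite linearZ /= (@opb_cons _ _ _ f H W id _ _ bi fi) big_ord0 subr0.
Qed.

(** Connes' operator factors as [h N] on the kernel of [Pi]. *)
Lemma h_N n z : h n (N n z) = B n (z - Pi n z).
Proof.
apply: (word_ext (w := W) (F := h n \o N n) (G := B n \o (idfun \- Pi n))) => {z} g /=.
rewrite (opNE rth) linear_sum linearB /= (opPiE rth) !opBE.
have cG : cmf f n (fun y => hw n.+1 (wcons 1 y)) := cmf_cons1 (cmf_word W n.+1).
have := telescope_left rth cG g => /= e.
rewrite -[X in _ = _ - X](_ : \sum_(j < n.+1) (-1) ^+ (n * j) *: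
   hw n.+1 (wcons 1 (th \o rt n id j g)) = _) -?e.
  by apply: eq_bigr => i _; rewrite linearZ /= (ophE rth).
apply: eq_bigr => j _; congr (_ *: _); apply: eq_word => -[|l] // ll /=.
by rewrite /rt; case: ifP.
Qed.

Lemma N_T n z : N n (T n z) = N n z.
Proof.
apply: (word_ext (w := W) (F := N n \o T n) (G := N n)) => {z} g /=.
have cG : cmf f n (fun y => (-1) ^+ n *: hw n (rot1 n pr y)).
  have c1 := cmf_rot1 (bilin_compl rth) (cmf_word W n); split.
  - by move=> y y' e; rewrite (cm_ext c1 e).
  - by move=> y i c x x' li; rewrite (cm_lin c1) // scalerDr !scalerA mulrC.
  - by move=> y i a li; rewrite (cm_bal c1).
rewrite (opTE rth) linear_sum /=.
have NE y : N n (hw n y) = \sum_(j < n.+1) (-1) ^+ (n * j) *: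
    ((-1) ^+ n *: hw n (rot1 n pr (rt n id j y))).
  rewrite (opNE rth); apply: eq_bigr => j _.
  by rewrite scalerA -exprD mulnS addnC.
have := telescope_right th cG g; rewrite /= -!NE => e.
rewrite (eq_bigr _ (fun (i : 'I_n.+1) _ => linearZ_LR (N n) _ _)).
under eq_bigr => i _ do rewrite NE.
rewrite e [X in _ - X](_ : _ = 0) ?subr0 // (opNE rth) big1 // => i _.
rewrite (cm_eq0 (cmf_word W n) (i := 0)) ?scaler0 //.
by rewrite rot1E /= /rt; case: ifP => _ /=; rewrite (compl_re rth).
Qed.

Lemma rt_diag n q i g : rt n q i g i = g 0%N.
Proof. by rewrite /rt ltnn subnn. Qed.

Lemma rt_diag_eq n q i l g : i = l -> rt n q i g l = g 0%N.
Proof. by move=> <-; apply: rt_diag. Qed.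

Lemma word_one n g i : (0 < i <= n)%N -> g i = 1 -> hw n g = 0.
Proof.
move=> li gi; apply: (van_eq0 (cmf_word W n) (van_word W n) (a := 1) li).
by rewrite rmorph1.
Qed.

Lemma word_zero n g i : (i <= n)%N -> g i = 0 -> hw n g = 0.
Proof. by move=> li gi; apply: (cm_eq0 (cmf_word W n) li gi). Qed.

(** In [h], [T] after [h], a letter [1] ends in a position where the class is
    zero, or is projected onto the kernel of [th]. *)
Lemma h_h n z : h n.+1 (h n z) = 0.
Proof.
apply: (word_ext (w := W) (F := h n.+1 \o h n) (G := \0)) => {z} g /=.
rewrite (ophE rth) linear_sum big1 // => j _.
rewrite linearZ /= (ophE rth) big1 ?scaler0 // => i _.
rewrite (@word_one _ _ i.+1) ?scaler0 //; first exact: ltn_ord.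
exact: rt_diag.
Qed.

Lemma T_h n z : T n.+1 (h n z) = 0.
Proof.
apply: (word_ext (w := W) (F := T n.+1 \o h n) (G := \0)) => {z} g /=.
rewrite (ophE rth) linear_sum big1 // => j _.
rewrite linearZ /= (opTE rth) big1 ?scaler0 // => i _.
have := ltn_ord i; rewrite ltnS leq_eqVlt => /predU1P[ei|li].
  rewrite (@word_zero _ _ 0%N) ?scaler0 // /rot1 /= (rt_diag_eq _ _ _ ei).
  exact: compl1 rth.
rewrite (@word_one _ _ i.+1) ?scaler0 //.
exact: rt_diag.
Qed.

Lemma N_h n z : N n.+1 (h n z) = 0.
Proof. by rewrite -N_T T_h linear0. Qed.

(** So [h] is injective on the image of [P]. *)
Lemma rho_h n z : opRho th W n (h n z) = P n z.
Proof.
apply: (word_ext (w := W) (F := opRho th W n \o h n) (G := P n)) => {z} g /=.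
rewrite (ophE rth) linear_sum big_ord_recl /= muln0 scale1r big1 ?addr0 => [|i _].
  rewrite (opRhoE rth) (opPE rth); apply: eq_word => l ll.
  by rewrite /face /upd /= mul1r; case: l ll => [|l] ll /=; rewrite /rt ltn0 subn0.
rewrite linearZ /= (opRhoE rth) (@word_zero _ _ 0%N) ?scaler0 //.
by rewrite /face /upd /= /rt /= (compl_re rth) mulr0.
Qed.

Lemma P_N n z : P n (N n z) = N n z.
Proof.
apply: (word_ext (w := W) (F := P n \o N n) (G := N n)) => {z} g /=.
rewrite (opNE rth) linear_sum; apply: eq_bigr => i _.
rewrite linearZ /= (opPE rth); congr (_ *: _); apply: eq_word => l _.
by rewrite /upd; case: l => //=; rewrite (compl_idem rth).
Qed.

Lemma P_T n z : P n (T n z) = T n z.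
Proof.
apply: (word_ext (w := W) (F := P n \o T n) (G := T n)) => {z} g /=.
rewrite (opTE rth) linear_sum; apply: eq_bigr => i _.
rewrite linearZ /= (opPE rth); congr (_ *: _); apply: eq_word => l _.
by rewrite /upd; case: l => //=; rewrite (compl_idem rth).
Qed.

Lemma Pi_P n z : Pi n (P n z) = 0.
Proof.
apply: (word_ext (w := W) (F := Pi n \o P n) (G := \0)) => {z} g /=.
by rewrite (opPE rth) (opPiE rth) (@word_zero _ _ 0%N) //= /upd /= (re_compl rth).
Qed.

Lemma Pi_h n z : Pi n.+1 (h n z) = h n (Pi n z).
Proof.
apply: (word_ext (w := W) (F := Pi n.+1 \o h n) (G := h n \o Pi n)) => {z} g /=.
rewrite (opPiE rth) !(ophE rth) linear_sum; apply: eq_bigr => i _.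
rewrite linearZ /= (opPiE rth); congr (_ *: _); apply: eq_word => -[|l] ll /=.
  exact: re1 rth.
by rewrite /rt; case: ifP.
Qed.

Lemma Pi_B n z : Pi n.+1 (B n z) = B n (Pi n z).
Proof.
apply: (word_ext (w := W) (F := Pi n.+1 \o B n) (G := B n \o Pi n)) => {z} g /=.
rewrite (opPiE rth) !opBE linear_sum; apply: eq_bigr => i _.
rewrite linearZ /= (opPiE rth); congr (_ *: _); apply: eq_word => -[|l] ll /=.
  exact: re1 rth.
by rewrite /rt; case: ifP.
Qed.

Section TwistedBoundary.
Variable q : R -> R.
Hypotheses (bq : bilin f q) (qf : forall a, q (f a) = f a).
Hypothesis qth : forall x, th (q x) = q (th x).

Lemma Pi_b n z : Pi n (opb W q n z) = opb W q n (Pi n.+1 z).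
Proof.
apply: (word_ext (w := W) (F := Pi n \o opb W q n) (G := opb W q n \o Pi n.+1)) => {z} g /=.
rewrite (opPiE rth) !(opbE W _ _ bq qf) linear_sum; apply: eq_bigr => i _.
rewrite linearZ /= (opPiE rth); congr (_ *: _); apply: eq_word => l ll.
by rewrite /face /=; wcase; rewrite (re_M rth) // qth.
Qed.

Lemma P_b_P n z : P n (opb W q n (P n.+1 z)) = opb W q n (P n.+1 z).
Proof.
apply: (word_ext (w := W) (F := (P n \o opb W q n) \o P n.+1)
  (G := opb W q n \o P n.+1)) => {z} g /=.
rewrite (opPE rth) !(opbE W _ _ bq qf) linear_sum; apply: eq_bigr => i _.
rewrite linearZ /= (opPE rth); congr (_ *: _); apply: eq_word => -[|l] // ll.
rewrite /upd /face /=; case: ifP => _; first by rewrite (compl_Mr rth).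
by case: (nat_of_ord i) => [|j] /=; rewrite ?(compl_idem rth) ?(compl_Ml rth).
Qed.
End TwistedBoundary.

End Identities.

(** * Words given by sequences *)

Section SeqWords.
Variables (T : Type) (z : T) (op : T -> T -> T).

Lemma size_merge_at j s : (j.+1 < size s)%N -> size (merge_at z op j s) = (size s).-1.
Proof.
by move=> lj; rewrite size_cat /= size_drop size_takel; lia.
Qed.

Lemma nth_merge_at j s i : (j.+1 < size s)%N ->
  nth z (merge_at z op j s) i = if (i < j)%N then nth z s i
    else if i == j then op (nth z s j) (nth z s j.+1) else nth z s i.+1.
Proof.
move=> lj; rewrite nth_cat size_takel; last by lia.
case: ltnP => [li|]; first by rewrite nth_take.
rewrite leq_eqVlt eq_sym => /orP[/eqP->|li]; first by rewrite subnn eqxx.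
rewrite gtn_eqF //; have -> : (i - j)%N = (i - j.+1).+1 by lia.
by rewrite /= nth_drop; congr (nth z s _); lia.
Qed.

Lemma size_merge_around s : (1 < size s)%N ->
  size (merge_around z op s) = (size s).-1.
Proof. by move=> ls; rewrite /= size_behead size_takel; lia. Qed.

Lemma nth_merge_around s i : (1 < size s)%N -> (i < (size s).-1)%N ->
  nth z (merge_around z op s) i =
    if i == 0%N then op (nth z s (size s).-1) (nth z s 0) else nth z s i.
Proof.
move=> ls; case: i => [|i] li; rewrite /merge_around /= ?nth_last ?nth0 //.
by rewrite nth_behead nth_take.
Qed.

Lemma count_merge_at (a : pred T) j s : (j.+1 < size s)%N ->
  (count a (merge_at z op j s) + (a (nth z s j) + a (nth z s j.+1)) =
   count a s + a (op (nth z s j) (nth z s j.+1)))%N.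
Proof.
move=> lj; have -> : count a s =
    (count a (take j s) + (a (nth z s j) + (a (nth z s j.+1) + count a (drop j.+2 s))))%N.
  rewrite -{1}(cat_take_drop j s) count_cat (drop_nth z (ltnW lj)) /=.
  by rewrite (drop_nth z lj).
by rewrite /merge_at count_cat /=; lia.
Qed.

Lemma count_merge_around (a : pred T) s : (1 < size s)%N ->
  (count a (merge_around z op s) + (a (last z s) + a (head z s)) =
   count a s + a (op (last z s) (head z s)))%N.
Proof.
case: s => [//|x s] ls; rewrite /merge_around /=.
case/lastP: s ls => [//|s y] _; rewrite last_rcons size_rcons /= -cats1 take_size_cat //.
by rewrite count_cat /=; lia.
Qed.

(** A function of words that is additive in each letter vanishes if it vanishes
    on the words with letters in [L], when each letter is a sum of two letters
    in [L]. *)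
Lemma additive_ext (Y : zmodType) n (F : (nat -> T) -> Y) (L : T -> Prop)
    (add : T -> T -> T) :
  (forall g g', (forall i, (i < n)%N -> g i = g' i) -> F g = F g') ->
  (forall g i x y, (i < n)%N -> F (upd g i (add x y)) = F (upd g i x) + F (upd g i y)) ->
  (forall x, exists y z, [/\ x = add y z, L y & L z]) ->
  (forall g, (forall i, (i < n)%N -> L (g i)) -> F g = 0) ->
  forall g, F g = 0.
Proof.
move=> eF aF dL zF g.
suff h j : (j <= n)%N -> forall g, (forall i, (j <= i < n)%N -> L (g i)) -> F g = 0.
  by apply: (h n) => // i; lia.
elim: j => {g} [_|j IHj lj] g Lg; first exact: zF.
have [x [y [gj Lx Ly]]] := dL (g j).
have -> : F g = F (upd g j (add x y)).
  by apply: eF => i _; rewrite /upd; case: eqP => // ->.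
have Lu t : L t -> forall i, (j <= i < n)%N -> L (upd g j t i).
  move=> Lt i li; rewrite /upd; case: (eqVneq i j) => // ij.
  by apply: Lg; lia.
by rewrite aF // !IHj ?addr0 //; [exact: ltnW|exact: Lu|exact: ltnW|exact: Lu].
Qed.
End SeqWords.

Section SeqOperators.
Variables (k : comNzRingType) (K R : algType k) (f : {lrmorphism K -> R}).
Variables (H : nat -> lmodType k) (W : words f H).

Lemma opb_seq n (s : seq R) : size s = n.+2 ->
  opb W id n (word W n.+1 (nth 0 s)) =
    \sum_(j < n.+1) (-1) ^+ j *: word W n (nth 0 (merge_at 0 *%R j s))
    + (-1) ^+ n.+1 *: word W n (nth 0 (merge_around 0 *%R s)).
Proof.
move=> ss; rewrite (opbE W _ _ (bilin_id f) (fun=> erefl)).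
rewrite big_ord_recr /=; congr (_ + _ *: _); last first.
  by apply: eq_word => l ll; rewrite nth_merge_around ?ss // /face eqxx.
apply: eq_bigr => j _; have lj := ltn_ord j; congr (_ *: _); apply: eq_word => l ll.
by rewrite nth_merge_at ?ss // /face ltn_eqF.
Qed.

Lemma opB_seq n (s : seq R) : size s = n.+1 ->
  opB W n (word W n (nth 0 s)) =
    \sum_(i < n.+1) (-1) ^+ (i * n) *: word W n.+1 (nth 0 (1 :: rot i s)).
Proof.
move=> ss; rewrite opBE.
have e i : (i <= n.+1)%N -> word W n.+1 (nth 0 (1 :: rot i s)) =
    word W n.+1 (wcons 1 (rt n id (n.+1 - i) (nth 0 s))).
  move=> li; apply: eq_word => -[|l] // ll.
  rewrite /= /rot nth_cat size_drop ss /rt; case: ltnP => h.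
    by rewrite nth_drop; congr (nth 0 s _); lia.
  by rewrite nth_take //; lia.
rewrite [LHS]big_ord_recl [RHS]big_ord_recl /= !muln0 !mul0n !scale1r; congr (_ + _).
  rewrite e //; apply: eq_word => -[|l] // ll.
  by rewrite /= rt0 subn0 rt_full.
(* [rot i] moves the first letters to the end, and [rt i] the last ones to the
   front, whence the reversal of the sum *)
rewrite [RHS](reindex_inj rev_ord_inj) /=; apply: eq_bigr => i _.
have li := ltn_ord i.
rewrite e; last by rewrite /bump /=; lia.
congr (_ *: word W _ (wcons 1 (rt n id _ _))); last by rewrite /bump /=; lia.
apply: signr_mod2; rewrite /bump /= !add1n.
have -> : (n - i.+1).+1 = (n - i)%N by lia.
by rewrite !oddM oddS (oddB (ltnW li)) andbC; case: (odd n); case: (odd i).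
Qed.
End SeqOperators.

Section HochschildOperators.
Variables (k : comNzRingType) (K R : algType k) (f : {lrmorphism K -> R}).
Local Notation W := (hoch_words f).

Lemma hwordE n s : size s = n.+1 -> hword f n s = word W n (nth 0 s).
Proof.
move=> ss; change (hword f n s = hword f n (mkseq (nth 0 s) n.+1)).
by rewrite -ss mkseq_nth.
Qed.

Lemma hochschild_bE n z : hochschild_b f n z = opb W id n z.
Proof.
pose P (G : {linear hochschild f n.+1 -> hochschild f n}) :=
  forall s : seq R, size s = n.+2 -> G (hword f n.+1 s) =
      \sum_(j < n.+1) (-1) ^+ j *: hword f n (merge_at 0 *%R j s)
      + (-1) ^+ n.+1 *: hword f n (merge_around 0 *%R s).
have Pb : P (opb W id n).
  move=> s ss; rewrite (hwordE ss) (opb_seq W ss).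
  rewrite (@hwordE n (merge_around 0 *%R s)); last by rewrite size_merge_around ss.
  apply: (f_equal2 +%R); last by [].
  apply: eq_bigr => j _; have lj := ltn_ord j.
  by rewrite (@hwordE n (merge_at 0 *%R j s)) // size_merge_at ss.
have Ph : P (hochschild_b f n) by apply: the_linearP; exists (opb W id n).
apply: (word_ext (w := W) (F := hochschild_b f n) (G := opb W id n)) => g.
have sg : size (mkseq g n.+2) = n.+2 by rewrite size_mkseq.
have e : hword f n.+1 (mkseq g n.+2) = word W n.+1 g by [].
by rewrite -e (Ph _ sg) (Pb _ sg).
Qed.

Lemma connes_BE n z : connes_B f n z = opB W n z.
Proof.
pose P (G : {linear hochschild f n -> hochschild f n.+1}) :=
  forall s : seq R, size s = n.+1 -> G (hword f n s) =
      \sum_(i < n.+1) (-1) ^+ (i * n) *: hword f n.+1 (1 :: rot i s).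
have Pb : P (opB W n).
  move=> s ss; rewrite (hwordE ss) (opB_seq W ss); apply: eq_bigr => i _.
  by rewrite (@hwordE n.+1 (1 :: rot i s)) // /= size_rot ss.
have Ph : P (connes_B f n) by apply: the_linearP; exists (opB W n).
apply: (word_ext (w := W) (F := connes_B f n) (G := opB W n)) => g.
have sg : size (mkseq g n.+1) = n.+1 by rewrite size_mkseq.
have e : hword f n (mkseq g n.+1) = word W n g by [].
by rewrite -e (Ph _ sg) (Pb _ sg).
Qed.

End HochschildOperators.

(** * Words with letters in A or M *)

Section Letters.
Variables (k : comNzRingType) (A : algType k) (M : bimod A) (nabla : bimod_product M).
Variables (K : algType k) (f : {lrmorphism K -> A}).
Local Notation E := (ext nabla).
Local Notation fE := (Defs.fE nabla f).
Local Notation letter := (letter M).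
Local Notation lext := (letter_ext nabla).

(** The projection of [E] onto [A]. *)
Definition eproj (x : E) : E := ext_in nabla (ext_out x).
Local Notation pr := (compl eproj).

Lemma ext_outM (x y : E) : ext_out (x * y) = ext_out x * ext_out y.
Proof. by []. Qed.

Lemma eproj_retraction : retraction fE eproj.
Proof.
have eM : {morph eproj : x y / x * y}.
  by move=> x y; rewrite /eproj ext_outM rmorphM.
have ef a : eproj (fE a) = fE a by [].
split=> //; split.
- by move=> c x y; rewrite /eproj /ext_out /= linearP.
- by move=> a x; rewrite eM ef.
- by move=> a x; rewrite eM ef.
Qed.

Lemma eproj_lext (x : letter) : eproj (lext x) = if inM x then 0 else lext x.
Proof. by case: x. Qed.
Lemma compl_lext (x : letter) : pr (lext x) = if inM x then lext x else 0.
Proof.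
by rewrite /compl eproj_lext; case: ifP; rewrite ?subr0 ?subrr.
Qed.

Lemma lext_split (x : E) : x = lext (inl x.1) + lext (inr x.2).
Proof. by case: x => a m; congr (_, _); rewrite ?addr0 ?add0r. Qed.

Lemma lextM (x y : letter) :
  lext x * lext y = lext (letter_mul x y) + lext (letter_nab nabla x y).
Proof.
case: x y => [a|m] [a'|m']; congr (_, _); rewrite /= ?mulr0 ?mul0r ?addr0 ?add0r //.
- by rewrite lact0r ract0l nab0l !addr0.
- by rewrite ract0l nab0l !addr0.
- by rewrite lact0r nab0r addr0 add0r.
- by rewrite lact0l ract0r !add0r.
Qed.

Section LetterWords.
Variables (H : nat -> lmodType k) (W : words fE H).
Local Notation hw := (word W).
Local Notation T := (opT eproj W).
Local Notation N := (opN eproj W).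
Implicit Types (s : seq letter) (n i j l : nat).

(** The class of a word with letters in [A] or [M]. *)
Definition hl n s : H n := hw n (fun i => lext (nth (inl 0) s i)).

Lemma hl_ext n (Y : lmodType k) (F G : {linear H n -> Y}) :
  (forall s, size s = n.+1 -> F (hl n s) = G (hl n s)) -> forall z, F z = G z.
Proof.
move=> FG; apply: (word_ext (w := W)) => g; apply/eqP; rewrite -subr_eq0; apply/eqP.
move: g; apply: (additive_ext (n := n.+1) (L := fun x => exists y, x = lext y)
  (add := +%R) (F := fun g => F (hw n g) - G (hw n g))).
- by move=> g g' e; rewrite (eq_word W (g' := g')).
- move=> g i x y li; rewrite (cm_add (cmf_word W n)) // !linearD /=.
  by rewrite addrACA.
- move=> x; exists (lext (inl x.1)), (lext (inr x.2)); split.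
  + exact: lext_split.
  + by exists (inl x.1).
  + by exists (inr x.2).
- move=> g Lg.
  have [s [ss sg]] : exists s, size s = n.+1 /\
      forall i, (i <= n)%N -> g i = lext (nth (inl 0) s i).
    pose c i := if pselect (exists y, g i = lext y) is left e then projT1 (cid e)
                else inl 0.
    exists (mkseq c n.+1); rewrite size_mkseq; split=> // i li.
    rewrite nth_mkseq // /c; case: pselect => [e|ne]; first by case: cid.
    by case: ne; apply: Lg.
  rewrite (eq_word W sg); apply/eqP; rewrite subr_eq0; apply/eqP.
  exact: FG ss.
Qed.

Lemma hl_zero n s i : (i <= n)%N -> lext (nth (inl 0) s i) = 0 -> hl n s = 0.
Proof. by move=> li; apply: word_zero. Qed.

(** A summand of [N] or [T], as a rotation of a sequence. *)
Lemma rot1_letters n s i (q : E -> E) : size s = n.+1 -> (i <= n)%N ->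
  (forall j, (n - i < j <= n)%N -> q (lext (nth (inl 0) s j)) = lext (nth (inl 0) s j)) ->
  pr (lext (nth (inl 0) s (n - i))) = lext (nth (inl 0) s (n - i)) ->
  hw n (rot1 n pr (rt n q i (fun j => lext (nth (inl 0) s j)))) = hl n (rot (n - i) s).
Proof.
move=> ss li hq hp; apply: eq_word => l ll.
rewrite /rot nth_cat size_drop ss rot1E /rt; case: l ll => [|l] ll.
  rewrite /= ltnNge li /= hp; case: ltnP => h; last by lia.
  by rewrite nth_drop addn0.
rewrite /=; case: (ltnP l i) => h.
  rewrite hq; last by lia.
  case: ltnP => h'; last by lia.
  by rewrite nth_drop; congr (lext (nth _ s _)); lia.
case: ltnP => h'; first by lia.
by rewrite nth_take; [congr (lext (nth _ s _)); lia|lia].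
Qed.

(** [N] on a word in letters: the rotations that start with a letter in [M]. *)
Lemma N_letters n s : size s = n.+1 -> N n (hl n s) =
  \sum_(i < n.+1 | inM (nth (inl 0) s i)) (-1) ^+ (n * i) *: hl n (rot i s).
Proof.
move=> ss; rewrite /hl (opNE eproj_retraction).
rewrite (reindex_inj rev_ord_inj) /= [RHS]big_mkcond; apply: eq_bigr => i _.
have li : (i <= n)%N by rewrite -ltnS.
have e : (n - (n.+1 - i.+1))%N = i by lia.
case: ifP => iM.
  rewrite (rot1_letters ss) //; [|lia|by rewrite e compl_lext iM].
  rewrite e; congr (_ *: _); apply: signr_mod2.
  by rewrite subSS !oddM oddS oddB //; case: (odd n); case: (odd i).
rewrite (@word_zero _ _ _ _ _ W _ _ 0%N) ?scaler0 // rot1E /= /rt.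
rewrite ltnNge; have -> : (n.+1 - i.+1 <= n)%N by lia.
by rewrite /= e compl_lext iM.
Qed.

(** [T] on a word in letters: the block of the last letter in [M] moves to the
    front. *)
Lemma T_letters n s1 m s2 : size (s1 ++ inr m :: s2) = n.+1 -> ~~ has (@inM _ _ M) s2 ->
  T n (hl n (s1 ++ inr m :: s2)) =
    (-1) ^+ (n * size s1) *: hl n (inr m :: s2 ++ s1).
Proof.
move=> ss s2A; set s := s1 ++ _; have e : size s = n.+1 by [].
have sz : (size s1 + size s2)%N = n by move: ss; rewrite size_cat /=; lia.
have nM : nth (inl 0) s (size s1) = inr m by rewrite nth_cat ltnn subnn.
have nA j : (size s1 < j)%N -> inM (nth (inl 0) s j) = false.
  move=> lj; rewrite nth_cat ltnNge (ltnW lj) /=.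
  have -> : (j - size s1)%N = (j - (size s1).+1).+1 by lia.
  rewrite /=; case: (ltnP (j - (size s1).+1) (size s2)) => h; last by rewrite nth_default.
  by apply/negbTE; apply: contra s2A => h'; apply/(has_nthP (inl 0)); exists (j - (size s1).+1)%N.
have l2 : (size s2 < n.+1)%N by lia.
rewrite /hl (opTE eproj_retraction) (bigD1 (Ordinal l2)) //= big1 ?addr0; last first.
  move=> i; rewrite -val_eqE /= => i2; have li := ltn_ord i.
  rewrite ltnS in li.
  case: (ltngtP i (size s2)) => h; last by rewrite h eqxx in i2.
    rewrite (@word_zero _ _ _ _ _ W _ _ 0%N) ?scaler0 // rot1E /= /rt ltnNge li /=.
    by rewrite compl_lext nA //; lia.
  have h1 : (i - size s2 <= n)%N by lia.
  rewrite (@word_zero _ _ _ _ _ W _ _ (i - size s2)%N) ?scaler0 // rot1E /rt.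
  have -> : (i - size s2 == 0)%N = false by lia.
  have -> : ((i - size s2).-1 < i)%N by lia.
  have -> : (n.+1 - i + (i - size s2).-1)%N = size s1 by lia.
  by rewrite nM.
have es : (n - size s2)%N = size s1 by lia.
rewrite (rot1_letters ss) //.
- rewrite es rot_size_cat; congr (_ *: _); apply: signr_mod2.
  by rewrite !oddM oddS -sz !oddD; case: (odd (size s1)); case: (odd (size s2)).
- move=> j lj; rewrite eproj_lext nA //; lia.
- by rewrite es nM compl_lext.
Qed.

Lemma T_letters0 n s : size s = n.+1 -> ~~ has (@inM _ _ M) s -> T n (hl n s) = 0.
Proof.
move=> ss sA; rewrite /hl (opTE eproj_retraction) big1 // => i _.
have li := ltn_ord i.
rewrite (@word_zero _ _ _ _ _ W _ _ 0%N) ?scaler0 // rot1E /= /rt ltnNge -ltnS li /=.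
rewrite compl_lext ifF //; apply/negbTE; apply: contra sA => h.
by apply/(has_nthP (inl 0)); exists (n - i)%N => //; rewrite ss; lia.
Qed.

End LetterWords.
End Letters.

(** * The weight decomposition of the tensor powers *)

(** A word [x :: s] has weight [w] if either [x] is in [A] and [s] has weight
    [w], or [x] is in [M] and [s] has weight [w - 1]. *)
Lemma select_count (Y : zmodType) (a : Y) (p : bool) (c w : nat) :
  (if p then 0 else if c == w then a else 0) +
  (if p then (if (0 < w)%N then (if c == w.-1 then a else 0) else 0) else 0) =
  if (p + c)%N == w then a else 0.
Proof. by case: p w => [] [|w]; rewrite /= ?addr0 ?add0r. Qed.

Section Weights.
Variables (k : comNzRingType) (A : algType k) (M : bimod A) (nabla : bimod_product M).
Variables (K : algType k) (f : {lrmorphism K -> A}).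
Local Notation E := (ext nabla).
Local Notation fE := (Defs.fE nabla f).
Local Notation letter := (letter M).
Local Notation lext := (letter_ext nabla).
Local Notation V := (algbar fE).
Local Notation lbar x := (bar fE (letter_ext nabla x)).
Implicit Types (s : seq letter) (n w : nat).

(** A map of [K]-bimodules from [E] to itself that sends [K] to itself, or to
    zero, descends to [E / K]. *)
Lemma bar_map_ex (q : E -> E) : bilin fE q -> (forall a, bar fE (q (fE a)) = 0) ->
  exists qb : {linear V -> V}, [/\ forall x, qb (bar fE x) = bar fE (q x),
    forall a v, qb (lact a v) = lact a (qb v) &
    forall a v, qb (ract v a) = ract (qb v) a].
Proof.
move=> bq q0.
have [q' q'E] := linear_ext (bl_lin bq).
have [p pE] := linear_ext (@bar_linear k K E fE).
have [|qb qbE] := @qlift_ex k (algK fE) V (imp fE) (p \o q').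
  by move=> x /asboolP [a <-]; change (p (q' (fE a)) = 0); rewrite pE q'E q0.
have e x : qb (bar fE x) = bar fE (q x).
  by rewrite [LHS]qbE; change (p (q' x) = bar fE (q x)); rewrite pE q'E.
exists qb; split=> // a v; have [x ->] := qpi_surj v; change (qpi _ x) with (bar fE x).
  by rewrite lact_bar !e (bl_l bq) lact_bar.
by rewrite ract_bar !e (bl_r bq) ract_bar.
Qed.

Lemma tpow_letters_ext n (Y : lmodType k) (F G : {linear tpow V n -> Y}) :
  (forall s c, size s = n ->
     F (tword n [seq lbar x | x <- s] c) = G (tword n [seq lbar x | x <- s] c)) ->
  forall u, F u = G u.
Proof.
move=> FG; apply: tpow_ext => t c st; apply/eqP; rewrite -subr_eq0; apply/eqP.
have -> : t = mkseq (nth 0 t) n by rewrite -st mkseq_nth.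
have mt := @multilin_tword k K V n.
move: (nth 0 t) => {t st}.
apply: (additive_ext (n := n) (L := fun x => exists y : letter, x = lbar y)
  (add := +%R) (F := fun g => F (tword n (mkseq g n) c) - G (tword n (mkseq g n) c))).
- by move=> g g' e; rewrite (ml_ext mt c e).
- move=> g i x y li.
  have := ml_lin mt g c 1 x y li; rewrite !scale1r => ->.
  by rewrite !linearD addrACA.
- move=> v; have [x ->] := qpi_surj v; change (qpi _ x) with (bar fE x).
  exists (lbar (inl x.1)), (lbar (inr x.2)); split.
  + have := @bar_linear k K E fE 1 (lext (inl x.1)) (lext (inr x.2)).
    by rewrite !scale1r -lext_split.
  + by exists (inl x.1).
  + by exists (inr x.2).
- move=> g Lg.
  have [s [ss sg]] : exists s : seq letter, size s = n /\
      mkseq g n = [seq lbar x | x <- s].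
    pose c0 i : letter := if pselect (exists y, g i = lbar y) is left e then projT1 (cid e)
                else inl 0.
    exists (mkseq c0 n); rewrite size_mkseq; split=> //.
    rewrite /mkseq -map_comp; apply/eq_in_map => i; rewrite mem_iota add0n => /andP[_ li].
    rewrite /= /c0; case: pselect => [e|ne]; first by case: cid.
    by case: ne; apply: Lg.
  by rewrite sg FG // subrr.
Qed.

Lemma lact_letters n s c a : size s = n -> exists s' c', [/\ size s' = n,
  count (@inM _ _ M) s' = count (@inM _ _ M) s &
  lact a (tword n [seq lbar x | x <- s] c) = tword n [seq lbar x | x <- s'] c'].
Proof.
case: n s => [|n] [|x s] // ss.
  by exists [::], (a * c); split=> //; exact: (@lact_tword_size _ _ V 0 [::]).
have [y yx lxy] := lact_lbar nabla f a x.
exists (y :: s), c; split; [exact: ss | by rewrite /= yx |].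
by have := lact_tword n (lbar x) [seq lbar z | z <- s] c a; rewrite lxy.
Qed.

(** The projection onto the part of weight [w], that is, the words with exactly
    [w] letters in [M]. *)
Lemma wproj_ex n w : exists q : {linear tpow V n -> tpow V n}, forall s c, size s = n ->
  q (tword n [seq lbar x | x <- s] c) =
    if count (@inM _ _ M) s == w then tword n [seq lbar x | x <- s] c else 0.
Proof.
elim: n w => [|n IHn] w.
  case: w => [|w]; last by exists \0 => -[].
  by exists idfun => -[|//] c _.
have eb (q : E -> E) a : (q (fE a) = fE a) \/ (q (fE a) = 0) -> bar fE (q (fE a)) = 0.
  case=> ->; apply/qpi_eq0/asboolP; [by exists a|by exists 0; rewrite linear0].
have [qA [qAE qAl qAr]] := bar_map_ex (re_bilin (eproj_retraction nabla f))
  (fun a => eb _ a (or_introl (re_f (eproj_retraction nabla f) a))).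
have [qM [qME qMl qMr]] := bar_map_ex (bilin_compl (eproj_retraction nabla f))
  (fun a => eb _ a (or_intror (compl_f (eproj_retraction nabla f) a))).
pose q w := projT1 (cid (IHn w)).
have qE w' : forall s c, size s = n -> q w' (tword n [seq lbar x | x <- s] c) =
    if count (@inM _ _ M) s == w' then tword n [seq lbar x | x <- s] c else 0.
  by rewrite /q; case: cid.
have ql w' a u : q w' (lact a u) = lact a (q w' u).
  have [l lE] := linear_ext (@lact_linearr _ _ (tpow V n) a).
  rewrite -!lE; move: u; apply: (@tpow_letters_ext n _ (q w' \o l) (l \o q w')) => s c ss.
  change (q w' (l (tword n [seq lbar x | x <- s] c)) = l (q w' (tword n [seq lbar x | x <- s] c))).
  have [s' [c' [ss' cs e]]] := lact_letters c a ss.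
  rewrite (qE w' s c ss) lE e (qE w' s' c' ss') cs.
  by case: ifP => _; rewrite ?linear0 // lE e.
have [o oE] : exists o : V -> {linear tpow V n -> tens V (tpow V n)},
    forall v u, o v u = otimes v u.
  pose o v := projT1 (cid (linear_ext (@otimes_linr _ _ V (tpow V n) v))).
  by exists o => v; rewrite /o; case: cid.
have [o' o'E] : exists o : tpow V n -> {linear V -> tens V (tpow V n)},
    forall v u, o u v = otimes v u.
  pose o' u := projT1 (cid (linear_ext (@otimes_linl _ _ V (tpow V n) u))).
  by exists o' => v u; rewrite /o'; case: cid.
have ex (b : bool) (p : {linear V -> V}) (w' : nat) :
    (forall a v, p (ract v a) = ract (p v) a) ->
    exists G : {linear tpow V n.+1 -> tpow V n.+1},
      forall v u, G (otimes v u) = if b then otimes (p v) (q w' u) else 0.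
  move=> pr; case: b; last by exists \0.
  apply: tens_lift_ex.
  - by move=> u c x y; rewrite -!o'E !linearP.
  - by move=> v c x y; rewrite -!oE !linearP.
  - by move=> a v u; rewrite pr ql otimes_bal.
have [G1 G1E] := ex true qA w qAr.
have [G2 G2E] := ex (0 < w)%N qM w.-1 qMr.
exists (G1 \+ G2) => -[//|x s] c [ss].
have -> : tword n.+1 [seq lbar x | x <- x :: s] c =
  otimes (lbar x) (tword n [seq lbar x | x <- s] c) by [].
set u := tword n [seq lbar x | x <- s] c.
change (G1 (otimes (lbar x) u) + G2 (otimes (lbar x) u) =
   if (inM x + count (@inM _ _ M) s)%N == w then otimes (lbar x) u else 0).
have b0 : bar fE 0 = 0.
  by have := @bar_linear k K E fE (-1) 0 0; rewrite !scaleN1r !addNr.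
have e1 : G1 (otimes (lbar x) u) =
    if inM x then 0 else if count (@inM _ _ M) s == w then otimes (lbar x) u else 0.
  apply: (etrans (G1E _ _)); rewrite qAE eproj_lext (qE w s c ss).
  case: (inM x); first by apply: (etrans (congr1 (fun v => otimes v _) b0)); exact: otimes_0l.
  by case: (_ == _); [by [] | exact: otimes_0r].
have e2 : G2 (otimes (lbar x) u) = if inM x then (if (0 < w)%N then
    (if count (@inM _ _ M) s == w.-1 then otimes (lbar x) u else 0) else 0) else 0.
  apply: (etrans (G2E _ _)); rewrite qME compl_lext (qE w.-1 s c ss).
  case: (0 < w)%N; last by case: (inM x).
  case: (inM x); last by apply: (etrans (congr1 (fun v => otimes v _) b0)); exact: otimes_0l.
  by case: (_ == _); [by [] | exact: otimes_0r].
apply: (etrans (congr2 +%R e1 e2)); exact: select_count.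
Qed.

End Weights.

(** * The columns as summands of the Hochschild modules *)

Section ColumnSummands.
Variables (k : comNzRingType) (A : algType k) (M : bimod A) (nabla : bimod_product M).
Variables (K : algType k) (f : {lrmorphism K -> A}).
Local Notation E := (ext nabla).
Local Notation fE := (Defs.fE nabla f).
Local Notation letter := (letter M).
Local Notation lext := (letter_ext nabla).
Local Notation V := (algbar fE).
Local Notation lbar x := (bar fE (letter_ext nabla x)).
Local Notation Bn := (Bnw nabla f).
Local Notation X := (X nabla f).
Local Notation xword := (xword nabla f).
Local Notation rM := (restr f M).
Local Notation H := (hochschild fE).
Local Notation W := (hoch_words fE).
Implicit Types (s : seq letter) (n w : nat).

Lemma Bval_linear n w : linear (fun u : Bn n w => \val u : tpow V n).
Proof. by move=> c x y; exact: (val_linear (V := tpow V n)). Qed.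

Lemma lext_inr_linear : linear (fun m : M => lext (inr m)).
Proof. by move=> c m m'; congr (_, _); rewrite /= scaler0 addr0. Qed.

Lemma lext_inr_ract (m : M) a : lext (inr (ract m (f a))) = lext (inr m) * fE a.
Proof. by congr (_, _); rewrite /= ?mul0r // lact0r nab0r add0r addr0. Qed.
Lemma lext_inr_lact (m : M) a : lext (inr (lact (f a) m)) = fE a * lext (inr m).
Proof. by congr (_, _); rewrite /= ?mulr0 // ract0l nab0l !addr0. Qed.

Lemma col_incl_ex n w : exists G : {linear X n w -> H n}, forall (m : rM) (u : Bn n w),
  G (cycpi (tens rM (Bn n w)) (otimes m u)) = hcls (f := fE) (lext (inr (m : M))) (\val u).
Proof.
have [G0 G0E] : exists G : {linear tens rM (Bn n w) -> H n},
    forall m u, G (otimes m u) = hcls (f := fE) (lext (inr (m : M))) (\val u).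
  apply: tens_lift_ex.
  - move=> u c x y.
    apply: (etrans (congr1 (fun z => hcls (f := fE) z (\val u)) (lext_inr_linear c x y))).
    exact: hcls_linl.
  - move=> m c x y.
    apply: (etrans (congr1 (hcls (f := fE) (lext (inr (m : M)))) (Bval_linear c x y))).
    exact: hcls_linr.
  - move=> a m u.
    apply: (etrans (congr1 (fun z => hcls (f := fE) z (\val u)) (lext_inr_ract m a))).
    exact: hcls_bal.
have [|G GE] := @cyc_lift_ex _ _ _ _ G0.
  move=> a t.
  have [l lE] := linear_ext (@lact_linearr _ _ (tens rM (Bn n w)) a).
  have [r rE] := linear_ext (@ract_linearl _ _ (tens rM (Bn n w)) a).
  rewrite -lE -rE; move: t; apply: (tens_ext (f := G0 \o r) (g := G0 \o l)) => m u.
  change (G0 (r (otimes m u)) = G0 (l (otimes m u))).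
  apply: (etrans (congr1 G0 (etrans (rE _) (ract_otimes _ _ _)))).
  apply: etrans (esym (congr1 G0 (etrans (lE _) (lact_otimes _ _ _)))).
  apply: (etrans (G0E _ _)); apply: etrans (esym (G0E _ _)).
  apply: etrans (congr1 (fun z => hcls (f := fE) z (\val u)) (esym (lext_inr_lact m a))).
  exact: hcls_cyc.
by exists G => m u; apply: (etrans (GE _)); apply: G0E.
Qed.

(** The map from [X n w] to the Hochschild module induced by the inclusions of
    [M] in [E] and of [B^n_w] in the tensor power. *)
Definition col_incl n w : {linear X n w -> H n} :=
  the_linear (fun G => forall (m : rM) (u : Bn n w),
    G (cycpi (tens rM (Bn n w)) (otimes m u)) = hcls (f := fE) (lext (inr (m : M))) (\val u)).

Lemma col_inclE n w (m : rM) (u : Bn n w) :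
  col_incl n w (cycpi (tens rM (Bn n w)) (otimes m u)) =
    hcls (f := fE) (lext (inr (m : M))) (\val u).
Proof. exact: (the_linearP (col_incl_ex n w)). Qed.

Lemma hl_hcls n x s : size s = n ->
  hl W n (x :: s) = hcls (f := fE) (lext x) (tword n [seq lbar y | y <- s] 1).
Proof.
move=> ss; change (hl W n (x :: s)) with (hw fE n (fun i => lext (nth (inl 0) (x :: s) i))).
rewrite hwE; congr (hcls _ (tword _ _ _)).
apply: (@eq_from_nth _ 0); rewrite size_mkseq ?size_map // => i li.
rewrite nth_mkseq //= (nth_map (inl 0)) //; by rewrite ss.
Qed.

Lemma Bword_val n w s : size s = n -> count (@inM _ _ M) s = w ->
  \val (Bword nabla f n w s) = tword n [seq lbar x | x <- s] 1.
Proof.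
move=> ss cs; rewrite /Bword val_insubd ifT //.
by apply/spanP/in_span_gen; exists s, 1.
Qed.

Lemma col_incl_xword n w s : xform n w s -> col_incl n w (xword n w s) = hl W n s.
Proof.
case: s => [//|[a|m] s] h; first by case/and3P: h.
have [ss cs] : size s = n /\ count (@inM _ _ M) s = w.
  by case/and3P: h => /eqP[e] _ /eqP.
rewrite /xword h col_inclE (Bword_val ss cs) -hl_hcls //.
Qed.

Lemma X_ext n w (Y : lmodType k) (F G : {linear X n w -> Y}) :
  (forall s, xform n w s -> F (xword n w s) = G (xword n w s)) -> forall x, F x = G x.
Proof.
move=> FG; apply: cyc_ext => t; pose q := cycpi (tens rM (Bn n w)).
move: t; apply: (tens_ext (f := F \o q) (g := G \o q)) => m u.
change (F (q (otimes m u)) = G (q (otimes m u))).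
have [o oE] := linear_ext (@otimes_linr _ _ rM (Bn n w) m).
rewrite -oE; case: u => u Pu.
have : forall x (Px : x \in span (@is_weighted k A M nabla K f n w)),
    (F (q (o (Sub x Px))) = G (q (o (Sub x Px)))).
  move=> x Px; have /spanP Sx := Px.
  elim: Sx Px => {x} [x [s [c [ss sw ->]]] Px||c x y Sx IHx Sy IHy Pxy].
  - have -> : Sub (tword n [seq lbar z | z <- s] c) Px =
        ract (Bword nabla f n w s : Bn n w) c.
      apply: val_inj; change (tword n [seq lbar z | z <- s] c =
        ract (\val (Bword nabla f n w s) : tpow V n) c).
      by rewrite (Bword_val ss sw) ract_tword mul1r.
    rewrite oE -ract_otimes /q cycpi_comm lact_otimes.
    have := FG (inr (lact c m) :: s); rewrite /xword.
    have -> : xform n w (inr (lact c m) :: s) by apply/and3P; rewrite /= ss sw !eqxx.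
    by apply.
  - move=> P0; have -> : Sub 0 P0 = 0 :> Bn n w by exact: val_inj.
    by rewrite !linear0.
  - have Px : x \in span (@is_weighted k A M nabla K f n w) by exact/spanP.
    have Py : y \in span (@is_weighted k A M nabla K f n w) by exact/spanP.
    have -> : Sub (c *: x + y) Pxy = c *: Sub x Px + Sub y Py :> Bn n w.
      by apply: val_inj; rewrite (Bval_linear c (Sub x Px) (Sub y Py)).
    by rewrite !linearP IHx IHy.
by move=> h; apply: h.
Qed.

(** The left inverse of [col_incl]: the first letter is projected onto [M], and
    the others onto the part of weight [w]. *)
Lemma restrict_ex n w : exists r : {linear H n -> X n w},
  forall s, size s = n.+1 -> r (hl W n s) = xword n w s.
Proof.
have [q qE] := wproj_ex nabla f n w.
have qP u : q u \in span (@is_weighted k A M nabla K f n w).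
  apply/qpi_eq0; set p := qpi _.
  move: u; apply: (@tpow_letters_ext _ _ _ nabla _ f n _ (p \o q) \0) => s c ss.
  change (p (q (tword n [seq lbar x | x <- s] c)) = 0); rewrite (qE s c ss).
  case: eqP => [cs|_]; last by apply/qpi_eq0; rewrite rpred0.
  by apply/qpi_eq0/spanP/in_span_gen; exists s, c.
pose pB u : Bn n w := Sub (q u) (qP u).
have pBv u : \val (pB u) = q u by [].
have [pb pbE] : exists p : {linear tpow V n -> Bn n w}, forall u, p u = pB u.
  by apply: linear_ext => c x y; apply: val_inj; rewrite Bval_linear !pBv linearP.
have comm_l a u : pb (lact a u) = lact a (pb u).
  rewrite !pbE; apply: val_inj; change (q (lact a u) = lact a (q u)).
  have [l lE] := linear_ext (@lact_linearr _ _ (tpow V n) a).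
  rewrite -!lE; move: u; apply: (@tpow_letters_ext _ _ _ nabla _ f n _ (q \o l) (l \o q)) => s c ss.
  change (q (l (tword n [seq lbar x | x <- s] c)) = l (q (tword n [seq lbar x | x <- s] c))).
  have [s' [c' [ss' cs e]]] := lact_letters nabla f c a ss.
  rewrite (qE s c ss) lE e (qE s' c' ss') cs.
  by case: ifP => _; rewrite ?linear0 // lE e.
have comm_r a u : pb (ract u a) = ract (pb u) a.
  rewrite !pbE; apply: val_inj; change (q (ract u a) = ract (q u) a).
  have [l lE] := linear_ext (@ract_linearl _ _ (tpow V n) a).
  rewrite -!lE; move: u; apply: (@tpow_letters_ext _ _ _ nabla _ f n _ (q \o l) (l \o q)) => s c ss.
  change (q (l (tword n [seq lbar x | x <- s] c)) = l (q (tword n [seq lbar x | x <- s] c))).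
  rewrite (qE s c ss) lE ract_tword (qE s (c * a) ss).
  by case: ifP => _; rewrite ?linear0 // lE ract_tword.
pose cl (m : M) (u : Bn n w) : X n w := cycpi (tens rM (Bn n w)) (otimes (m : rM) u).
have cl_l u : linear (cl^~ u).
  by move=> c x y; rewrite /cl (@otimes_linl _ _ rM) linearP.
have cl_r m : linear (cl m).
  by move=> c x y; rewrite /cl (@otimes_linr _ _ rM (Bn n w)) linearP.
have cl_b m a u : cl (ract m (f a)) u = cl m (lact a u) by rewrite /cl -otimes_bal.
have cl_c m a u : cl m (ract u a) = cl (lact (f a) m) u.
  by rewrite /cl -ract_otimes cycpi_comm lact_otimes.
have [G0 G0E] : exists G : {linear tens (algK fE) (tpow V n) -> X n w},
    forall (x : algK fE) u, G (otimes x u) = cl (x : E).2 (pb u).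
  apply: tens_lift_ex.
  - by move=> u c x y; apply: (cl_l (pb u) c (x : E).2 (y : E).2).
  - move=> m c x y; apply: (etrans (congr1 (cl (m : E).2) (linearP pb c x y))).
    exact: cl_r.
  - move=> a x u; apply: etrans (congr1 (cl (x : E).2) (esym (comm_l a u))).
    apply: etrans (cl_b _ _ _); apply: (congr1 (fun m => cl m (pb u))).
    change ((x * fE a : E).2 = ract (x : E).2 (f a)).
    by rewrite [LHS]/= lact0r nab0r add0r addr0.
have [|G GE] := @cyc_lift_ex _ _ _ _ G0.
  move=> a t.
  have [l lE] := linear_ext (@lact_linearr _ _ (tens (algK fE) (tpow V n)) a).
  have [r rE] := linear_ext (@ract_linearl _ _ (tens (algK fE) (tpow V n)) a).
  rewrite -lE -rE; move: t; apply: (tens_ext (f := G0 \o r) (g := G0 \o l)) => x u.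
  change (G0 (r (otimes x u)) = G0 (l (otimes x u))).
  apply: (etrans (congr1 G0 (etrans (rE _) (ract_otimes _ _ _)))).
  apply: etrans (esym (congr1 G0 (etrans (lE _) (lact_otimes _ _ _)))).
  apply: (etrans (G0E _ _)); apply: etrans (esym (G0E _ _)).
  apply: (etrans (congr1 (cl (x : E).2) (comm_r a u))); apply: (etrans (cl_c _ _ _)).
  apply: (congr1 (fun m => cl m (pb u))).
  change (lact (f a) (x : E).2 = (fE a * x : E).2).
  by rewrite [RHS]/= ract0l nab0l !addr0.
exists G => -[//|x s] [ss]; rewrite (hl_hcls x ss); apply: (etrans (GE _)).
apply: (etrans (G0E _ _)); rewrite pbE.
have pw : pB (tword n [seq lbar y | y <- s] 1) =
    if count (@inM _ _ M) s == w then Bword nabla f n w s else 0.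
  apply: val_inj; rewrite pBv (qE s 1 ss); case: eqP => // cs.
  by rewrite (Bword_val ss cs).
have xf m : xform n w (inr m :: s) = (count (@inM _ _ M) s == w).
  by rewrite /xform /= ss eqxx.
case: x => [a|m].
  have [cl' clE] := linear_ext (cl_l (pB (tword n [seq lbar y | y <- s] 1))).
  exact: etrans (esym (clE 0)) (linear0 cl').
rewrite pw /xword xf; case: ifP => _; first by [].
by have [cl' clE] := linear_ext (cl_r m); exact: etrans (esym (clE 0)) (linear0 cl').
Qed.

End ColumnSummands.

(** * Averaging over the rotations, and the kernel of Connes' operator *)

(** A decomposition of the image of [opP] in [H n] into summands [X n w], stable
    under the rotation [opT], such that [opN] is the sum of the first [w + 1]
    powers of [opT] on the [w]-th component. *)
Record grading (k : comNzRingType) (K R : algType k) (f : {lrmorphism K -> R})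
    (th : R -> R) (H : nat -> lmodType k) (W : words f H)
    (X : nat -> nat -> lmodType k) := Grading {
  cxi n w : {linear X n w -> H n};
  cxr n w : {linear H n -> X n w};
  xr_xi n w x : cxr n w (cxi n w x) = x;
  xr_xi_ne n w w' x : w != w' -> cxr n w (cxi n w' x) = 0;
  P_xi n w x : opP th W n (cxi n w x) = cxi n w x;
  P_sum n z : opP th W n z = \sum_(w < n.+1) cxi n w (cxr n w z);
  xr_T_P n w z : cxr n w (opT th W n (opP th W n z)) =
    cxr n w (opT th W n (cxi n w (cxr n w z)));
  T_xi_xr n w x : opT th W n (cxi n w x) = cxi n w (cxr n w (opT th W n (cxi n w x)));
  xr_N n w z : cxr n w (opN th W n z) =
    \sum_(c < w.+1) cxr n w (iter c.+1 (opT th W n) z)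
}.

Section Averaging.
Variables (k : comNzRingType) (Qk : {rmorphism rat -> k}).
Variables (K R : algType k) (f : {lrmorphism K -> R}).
Variables (th : R -> R) (rth : retraction f th).
Variables (H : nat -> lmodType k) (W : words f H) (X : nat -> nat -> lmodType k).
Variable C : grading th W X.
Implicit Types (n i j : nat).
Local Notation xi := (cxi C).
Local Notation xr := (cxr C).
Local Notation b := (opb W id).
Local Notation b0 := (opb W th).
Local Notation T := (opT th W).
Local Notation N := (opN th W).
Local Notation h := (oph th W).
Local Notation Pi := (opPi th W).
Local Notation P := (opP th W).
Local Notation B := (opB W).

(** The operator induced by the rotation [opT] on [X n w]. *)
Definition xt n w : {linear X n w -> X n w} := xr n w \o (T n \o xi n w).
Local Notation t := xt.

Lemma xr_T n w z : P n z = z -> xr n w (T n z) = t n w (xr n w z).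
Proof. by move=> Pz; rewrite -[in LHS]Pz xr_T_P. Qed.

Lemma T_xi n w x : T n (xi n w x) = xi n w (t n w x).
Proof. exact: T_xi_xr. Qed.

Let bi := bilin_id f.
Let fi (a : K) : id (f a) = f a := erefl.
Let bth := re_bilin rth.

Lemma inv_nat w : {e : k | (w.+1)%:R * e = 1}.
Proof.
exists (Qk (w.+1)%:R^-1); rewrite -(rmorph_nat Qk) -rmorphM mulfV ?rmorph1 //.
by rewrite Num.Theory.pnatr_eq0.
Qed.

Lemma Pi_xi n w x : Pi n (xi n w x) = 0.
Proof. by rewrite -(P_xi C) (Pi_P rth). Qed.

Lemma hN_B n z : Pi n z = 0 -> h n (N n z) = B n z.
Proof. by move=> Pz; rewrite (h_N rth) Pz subr0. Qed.

Lemma h_inj_N n z : h n (N n z) = 0 -> N n z = 0.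
Proof. by move=> hz; rewrite -(P_N rth) -(rho_h rth) hz linear0. Qed.

(** The components of [T z] have class zero in the quotients of the [X n w] by
    the image of [id - t]. *)
Definition phi_zero n (z : H n) : Prop :=
  forall w, (w < n.+1)%N -> exists u, xr n w (T n z) = u - t n w u.

Lemma iter_T n w z c : xr n w (iter c.+1 (T n) z) = iter c (t n w) (xr n w (T n z)).
Proof.
elim: c => [//|c IHc]; rewrite [iter c.+2 _ _]/= xr_T ?(P_T rth) //.
by rewrite -[T n (iter c _ _)]/(iter c.+1 (T n) z) IHc.
Qed.

(** If [x + t x + ... + t^w x = 0], then [(w + 1) x] is the sum of the
    [x - t^c x], each of which is a value of [id - t]. *)
Lemma N_phi_zero n z : N n z = 0 -> phi_zero z.
Proof.
move=> Nz w lw; set x := xr n w (T n z).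
have sx : \sum_(c < w.+1) iter c (t n w) x = 0.
  rewrite -[RHS](linear0 (xr n w)) -Nz (xr_N C).
  by apply: eq_bigr => c _; rewrite iter_T.
have [e we] := inv_nat w.
pose u0 := \sum_(c < w.+1) \sum_(j < c) iter j (t n w) x.
exists (e *: u0).
have u0E : u0 - t n w u0 = w.+1%:R *: x.
  rewrite /u0 linear_sum -sumrB.
  transitivity (\sum_(c < w.+1) (x - iter c (t n w) x)).
    apply: eq_bigr => c _; rewrite linear_sum -sumrB.
    elim: (nat_of_ord c) => [|d IHd]; first by rewrite big_ord0 subrr.
    by rewrite big_ord_recr /= IHd addrA subrK.
  by rewrite sumrB sx subr0 sumr_const card_ord -scaler_nat.
by rewrite linearZ -scalerBr u0E scalerA mulrC we scale1r.
Qed.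

Lemma phi_zero_1T n z : Pi n z = 0 -> phi_zero z ->
  exists2 u, Pi n u = 0 & z = u - T n u.
Proof.
move=> Pz hz.
pose uw (w : 'I_n.+1) := projT1 (cid (hz w (ltn_ord w))).
have uwE (w : 'I_n.+1) : xr n w (T n z) = uw w - t n w (uw w) by rewrite /uw; case: cid.
(* if [T z = y - T y], then [z = (z + y) - T (z + y)] *)
exists (z + \sum_(w < n.+1) xi n w (uw w)).
  by rewrite linearD Pz linear_sum big1 ?addr0 // => w _; rewrite Pi_xi.
have Tz : T n z = \sum_(w < n.+1) xi n w (uw w) - T n (\sum_(w < n.+1) xi n w (uw w)).
  rewrite -(P_T rth) (P_sum C) linear_sum -sumrB; apply: eq_bigr => w _.
  by rewrite uwE linearB T_xi.
by rewrite linearD opprD addrACA -Tz subrK.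
Qed.

(** [N] multiplies the component of [z] in [X n w] by [w + 1], so the sum of these
    components divided by [w + 1] is mapped to [z]. *)
Lemma fix_N n z : T n z = z -> exists2 v, Pi n v = 0 & N n v = z.
Proof.
move=> Tz; pose e w := sval (inv_nat w).
have eE w : w.+1%:R * e w = 1 by rewrite /e; case: (inv_nat w).
have Pz : P n z = z by rewrite -Tz (P_T rth).
pose v := \sum_(w < n.+1) e w *: xi n w (xr n w z).
have tx (w : nat) : t n w (xr n w z) = xr n w z by rewrite -xr_T // Tz.
exists v.
  by rewrite linear_sum big1 // => w _; rewrite linearZ /= Pi_xi scaler0.
have Tv : T n v = v.
  rewrite linear_sum; apply: eq_bigr => w _.
  by rewrite linearZ /= T_xi tx.
have Tiv c : iter c (T n) v = v by elim: c => //= c ->.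
rewrite -(P_N rth) (P_sum C) -[RHS]Pz (P_sum C); apply: eq_bigr => w _.
congr (xi n w _); rewrite (xr_N C).
rewrite (eq_bigr (fun=> xr n w v)) => [|c _]; last by rewrite Tiv.
rewrite sumr_const card_ord -scaler_nat /v linear_sum (bigD1 w) //= big1 ?addr0.
  by rewrite linearZ /= (xr_xi C) scalerA eE scale1r.
by move=> w' ww'; rewrite linearZ /= (xr_xi_ne C) ?scaler0 // eq_sym.
Qed.

Lemma N_1T n u : N n (u - T n u) = 0.
Proof. by rewrite linearB (N_T rth) subrr. Qed.

Lemma ker_B n z : Pi n z = 0 -> B n z = 0 <-> phi_zero z.
Proof.
move=> Pz; split=> [Bz|/(phi_zero_1T Pz) [u Pu zu]].
  by apply/N_phi_zero/h_inj_N; rewrite hN_B.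
by rewrite -hN_B // zu N_1T linear0.
Qed.

Lemma ker_B_1T n z : Pi n z = 0 -> B n z = 0 -> exists2 u, Pi n u = 0 & z = u - T n u.
Proof. by move=> Pz /(ker_B Pz); apply: phi_zero_1T. Qed.

Lemma B_h n u : Pi n u = 0 -> B n.+1 (h n u) = 0.
Proof.
move=> Pu; rewrite -hN_B; first by rewrite (N_h rth) linear0.
by rewrite (Pi_h rth) Pu linear0.
Qed.

Let Pi_b0 n z : Pi n.+1 z = 0 -> Pi n (b0 n z) = 0.
Proof. by move=> Pz; rewrite (Pi_b rth W bth (re_f rth)) // Pz linear0. Qed.

Lemma Pi_bid n z : Pi n (b n z) = b n (Pi n.+1 z).
Proof. exact: (Pi_b rth W bi fi). Qed.

Lemma b_h_b0 n u : Pi n.+1 u = 0 -> b n (h n (b0 n u)) = b0 n u - T n (b0 n u).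
Proof.
move=> Pu; have P0 := Pi_b0 Pu.
case: n u Pu P0 => [|n] u Pu P0; first by rewrite (b_h0 rth) P0 subr0.
have := b_h rth W (b0 n.+1 u).
by rewrite (opb_opb W _ bth (re_f rth) (re_M rth)) linear0 addr0 P0 subr0.
Qed.

(** [id - T] intertwines [b0] and [b] on the kernel of [Pi]. *)
Lemma b_1T n u : Pi n.+1 u = 0 -> b n (u - T n.+1 u) = b0 n u - T n (b0 n u).
Proof.
move=> Pu; rewrite -(b_h_b0 Pu).
have := b_h rth W u; rewrite Pu subr0 => <-.
by rewrite linearD (opb_opb W _ bi fi) ?add0r.
Qed.

(** The elements of the kernel of [B] whose boundary is killed by [h] and [T]
    are sums of boundaries of elements of this kernel and values of [B]. *)
Lemma key_decomp n (c : H n.+1) : Pi n.+1 c = 0 -> B n.+1 c = 0 ->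
  h n (b n c) = 0 -> T n (b n c) = 0 ->
  exists u v, [/\ Pi n.+2 u = 0, Pi n v = 0, B n.+2 u = 0 & c = b n.+1 u + B n v].
Proof.
move=> Pc Bc hbc Tbc; have [u0 Pu0 cE] := ker_B_1T Pc Bc.
have [v Pv Nv] : exists2 v, Pi n v = 0 & N n v = b0 n u0 - b n c.
  apply: fix_N; rewrite linearB Tbc subr0 cE b_1T //.
  by rewrite opprB addrC subrK.
exists (h n.+1 u0), v; split=> //.
- by rewrite (Pi_h rth) Pu0 linear0.
- exact: B_h.
- rewrite -hN_B // Nv linearB hbc subr0 cE.
  by have := b_h rth W u0; rewrite Pu0 subr0.
Qed.

Lemma key_decomp0 (c : H 0) : Pi 0 c = 0 -> B 0 c = 0 ->
  exists u, [/\ Pi 1 u = 0, B 1 u = 0 & c = b 0 u].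
Proof.
move=> Pc Bc; have [u0 Pu0 cE] := ker_B_1T Pc Bc.
exists (h 0 u0); split; [by rewrite (Pi_h rth) Pu0 linear0|exact: B_h|].
by rewrite (b_h0 rth) Pu0 subr0 cE.
Qed.

Lemma BB n z : Pi n z = 0 -> B n.+1 (B n z) = 0.
Proof.
move=> Pz; rewrite -(hN_B Pz) B_h //.
by rewrite -(P_N rth) (Pi_P rth).
Qed.

Let b_P n z : P n (b n (P n.+1 z)) = b n (P n.+1 z).
Proof. exact: (P_b_P rth W bi fi). Qed.
Let b0_P n z : P n (b0 n (P n.+1 z)) = b0 n (P n.+1 z).
Proof. exact: (P_b_P rth W bth (re_f rth)). Qed.

(** The boundary of the column complex descends to the quotients. *)
Lemma quot_b n w w' x : exists u,
  xr n w (b n (xi n.+1 w' (x - t n.+1 w' x))) = u - t n w u.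
Proof.
exists (xr n w (b0 n (xi n.+1 w' x))).
rewrite linearB -T_xi b_1T ?Pi_xi // linearB; congr (_ - _).
by rewrite xr_T // -(P_xi C) b0_P.
Qed.

(** The projection to the quotients is a chain map. *)
Lemma phi_b n w z : Pi n.+1 z = 0 -> exists u,
  xr n w (b n (T n.+1 z)) - xr n w (T n (b n z)) = u - t n w u.
Proof.
move=> Pz; set y := b0 n z; set a := b n (T n.+1 z).
have Pa : P n a = a by rewrite /a -(P_T rth) b_P.
have bz : b n z = a + (y - T n y).
  by rewrite -b_1T // /a -linearD addrC subrK.
exists (xr n w a - xr n w (T n y)).
have ea := @xr_T n w a Pa.
have ey := @xr_T n w (T n y) (P_T rth W y).
rewrite bz (linearD (T n)) (linearB (T n)) (linearD (xr n w)) (linearB (xr n w)) ea ey.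
rewrite linearB opprD !opprB -addrA; congr (_ + _).
by rewrite addrCA [RHS]addrCA; congr (_ + _); rewrite addrC.
Qed.

End Averaging.

(** * The grading given by the columns *)

Section LettersCombinatorics.
Variables (Y : zmodType) (T : Type) (a : pred T) (z : T).

Lemma has_last s : has a s -> exists s1 x s2, [/\ s = s1 ++ x :: s2, a x & ~~ has a s2].
Proof.
elim: s => [//|x s IHs] /=; case: (boolP (has a s)) => [/IHs|sa].
  by case=> s1 [y [s2 [-> ay s2a]]] _; exists (x :: s1), y, s2.
by rewrite orbF => ax; exists [::], x, s.
Qed.

(** The positions [i] with [a (nth z s i)], listed by the number of such
    positions from [i] on. *)
Lemma sum_count (F : nat -> Y) s :
  \sum_(i < size s | a (nth z s i)) F (count a (drop i s)) =
  \sum_(c < count a s) F c.+1.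
Proof.
rewrite big_mkcond /=; elim: s => [|x s IHs]; first by rewrite !big_ord0.
rewrite big_ord_recl /= IHs; case: (a x); rewrite ?add0r //=.
by rewrite add1n big_ord_recr /= addrC.
Qed.

Lemma size_rotate (s1 s3 s4 : seq T) x y :
  size ((y :: s4 ++ s1) ++ x :: s3) = size (s1 ++ x :: s3 ++ y :: s4).
Proof. by rewrite ?size_cat /= ?size_cat /= ?size_cat /=; lia. Qed.
Lemma size_rotate_add (s1 s3 s4 : seq T) x y :
  (size (s1 ++ x :: s3) + size (y :: s4 ++ s1))%N =
  (size (s1 ++ x :: s3 ++ y :: s4) + size s1)%N.
Proof. by rewrite ?size_cat /= ?size_cat /= ?size_cat /=; lia. Qed.
End LettersCombinatorics.

Section ColumnGrading.
Variables (k : comNzRingType) (A : algType k) (M : bimod A) (nabla : bimod_product M).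
Variables (K : algType k) (f : {lrmorphism K -> A}).
Local Notation fE := (Defs.fE nabla f).
Local Notation letter := (letter M).
Local Notation lext := (letter_ext nabla).
Local Notation rth := (eproj_retraction nabla f).
Implicit Types (s : seq letter) (n w i j : nat).

(** The modules [X n w] as direct summands of [H n]: [X n w] is spanned by the
    words that start with a letter in [M] and have [w] further letters in [M]. *)
Record columns (H : nat -> lmodType k) (W : words fE H)
    (X : nat -> nat -> lmodType k) := Columns {
  colw n w : seq letter -> X n w;
  coli n w : {linear X n w -> H n};
  colr n w : {linear H n -> X n w};
  colw_form n w s : ~~ xform n w s -> colw n w s = 0;
  coli_colw n w s : xform n w s -> coli n w (colw n w s) = hl W n s;
  colr_hl n w s : size s = n.+1 -> colr n w (hl W n s) = colw n w s;
  colw_ext n w (Y : lmodType k) (F G : {linear X n w -> Y}) :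
    (forall s, xform n w s -> F (colw n w s) = G (colw n w s)) -> forall x, F x = G x
}.

Variables (H : nat -> lmodType k) (W : words fE H) (X : nat -> nat -> lmodType k).
Variable C : columns W X.
Local Notation hl := (hl W).
Local Notation xw := (colw C).
Local Notation xi := (coli C).
Local Notation xr := (colr C).
Local Notation b := (opb W id).
Local Notation T := (opT (@eproj _ _ _ nabla) W).
Local Notation N := (opN (@eproj _ _ _ nabla) W).
Local Notation P := (opP (@eproj _ _ _ nabla) W).
Local Notation cM := (count (@inM _ _ M)).

Lemma xform_size n w s : xform n w s -> size s = n.+1.
Proof. by case/and3P => /eqP. Qed.
Lemma xform_count n w s : xform n w s -> cM s = w.+1.
Proof. by case/and3P; case: s => [|x s] //= _ -> /eqP ->; rewrite add1n. Qed.
Lemma xformP n w m s : size s = n -> cM s = w -> xform n w (inr m :: s).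
Proof. by move=> ss cs; rewrite /xform /= ss cs !eqxx. Qed.

Lemma colw_count n w s : cM s != w.+1 -> xw n w s = 0.
Proof. by move=> cs; apply: colw_form; apply: contra cs => /xform_count ->. Qed.

Lemma colr_coli n w x : xr n w (xi n w x) = x.
Proof.
apply: (colw_ext (c := C) (F := xr n w \o xi n w) (G := idfun)) => s xs /=.
by rewrite coli_colw // colr_hl // (xform_size xs).
Qed.

Lemma colr_coli_ne n w w' x : w != w' -> xr n w (xi n w' x) = 0.
Proof.
move=> ww; apply: (colw_ext (c := C) (F := xr n w \o xi n w') (G := \0)) => s xs /=.
rewrite coli_colw // colr_hl ?(xform_size xs) // colw_count // (xform_count xs) eqSS.
by rewrite eq_sym.
Qed.

Lemma P_head n s : size s = n.+1 ->
  P n (hl n s) = if inM (head (inl 0) s) then hl n s else 0.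
Proof.
move=> ss; rewrite /hl (opPE rth) compl_lext nth0; case: ifP => hM.
  by apply: eq_word => -[|i] // li; rewrite /upd /= nth0.
by rewrite (@word_zero _ _ _ _ _ W _ _ 0%N).
Qed.

Lemma P_coli n w x : P n (xi n w x) = xi n w x.
Proof.
apply: (colw_ext (c := C) (F := P n \o xi n w) (G := xi n w)) => s xs /=.
by rewrite coli_colw // P_head ?(xform_size xs) //; case/and3P: xs => _ ->.
Qed.

Lemma P_cols n z : P n z = \sum_(w < n.+1) xi n w (xr n w z).
Proof.
pose F (w : 'I_n.+1) : {linear H n -> H n} := xi n w \o xr n w.
have [G GE] := sum_linear_ex F.
have -> : \sum_(w < n.+1) xi n w (xr n w z) = G z by rewrite GE.
apply: (hl_ext (W := W) (F := P n) (G := G)) => s ss; rewrite GE /F P_head //=.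
case: s ss => [//|[a|m] s] [ss]; rewrite /=.
  by rewrite big1 // => w _; rewrite colr_hl /= ?ss // colw_form ?linear0 // /xform /= andbF.
have lc : (cM s < n.+1)%N by rewrite ltnS -ss count_size.
rewrite (bigD1 (Ordinal lc)) //= big1 ?addr0.
  by rewrite colr_hl /= ?ss // coli_colw //; apply: xformP.
move=> w; rewrite -val_eqE /= => wc.
rewrite colr_hl /= ?ss // colw_count ?linear0 //=.
by rewrite add1n eqSS eq_sym.
Qed.

Lemma T_hl n s : size s = n.+1 -> has (@inM _ _ M) s ->
  exists m s' (e : k), [/\ T n (hl n s) = e *: hl n (inr m :: s'), size s' = n &
    (cM s').+1 = cM s].
Proof.
move=> ss /has_last [s1 [x [s2 [es xM s2A]]]]; case: x es xM => [//|m] es _; subst s.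
exists m, (s2 ++ s1), ((-1) ^+ (n * size s1)); split.
- exact: T_letters.
- by move: ss; rewrite !size_cat /=; lia.
- by rewrite !count_cat /=; lia.
Qed.

Lemma colr_T_P n w z : xr n w (T n (P n z)) = xr n w (T n (xi n w (xr n w z))).
Proof.
apply: (hl_ext (W := W) (F := (xr n w \o T n) \o P n)
  (G := (xr n w \o T n) \o (xi n w \o xr n w))) => s ss /=.
rewrite P_head // colr_hl //.
case: s ss => [//|[a|m] s] [ss]; rewrite [head _ _]/= [inM _]/=.
  by rewrite colw_form ?linear0 // /xform /= andbF.
case: (eqVneq (cM s) w) => cs; first by rewrite coli_colw //; apply: xformP.
rewrite (@colw_count _ _ (inr m :: s)) ?linear0 /= ?add1n ?eqSS //.
have [|//|m' [s' [e [-> ss' cs']]]] := @T_hl n (inr m :: s); first by rewrite /= ss.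
rewrite linearZ /= colr_hl /= ?ss' // colw_count ?scaler0 //=.
by rewrite add1n cs' /= add1n eqSS.
Qed.

Lemma T_coli n w x : T n (xi n w x) = xi n w (xr n w (T n (xi n w x))).
Proof.
apply: (colw_ext (c := C) (F := T n \o xi n w)
  (G := xi n w \o (xr n w \o (T n \o xi n w)))) => s xs /=.
rewrite coli_colw //; have ss := xform_size xs; have cs := xform_count xs.
have [|m [s' [e [-> ss' cs']]]] := T_hl ss; first by rewrite has_count cs.
rewrite !linearZ /= colr_hl /= ?ss' // coli_colw //; apply: xformP => //.
by move: cs'; rewrite cs => -[].
Qed.

(** Each application of [T] moves one block to the front. *)
Lemma T_iter_letters n s1 m s2 : size (s1 ++ inr m :: s2) = n.+1 ->
  iter (cM (inr m :: s2)) (T n) (hl n (s1 ++ inr m :: s2)) =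
  (-1) ^+ (n * size s1) *: hl n (inr m :: s2 ++ s1).
Proof.
rewrite [cM _]/= add1n; move ec : (cM s2) => c.
elim: c s1 s2 ec => [|c IHc] s1 s2 ec ss.
  by apply: T_letters => //; rewrite has_count ec.
have /has_last [s3 [x [s4 [es xM s4A]]]] : has (@inM _ _ M) s2 by rewrite has_count ec.
case: x es xM => [//|m'] es _; subst s2.
rewrite iterSr -cat_cons catA T_letters //; last by rewrite -catA.
have s4c : cM s4 = 0%N by apply/eqP; rewrite -leqn0 leqNgt -has_count.
have ss' : size ((inr m' :: s4 ++ s1) ++ inr m :: s3) = n.+1.
  by rewrite size_rotate.
have iterZ i (e : k) x : iter i (T n) (e *: x) = e *: iter i (T n) x.
  by elim: i => //= i ->; rewrite linearZ.
have -> : inr m' :: s4 ++ s1 ++ inr m :: s3 = (inr m' :: s4 ++ s1) ++ inr m :: s3.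
  by rewrite cat_cons catA.
rewrite iterZ IHc //; last first.
  by move: ec; rewrite count_cat /= s4c; lia.
rewrite scalerA -exprD -mulnDr -!catA !cat_cons.
have -> : (size (s1 ++ inr m :: s3) + size (inr m' :: s4 ++ s1))%N = (n.+1 + size s1)%N.
  by rewrite size_rotate_add ss.
by rewrite mulnDr exprD even_full mul1r.
Qed.

Lemma T_iter_hl n s c : size s = n.+1 -> exists s' (e : k),
  [/\ iter c (T n) (hl n s) = e *: hl n s', size s' = n.+1 & cM s' = cM s].
Proof.
move=> ss; elim: c => [|c [s' [e [IH ss' cs']]]].
  by exists s, 1; rewrite scale1r.
rewrite iterS IH linearZ /=; case: (boolP (has (@inM _ _ M) s')) => hs'.
  have [m [s2 [e' [-> ss2 cs2]]]] := T_hl ss' hs'.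
  exists (inr m :: s2), (e * e'); split; [by rewrite scalerA|by rewrite /= ss2|].
  by rewrite /= add1n cs2 cs'.
exists s, 0; split=> //; rewrite (T_letters0 _ ss' hs') scaler0 scale0r //.
Qed.

(** The rotations that start in [M] are the first powers of [T]. *)
Lemma N_iter_letters n s : size s = n.+1 ->
  N n (hl n s) = \sum_(c < cM s) iter c.+1 (T n) (hl n s).
Proof.
move=> ss; rewrite (N_letters W ss).
rewrite -(@sum_count _ _ (@inM _ _ M) (inl 0) (fun c => iter c (T n) (hl n s))) ss.
apply: eq_bigr => i iM; have li : (i < size s)%N by rewrite ss ltn_ord.
have sz : size (take i s) = i by rewrite size_takel // ltnW.
have [m ed] : exists m, drop i s = inr m :: drop i.+1 s.
  rewrite (drop_nth (inl 0) li); case: (nth _ s i) iM => [//|m] _; by exists m.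
have es : take i s ++ inr m :: drop i.+1 s = s by rewrite -ed cat_take_drop.
have := @T_iter_letters n (take i s) m (drop i.+1 s).
by rewrite es sz /rot ed => -> //.
Qed.

Lemma colr_N n w z : xr n w (N n z) = \sum_(c < w.+1) xr n w (iter c.+1 (T n) z).
Proof.
have [Ti TiE] : exists Ti : nat -> {linear H n -> H n}, forall c z, Ti c z = iter c (T n) z.
  have ex c : exists Tc : {linear H n -> H n}, forall z, Tc z = iter c (T n) z.
    elim: c => [|c [Tc TcE]]; first by exists idfun.
    by exists (T n \o Tc) => x /=; rewrite TcE.
  by exists (fun c => projT1 (cid (ex c))) => c x; case: cid.
have [G GE] := sum_linear_ex (fun c : 'I_w.+1 => xr n w \o Ti c.+1).
transitivity (G z); last by rewrite GE; apply: eq_bigr => c _ /=; rewrite TiE.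
apply: (hl_ext (W := W) (F := xr n w \o N n) (G := G)) => s ss.
rewrite GE [LHS]/= N_iter_letters // linear_sum.
case: (eqVneq (cM s) w.+1) => [->|cs].
  by apply: eq_bigr => c _; rewrite [RHS]/= TiE.
have z0 c : xr n w (iter c (T n) (hl n s)) = 0.
  have [s' [e [-> ss' cs']]] := T_iter_hl c ss.
  by rewrite linearZ /= colr_hl // colw_count ?scaler0 // cs'.
by rewrite !big1 // => c _; rewrite /= ?TiE z0.
Qed.

Definition columns_grading : grading (@eproj _ _ _ nabla) W X :=
  Grading colr_coli colr_coli_ne P_coli P_cols colr_T_P T_coli colr_N.

Local Notation mmul := (merge_at (inl 0) (@letter_mul _ _ M)).
Local Notation mnab := (merge_at (inl 0) (letter_nab nabla)).
Local Notation rmul := (merge_around (inl 0) (@letter_mul _ _ M)).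
Local Notation rnab := (merge_around (inl 0) (letter_nab nabla)).

(** In each face, the product of two letters is split into its components in
    [A] and [M]: the one of the bimodule products, and that of the product of
    [M]. *)
Lemma b_hl n s : size s = n.+2 -> b n (hl n.+1 s) =
  \sum_(j < n.+1) (-1) ^+ j *: (hl n (mmul j s) + hl n (mnab j s)) +
  (-1) ^+ n.+1 *: (hl n (rmul s) + hl n (rnab s)).
Proof.
move=> ss; rewrite /hl (opbE W _ _ (bilin_id fE) (fun=> erefl)) big_ord_recr /=.
have split_at i g g1 g2 : (i <= n)%N -> g i = g1 i + g2 i ->
    (forall l, l != i -> g l = g1 l /\ g l = g2 l) ->
    word W n g = word W n g1 + word W n g2.
  move=> li gi gl.
  have -> : word W n g = word W n (upd g i (g1 i + g2 i)).
    by apply: eq_word => l _; rewrite /upd; case: eqP => // ->.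
  rewrite (cm_add (cmf_word W n)) //; congr (_ + _); apply: eq_word => l _;
    by rewrite /upd; case: (eqVneq l i) => [->//|/gl []].
congr (_ + _ *: _).
  apply: eq_bigr => j _; congr (_ *: _).
  have lj := ltn_ord j; rewrite ltnS in lj.
  have ls : (j.+1 < size s)%N by rewrite ss !ltnS.
  apply: (split_at j) => // [|l lnj].
    rewrite !nth_merge_at // /face ltn_eqF // ltnn eqxx; exact: lextM.
  by rewrite !nth_merge_at // /face ltn_eqF // (negPf lnj); case: ifP.
have ls : (1 < size s)%N by rewrite ss.
rewrite (@eq_word _ _ _ _ _ W n _ (fun l => if l == 0%N then
   lext (nth (inl 0) s n.+1) * lext (nth (inl 0) s 0) else lext (nth (inl 0) s l))); last first.
  by move=> l _; rewrite /face eqxx.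
rewrite (@eq_word _ _ _ _ _ W n (fun l => lext (nth (inl 0) (rmul s) l))
  (fun l => if l == 0%N then lext (letter_mul (nth (inl 0) s n.+1) (nth (inl 0) s 0))
     else lext (nth (inl 0) s l))); last first.
  by move=> l ll; rewrite nth_merge_around ss //; case: eqP.
rewrite (@eq_word _ _ _ _ _ W n (fun l => lext (nth (inl 0) (rnab s) l))
  (fun l => if l == 0%N then lext (letter_nab nabla (nth (inl 0) s n.+1) (nth (inl 0) s 0))
     else lext (nth (inl 0) s l))); last first.
  by move=> l ll; rewrite nth_merge_around ss //; case: eqP.
apply: (split_at 0%N) => //=; first exact: lextM.
by move=> l /negPf ->.
Qed.

Lemma colw_zero n w s i : size s = n.+1 -> (i <= n)%N ->
  lext (nth (inl 0) s i) = 0 -> xw n w s = 0.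
Proof. by move=> ss li e; rewrite -(colr_hl C w ss) (hl_zero W li e) linear0. Qed.

Lemma letter_mul_count (x y : letter) : lext (letter_mul x y) = 0 \/
  (inM x + inM y = inM (letter_mul x y))%N.
Proof. by case: x y => [a|m] [a'|m']; [right|right|right|left]. Qed.

Lemma letter_nab_count (x y : letter) : lext (letter_nab nabla x y) = 0 \/
  (inM x + inM y = (inM (letter_nab nabla x y)).+1)%N.
Proof. by case: x y => [a|m] [a'|m']; [left|left|left|right]. Qed.

(** A product of two letters that loses [d] letters in [M] sends a word to a
    word of weight [w] only if the word had weight [w + d]. *)
Lemma colw_merge_at n w j s (op : letter -> letter -> letter) d : size s = n.+2 ->
  (forall x y, lext (op x y) = 0 \/ (inM x + inM y = inM (op x y) + d)%N) ->
  (j <= n)%N -> cM s != (w.+1 + d)%N -> xw n w (merge_at (inl 0) op j s) = 0.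
Proof.
move=> ss hop lj cs; have ls : (j.+1 < size s)%N by rewrite ss !ltnS.
have sm : size (merge_at (inl 0) op j s) = n.+1 by rewrite size_merge_at ?ss.
case: (hop (nth (inl 0) s j) (nth (inl 0) s j.+1)) => e.
  by apply: (colw_zero _ sm lj); rewrite nth_merge_at // ltnn eqxx.
apply: colw_count; apply: contra cs => /eqP cm.
have := count_merge_at (inl 0) op (@inM _ _ M) ls.
by rewrite cm e [(_ + d)%N]addnC addnA => /addIn <-.
Qed.

Lemma colw_merge_around n w s (op : letter -> letter -> letter) d : size s = n.+2 ->
  (forall x y, lext (op x y) = 0 \/ (inM x + inM y = inM (op x y) + d)%N) ->
  cM s != (w.+1 + d)%N -> xw n w (merge_around (inl 0) op s) = 0.
Proof.
move=> ss hop cs; have ls : (1 < size s)%N by rewrite ss.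
have sm : size (merge_around (inl 0) op s) = n.+1 by rewrite size_merge_around ?ss.
case: (hop (last (inl 0) s) (head (inl 0) s)) => e.
  by apply: (colw_zero _ sm (leq0n n)).
apply: colw_count; apply: contra cs => /eqP cm.
have := count_merge_around (inl 0) op (@inM _ _ M) ls.
by rewrite cm e [(_ + d)%N]addnC addnA => /addIn <-.
Qed.

Let mulc (x y : letter) : lext (letter_mul x y) = 0 \/
  (inM x + inM y = inM (letter_mul x y) + 0)%N.
Proof. by rewrite addn0; apply: letter_mul_count. Qed.
Let nabc (x y : letter) : lext (letter_nab nabla x y) = 0 \/
  (inM x + inM y = inM (letter_nab nabla x y) + 1)%N.
Proof. by rewrite addn1; apply: letter_nab_count. Qed.

Lemma colr_b n w s : size s = n.+2 -> xr n w (b n (hl n.+1 s)) =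
  (\sum_(j < n.+1) (-1) ^+ j *: xw n w (mmul j s) + (-1) ^+ n.+1 *: xw n w (rmul s)) +
  (\sum_(j < n.+1) (-1) ^+ j *: xw n w (mnab j s) + (-1) ^+ n.+1 *: xw n w (rnab s)).
Proof.
move=> ss; rewrite b_hl // linearD linear_sum linearZ linearD /=.
have ls : (1 < size s)%N by rewrite ss.
rewrite !colr_hl ?size_merge_around ?ss // scalerDr addrACA -big_split; congr (_ + _).
apply: eq_bigr => j _; have lj : (j.+1 < size s)%N by rewrite ss ltnS ltn_ord.
by rewrite linearZ linearD /= !colr_hl ?size_merge_at // ?ss // scalerDr.
Qed.

(** The component of [b] that preserves the weight is the internal boundary, and
    the one that lowers it by one is the boundary given by the product of [M]. *)
Lemma colr_b_same n w s : xform n.+1 w s -> xr n w (b n (hl n.+1 s)) =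
  \sum_(j < n.+1) (-1) ^+ j *: xw n w (mmul j s) + (-1) ^+ n.+1 *: xw n w (rmul s).
Proof.
move=> xs; have ss := xform_size xs; have cs := xform_count xs.
have c1 : cM s != (w.+1 + 1)%N by rewrite cs addn1 neq_ltn ltnSn.
rewrite colr_b // [X in _ + X = _](_ : _ = 0) ?addr0 //.
rewrite (colw_merge_around ss nabc c1) scaler0 addr0 big1 // => j _.
by rewrite (colw_merge_at ss nabc _ c1) ?scaler0 // -ltnS.
Qed.

Lemma colr_b_down n w s : xform n.+1 w.+1 s -> xr n w (b n (hl n.+1 s)) =
  \sum_(j < n.+1) (-1) ^+ j *: xw n w (mnab j s) + (-1) ^+ n.+1 *: xw n w (rnab s).
Proof.
move=> xs; have ss := xform_size xs; have cs := xform_count xs.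
have c1 : cM s != (w.+1 + 0)%N by rewrite cs addn0 neq_ltn ltnSn orbT.
rewrite colr_b // [X in X + _ = _](_ : _ = 0) ?add0r //.
rewrite (colw_merge_around ss mulc c1) scaler0 addr0 big1 // => j _.
by rewrite (colw_merge_at ss mulc _ c1) ?scaler0 // -ltnS.
Qed.

Lemma colr_b_ne n w w' x : w' != w -> w' != w.+1 -> xr n w (b n (xi n.+1 w' x)) = 0.
Proof.
move=> ww1 ww2.
apply: (colw_ext (c := C) (F := (xr n w \o b n) \o xi n.+1 w') (G := \0)) => s xs.
have ss := xform_size xs; have cs := xform_count xs.
have c1 : cM s != (w.+1 + 1)%N by rewrite cs addn1 eqSS.
have c0 : cM s != (w.+1 + 0)%N by rewrite cs addn0 eqSS.
rewrite [LHS]/= coli_colw // colr_b //.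
rewrite (colw_merge_around ss nabc c1) (colw_merge_around ss mulc c0) !scaler0 !addr0.
rewrite !big1 ?addr0 // => j _.
  by rewrite (colw_merge_at ss nabc _ c1) ?scaler0 // -ltnS.
by rewrite (colw_merge_at ss mulc _ c0) ?scaler0 // -ltnS.
Qed.

Lemma colr_b_sum n w z : (w <= n)%N -> P n.+1 z = z -> xr n w (b n z) =
  xr n w (b n (xi n.+1 w (xr n.+1 w z))) + xr n w (b n (xi n.+1 w.+1 (xr n.+1 w.+1 z))).
Proof.
move=> lw Pz; rewrite -[in LHS]Pz P_cols !linear_sum /=.
have l1 : (w < n.+2)%N by lia.
have l2 : (w.+1 < n.+2)%N by lia.
rewrite (bigD1 (Ordinal l1)) //= (bigD1 (Ordinal l2)) /=; last first.
  by rewrite -val_eqE /= neq_ltn ltnSn orbT.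
rewrite [X in _ + (_ + X)]big1 ?addr0 // => i /andP[].
by rewrite -!val_eqE /= => i1 i2; apply: colr_b_ne.
Qed.

End ColumnGrading.

(** * Homology and mixed complexes *)

Section HomologyIso.
Variable k : comNzRingType.

(** A criterion on cycles and boundaries for a linear map to induce an isomorphism
    in homology. *)
Lemma homology_at_iso (U V W U' V' W' : lmodType k)
    (D : {linear U -> V}) (G : {linear V -> W})
    (D' : {linear U' -> V'}) (G' : {linear V' -> W'}) (phi : {linear V -> V'}) :
  (forall x, G x = 0 -> G' (phi x) = 0) ->
  (forall x, exists y, phi (D x) = D' y) ->
  (forall y, G' y = 0 -> exists x z, G x = 0 /\ phi x = y + D' z) ->
  (forall x y, G x = 0 -> phi x = D' y -> exists z, x = D z) ->
  isomorphic (homology_at D G) (homology_at D' G').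
Proof.
move=> hG hD hsurj hinj.
pose S := submod (kerp G); pose S' := submod (kerp G').
have kG (x : S) : G (\val x) = 0 by apply/eqP; have := valP x; rewrite inE.
have pP (x : S) : phi (\val x) \in kerp G' by rewrite inE hG // kG.
pose r0 (x : S) : S' := Sub (phi (\val x)) (pP x).
have r0_lin : linear r0.
  by move=> c x y; apply: val_inj; rewrite /= !linearP.
have [r rE] := linear_ext r0_lin.
have rv x : \val (r x) = phi (\val x) by rewrite rE.
pose Q := preimp (\val : {linear S -> V}) (imp D).
pose Q' := preimp (\val : {linear S' -> V'}) (imp D').
have [|F FE] := @qlift_ex k S (qmod Q') Q (qpi Q' \o r).
  move=> x; rewrite inE => /asboolP [u ux]; apply/qpi_eq0; rewrite inE; apply/asboolP.
  by have [y e] := hD u; exists y; apply: etrans _ (esym (rv x)); rewrite -ux e.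
exists F; apply: inj_surj_bij.
  suff F0 x : F x = 0 -> x = 0.
    move=> x y e; apply/eqP; rewrite -subr_eq0; apply/eqP; apply: F0.
    by rewrite linearB e subrr.
  have [v ->] := qpi_surj x; rewrite FE => /qpi_eq0; rewrite inE => /asboolP [y e].
  apply/qpi_eq0; rewrite inE; apply/asboolP.
  have [|z ez] := hinj (\val v) y (kG v); first exact: etrans (esym (rv v)) (esym e).
  by exists z.
move=> y; have [v ->] := qpi_surj y.
have kv : G' (\val v) = 0 by apply/eqP; have := valP v; rewrite inE.
have [x [z [Gx ex]]] := hsurj _ kv.
have xk : x \in kerp G by rewrite inE Gx.
exists (qpi Q (Sub x xk)); rewrite FE; apply/qpi_eq; rewrite inE; apply/asboolP.
have e1 : \val (r (Sub x xk) - v) = phi x - \val v.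
  by apply: etrans (linearB _ _ _) _; exact: (congr1 (fun t => t - \val v) (rv _)).
by exists z; apply: etrans _ (esym e1); rewrite ex addrC addKr.
Qed.

(** [c] is a cycle; every element of degree 0 is one. *)
Definition cycle (C : nat -> lmodType k) (D : forall n, {linear C n.+1 -> C n})
    n : C n -> Prop :=
  match n with 0 => fun=> True | m.+1 => fun c => D m c = 0 end.

(** A surjective chain map with acyclic kernel is a quasi-isomorphism. *)
Lemma homology_iso (C C' : nat -> lmodType k)
    (D : forall n, {linear C n.+1 -> C n}) (D' : forall n, {linear C' n.+1 -> C' n})
    (phi : forall n, {linear C n -> C' n}) :
  (forall n y, exists x, phi n x = y) ->
  (forall n x, phi n (D n x) = D' n (phi n.+1 x)) ->
  (forall n x, D n (D n.+1 x) = 0) ->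
  (forall n c, cycle D c -> phi n c = 0 -> exists2 e, D n e = c & phi n.+1 e = 0) ->
  forall n, isomorphic (homology D n) (homology D' n).
Proof.
move=> surj chain DD acyc n.
case: n => [|n]; apply: (homology_at_iso (phi := phi _)).
- by [].
- by move=> x; exists (phi 1%N x); apply: chain.
- by move=> y _; have [x xy] := surj _ y; exists x, 0; rewrite linear0 addr0.
- move=> x y _ e; have [z zy] := surj _ y.
  have [//||w wx _] := acyc 0 (x - D 0 z); first by rewrite linearB chain e zy subrr.
  by exists (z + w); rewrite linearD wx addrC subrK.
- by move=> x Dx; rewrite -chain Dx linear0.
- by move=> x; exists (phi n.+2 x); apply: chain.
- move=> y Dy; have [x xy] := surj _ y.
  have [||e ex pe] := acyc n (D n x).
  + by case: n x y Dy xy => //= n x *; apply: DD.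
  + by rewrite chain xy.
  exists (x - e), 0; rewrite linear0 addr0 !linearB ex subrr; split=> //.
  by rewrite pe subr0.
- move=> x y Dx e; have [z zy] := surj _ y.
  have [||w wx _] := acyc n.+1 (x - D n.+1 z).
  + by rewrite /= linearB Dx DD subrr.
  + by rewrite linearB chain e zy subrr.
  by exists (z + w); rewrite linearD wx addrC subrK.
Qed.

End HomologyIso.

Section MixedComplex.
Variables (k : comNzRingType) (C : nat -> lmodType k).
Variables (b : forall n, {linear C n.+1 -> C n}) (B : forall n, {linear C n -> C n.+1}).
Local Notation tot := (mixed_tot C).
Local Notation D := (mixed_diff b B).

Lemma mixed_top_linear_ex n : exists top : {linear tot n -> C n}, forall c, top c = mixed_top c.
Proof. exact: linear_ext (@mixed_top_linear k C n). Qed.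

(** [v] in the first summand of the total complex. *)
Definition mixed_emb n : C n -> tot n :=
  match n return C n -> tot n with
  | 0 => id | 1 => id | p.+2 => fun v => (v, 0 : tot p)
  end.

Lemma mixed_top_emb n v : mixed_top (@mixed_emb n v) = v.
Proof. by case: n v => [|[|n]]. Qed.

Lemma mixed_topD n (c c' : tot n) : mixed_top (c + c') = mixed_top c + mixed_top c'.
Proof. exact: linear_additive (@mixed_top_linear k C n) c c'. Qed.
Lemma mixed_top0 n : mixed_top (0 : tot n) = 0.
Proof. by case: n => [|[|n]]. Qed.

Lemma mixed_top_diff_ker (Y : nat -> lmodType k) (phi : forall n, {linear C n -> Y n}) :
  (forall n z, phi n.+1 (B n z) = 0) ->
  forall n c, phi n (mixed_top (D n c)) = phi n (b n (mixed_top c)).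
Proof.
move=> phiB [|[|n]] c //.
  by rewrite [mixed_top _]/= linearD phiB addr0.
by rewrite [mixed_top _]/= linearD phiB addr0.
Qed.

Lemma mixed_top_diff_emb n v : mixed_top (D n (mixed_emb v)) = b n v.
Proof.
case: n v => [|[|n]] v; first by [].
  by change (b 1 v + B 0 0 = b 1 v); rewrite linear0 addr0.
change (b n.+2 v + B n.+1 (mixed_top (0 : tot n.+1)) = b n.+2 v).
by rewrite mixed_top0 linear0 addr0.
Qed.

Hypothesis bb : forall n z, b n (b n.+1 z) = 0.
Hypothesis bB : forall n z, b n.+1 (B n.+1 z) + B n (b n z) = 0.
Hypothesis bB0 : forall z, b 0 (B 0 z) = 0.
Hypothesis BB : forall n z, B n.+1 (B n z) = 0.

Lemma mixed_diff_diff n c : D n (D n.+1 c) = 0.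
Proof.
have step m (x : C m.+3) (y : C m.+1) : b m.+1 (b m.+2 x + B m.+1 y) + B m (b m y) = 0.
  by rewrite linearD bb add0r bB.
suff [] : (forall c, D n (D n.+1 c) = 0) /\ (forall c, D n.+1 (D n.+2 c) = 0) by [].
elim: n {c} => [|n [IH1 IH2]].
  split=> -[x y].
    change (b 0 (b 1 x + B 0 y) = 0); by rewrite linearD bb bB0 add0r.
  change (b 1 (b 2 x + B 1 y) + B 0 (b 0 y) = 0); exact: step.
split=> // -[x y].
change ((b n.+2 (b n.+3 x + B n.+2 (mixed_top (y : tot n.+2))) +
  B n.+1 (mixed_top (D n.+1 y)), D n (D n.+1 y)) = (0, 0)).
congr (_, _); last exact: IH1.
suff [z e] : exists z, mixed_top (D n.+1 y) = b n.+1 (mixed_top (y : tot n.+2)) + B n z.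
  by rewrite e !linearD bb add0r BB addr0 bB.
case: n x y {IH1 IH2} => [|n] x [y1 y2]; first by exists y2.
by exists (mixed_top (y2 : tot n.+1)).
Qed.

Hypothesis key0 : forall c : C 0, B 0 c = 0 -> exists2 u, B 1 u = 0 & c = b 0 u.
Hypothesis key1 : forall c : C 1, B 1 c = 0 -> b 0 c = 0 ->
  exists u v, B 2 u = 0 /\ c = b 1 u + B 0 v.
Hypothesis keyS : forall n (c : C n.+2) (c' : C n), B n.+2 c = 0 ->
  b n.+1 c + B n c' = 0 -> exists u v, B n.+3 u = 0 /\ c = b n.+2 u + B n.+1 v.

(** The cycles of the total complex with leading term in the kernel of [B] are
    the boundaries of such elements. *)
Lemma mixed_acyclic n (c : tot n) : cycle D c -> B n (mixed_top c) = 0 ->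
  exists2 e, D n e = c & B n.+1 (mixed_top e) = 0.
Proof.
suff [] : (forall c : tot n, cycle D c -> B n (mixed_top c) = 0 ->
    exists2 e, D n e = c & B n.+1 (mixed_top e) = 0) /\
  (forall c : tot n.+1, cycle D c -> B n.+1 (mixed_top c) = 0 ->
    exists2 e, D n.+1 e = c & B n.+2 (mixed_top e) = 0) by move=> h _; apply: h.
elim: n {c} => [|n [IH1 IH2]].
  split=> c /=; first by move=> _ /key0 [u Bu ->]; exists u.
  move=> Dc /key1 /(_ Dc) [u [v [Bu ->]]].
  by exists (u, v).
split=> // c Dc Bc.
have [h1 h2] : b n.+1 c.1 + B n (mixed_top c.2) = 0 /\ cycle D c.2.
  case: n c Dc {IH1 IH2 Bc} => [|n] c Dc; first by [].
  by case: (Dc : (_, _) = (0, 0)).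
have [u [v [Bu cE]]] := keyS Bc h1.
(* the boundary of [(u, v, 0, ...)] has the same leading term as [c] *)
pose c2 : tot n := c.2 - D n (mixed_emb v).
have c2c : cycle D c2.
  case: n c Dc IH1 IH2 Bc h1 h2 u v Bu cE @c2 => [//|n] c Dc IH1 IH2 Bc h1 h2 u v Bu cE.
  by rewrite /= linearB mixed_diff_diff h2 subrr.
have Bc2 : B n (mixed_top c2) = 0.
  have [t tE] := mixed_top_linear_ex n.
  rewrite /c2 -tE linearB !tE mixed_top_diff_emb linearB.
  move: h1; rewrite {1}(_ : c.1 = b n.+2 u + B n.+1 v) // linearD bb add0r => h1.
  apply/eqP; rewrite subr_eq0; apply/eqP.
  by apply: (addrI (b n.+1 (B n.+1 v))); rewrite h1 bB.
have [e eE Be] := IH1 c2 c2c Bc2.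
have e1 : b n.+2 u + B n.+1 (mixed_top (mixed_emb v + e)) = c.1.
  by rewrite mixed_topD mixed_top_emb linearD Be addr0 -cE; case: (c).
have e2 : D n (mixed_emb v + e) = c.2 by rewrite linearD eE addrC subrK.
exists (u, mixed_emb v + e); last exact: Bu.
by apply: etrans (congr2 pair e1 e2) _; case: (c).
Qed.

End MixedComplex.

(** * From the mixed complex to the quotients of the columns *)

Section Assembly.
Variables (k : comNzRingType) (Qk : {rmorphism rat -> k}).
Variables (K R : algType k) (f : {lrmorphism K -> R}).
Variables (th : R -> R) (rth : retraction f th).
Variables (H : nat -> lmodType k) (W : words f H) (X : nat -> nat -> lmodType k).
Variable C : grading th W X.
Local Notation xi := (cxi C).
Local Notation xr := (cxr C).
Local Notation t := (xt C).
Local Notation T := (opT th W).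
Local Notation h := (oph th W).
Local Notation Pi := (opPi th W).
Local Notation P := (opP th W).
Implicit Types n : nat.

Hypothesis b_sum : forall n (w : nat) z, (w <= n)%N -> P n.+1 z = z ->
  xr n w (opb W id n z) =
  xr n w (opb W id n (xi n.+1 w (xr n.+1 w z))) +
  xr n w (opb W id n (xi n.+1 w.+1 (xr n.+1 w.+1 z))).

(* the kernel of [Pi] as a mixed complex *)
Variables (C0 : nat -> lmodType k) (vl : forall n, {linear C0 n -> H n}).
Hypothesis vl_inj : forall n, injective (vl n).
Hypothesis vl_Pi : forall n x, Pi n (vl n x) = 0.
Hypothesis vl_surj : forall n z, Pi n z = 0 -> exists x, vl n x = z.
Variables (b : forall n, {linear C0 n.+1 -> C0 n}).
Variables (B : forall n, {linear C0 n -> C0 n.+1}).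
Hypothesis vl_b : forall n x, vl n (b n x) = opb W id n (vl n.+1 x).
Hypothesis vl_B : forall n x, vl n.+1 (B n x) = opB W n (vl n x).

(* the quotients of the columns, and their total complex *)
Variables (Xb : nat -> nat -> lmodType k) (q : forall n w, {linear X n w -> Xb n w}).
Hypothesis q_surj : forall n w y, exists x, q n w x = y.
Hypothesis q_ker : forall n w x, q n w x = 0 <-> exists u, x = u - t n w u.
Variables (bb : forall n w, {linear Xb n.+1 w -> Xb n w}).
Variables (dd : forall n w, {linear Xb n.+1 w.+1 -> Xb n w}).
Hypothesis bbE : forall n w x,
  bb n w (q n.+1 w x) = q n w (xr n w (opb W id n (xi n.+1 w x))).
Hypothesis ddE : forall n w x,
  dd n w (q n.+1 w.+1 x) = q n w (xr n w (opb W id n (xi n.+1 w.+1 x))).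
Let tot n : lmodType k := dsum (fun w : 'I_n.+1 => Xb n w).
Variable D : forall n, {linear tot n.+1 -> tot n}.
Hypothesis DE : forall n (y : tot n.+1) (w : 'I_n.+1),
  dcomp (D n y) w = bb n w (dcomp y (widen_ord (leqnSn _) w))
                  + dd n w (dcomp y (lift ord0 w)).

Lemma phi_ex n : exists F : {linear C0 n -> tot n}, forall x (w : 'I_n.+1),
  dcomp (F x) w = q n w (xr n w (T n (vl n x))).
Proof.
pose g (x : C0 n) : tot n :=
  mkdsum (fun w : 'I_n.+1 => q n w (xr n w (T n (vl n x)))).
have gl : linear g.
  move=> c x y; apply: dcompP => w.
  have dl := @dcomp_linear k _ (fun w : 'I_n.+1 => Xb n w) w.
  apply: etrans (dcompE _ _) _; apply: esym; apply: etrans (dl _ _ _) _.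
  by rewrite !dcompE !linearP.
have [F FE] := linear_ext gl.
by exists F => x w; rewrite FE dcompE.
Qed.

(* [phi z] is the family of the classes of the components of [T z] *)
Let phi n := projT1 (cid (phi_ex n)).
Let phiE n x (w : 'I_n.+1) : dcomp (phi n x) w = q n w (xr n w (T n (vl n x))).
Proof. by rewrite /phi; case: cid. Qed.

Let Bvl0 n x : B n x = 0 <-> opB W n (vl n x) = 0.
Proof.
split=> [Bx|Bx]; first by rewrite -vl_B Bx linear0.
by apply: vl_inj; rewrite vl_B Bx linear0.
Qed.

Let phi0 n x : phi n x = 0 <-> B n x = 0.
Proof.
rewrite Bvl0 (ker_B Qk rth C (vl_Pi x)); split=> [e w lw|hz].
  apply/q_ker; have := phiE x (Ordinal lw); rewrite e /= => <-.
  have dl := @dcomp_linear k _ (fun w : 'I_n.+1 => Xb n w) (Ordinal lw).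
  by have := linear_scalable dl 0 0; rewrite !scale0r.
apply: dcompP => w; rewrite phiE.
have dl := @dcomp_linear k _ (fun w : 'I_n.+1 => Xb n w) w.
have -> : dcomp (0 : tot n) w = 0.
  by have := linear_scalable dl 0 0; rewrite !scale0r.
by apply/q_ker/hz.
Qed.

Let phi_surj n y : exists x, phi n x = y.
Proof.
have ex (w : 'I_n.+1) : exists x, q n w x = dcomp y w by apply: q_surj.
pose x (w : 'I_n.+1) := projT1 (cid (ex w)).
have xE (w : 'I_n.+1) : q n w (x w) = dcomp y w by rewrite /x; case: cid.
pose z := \sum_(w < n.+1) xi n w (x w).
have Pz : P n z = z.
  by rewrite linear_sum; apply: eq_bigr => w _; rewrite (P_xi C).
have [c cz] : exists c, vl n c = z.
  by apply: vl_surj; rewrite -Pz (Pi_P rth).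
have xz (w : 'I_n.+1) : xr n w z = x w.
  rewrite /z linear_sum (bigD1 w) //= big1 ?addr0 ?(xr_xi C) //.
  by move=> w' ww'; rewrite (xr_xi_ne C) // eq_sym.
exists c; apply: dcompP => w; rewrite phiE cz (xr_T C) // xz -xE.
apply/eqP; rewrite eq_sym -subr_eq0 -linearB; apply/eqP/q_ker.
by exists (x w).
Qed.

Let phi_chain n x : phi n (b n x) = D n (phi n.+1 x).
Proof.
apply: dcompP => w; rewrite phiE DE !phiE bbE ddE vl_b.
rewrite -(linearD (q n w)).
have e := @b_sum n w (T n.+1 (vl n.+1 x)) (ltn_ord w) (P_T rth W _).
rewrite -[X in q n w X = _]/(xr n w (T n (opb W id n (vl n.+1 x)))).
apply: esym; apply/eqP; rewrite -subr_eq0 -linearB; apply/eqP/q_ker.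
have [u uE] := phi_b rth C w (vl_Pi x).
by exists u; rewrite -uE e.
Qed.

Let bbz n z : b n (b n.+1 z) = 0.
Proof.
apply: vl_inj; rewrite !vl_b linear0.
exact: (opb_opb W _ (bilin_id f)).
Qed.
Let bBz n z : b n.+1 (B n.+1 z) + B n (b n z) = 0.
Proof.
by apply: vl_inj; rewrite linearD linear0 vl_b !vl_B vl_b opb_opB.
Qed.
Let bB0z z : b 0 (B 0 z) = 0.
Proof. by apply: vl_inj; rewrite vl_b vl_B linear0 opb_opB0. Qed.
Let BBz n z : B n.+1 (B n z) = 0.
Proof. by apply: vl_inj; rewrite !vl_B linear0 (BB rth). Qed.

Let vl_ex2 n z : Pi n z = 0 -> opB W n z = 0 -> exists2 u, vl n u = z & B n u = 0.
Proof.
move=> Pz Bz; have [u uz] := vl_surj Pz; exists u => //.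
by apply/Bvl0; rewrite uz.
Qed.

Let key0 (c : C0 0) : B 0 c = 0 -> exists2 u, B 1 u = 0 & c = b 0 u.
Proof.
move=> /Bvl0 Bc; have [u [Pu Bu cE]] := key_decomp0 Qk rth C (vl_Pi c) Bc.
have [u' uu' Bu'] := vl_ex2 Pu Bu.
by exists u' => //; apply: vl_inj; rewrite vl_b uu'.
Qed.

Let key n (c : C0 n.+1) : B n.+1 c = 0 -> h n (vl n (b n c)) = 0 ->
  T n (vl n (b n c)) = 0 -> exists u v, B n.+2 u = 0 /\ c = b n.+1 u + B n v.
Proof.
rewrite vl_b => /Bvl0 Bc hc Tc.
have [u [v [Pu Pv Bu cE]]] := key_decomp Qk rth C (vl_Pi c) Bc hc Tc.
have [u' uu' Bu'] := vl_ex2 Pu Bu; have [v' vv'] := vl_surj Pv.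
exists u', v'; split=> //; apply: vl_inj.
by rewrite linearD vl_b vl_B uu' vv'.
Qed.

Let key1 (c : C0 1) : B 1 c = 0 -> b 0 c = 0 ->
  exists u v, B 2 u = 0 /\ c = b 1 u + B 0 v.
Proof. by move=> Bc bc; apply: key; rewrite // bc !linear0. Qed.

Let keyS n (c : C0 n.+2) (c' : C0 n) : B n.+2 c = 0 ->
  b n.+1 c + B n c' = 0 -> exists u v, B n.+3 u = 0 /\ c = b n.+2 u + B n.+1 v.
Proof.
move=> Bc /eqP; rewrite addr_eq0 => /eqP e.
have vB : vl n.+1 (b n.+1 c) = - h n (opN th W n (vl n c')).
  by rewrite e linearN vl_B -(hN_B rth) // vl_Pi.
apply: key => //; rewrite vB linearN; apply/eqP; rewrite oppr_eq0; apply/eqP.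
  exact: h_h.
exact: T_h.
Qed.

(** The cyclic homology of the kernel of [Pi] is the homology of the total
    complex of the quotients of the columns. *)
Lemma cyclic_homology_iso n : isomorphic (cyclic_homology b B n) (homology D n).
Proof.
have [psi psiE] : exists psi : forall n, {linear mixed_tot C0 n -> tot n},
    forall n c, psi n c = phi n (mixed_top c).
  have ex n' : exists F : {linear mixed_tot C0 n' -> tot n'},
      forall c, F c = phi n' (mixed_top c).
    have [top topE] := mixed_top_linear_ex C0 n'.
    by exists (phi n' \o top) => c /=; rewrite topE.
  by exists (fun n' => projT1 (cid (ex n'))) => n' c; case: cid.
have phiB m z : phi m.+1 (B m z) = 0 by apply/phi0; apply: BBz.
apply: (homology_iso (phi := psi)).
- move=> m y; have [x <-] := phi_surj y.
  by exists (mixed_emb x); rewrite psiE mixed_top_emb.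
- move=> m x; rewrite !psiE -phi_chain.
  exact: (mixed_top_diff_ker b (phi := phi) phiB).
- exact: (mixed_diff_diff bbz bBz bB0z BBz).
- move=> m c cyc_c; rewrite psiE => /phi0 Bc.
  have [e eE Be] := mixed_acyclic bbz bBz bB0z BBz key0 key1 keyS cyc_c Bc.
  by exists e => //; rewrite psiE; apply/phi0.
Qed.

End Assembly.

(** * The relative complex *)

Section Functoriality.
Variables (k : comNzRingType) (K R R' : algType k).
Variables (f : {lrmorphism K -> R}) (f' : {lrmorphism K -> R'}) (phi : R -> R').
Hypotheses (phi_lin : linear phi) (phi_f : forall a, phi (f a) = f' a).
Hypothesis phiM : {morph phi : x y / x * y}.

(** A morphism of algebras under [K] acts on words letter by letter. *)
Lemma word_map_ex (H : nat -> lmodType k) (W : words f H)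
    (H' : nat -> lmodType k) (W' : words f' H') n :
  exists G : {linear H n -> H' n}, forall g, G (word W n g) = word W' n (phi \o g).
Proof.
have cF := cmf_word W' n; have vF := van_word W' n.
have e (g : nat -> R) i x l : (phi \o upd g i x) l = upd (phi \o g) i (phi x) l.
  by rewrite /upd /=; case: eqP.
have eF (g : nat -> R) i x : word W' n (phi \o upd g i x) =
    word W' n (upd (phi \o g) i (phi x)) by apply: (cm_ext cF).
apply: (word_lift W (F := fun g => word W' n (phi \o g))); last first.
  by move=> g i a li; rewrite eF phi_f vF.
split.
- by move=> g g' h; apply: (cm_ext cF) => i li /=; rewrite h.
- by move=> g i c x y li; rewrite !eF phi_lin (cm_lin cF).
- move=> g i a li; rewrite !eF !phiM !phi_f.
  exact: (cm_bal cF (phi \o g)).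
Qed.
End Functoriality.

Section BaseKernel.
Variables (k : comNzRingType) (K R R' : algType k).
Variables (f : {lrmorphism K -> R}) (f' : {lrmorphism K -> R'}).
Variables (out : R -> R') (inn : R' -> R).
Hypotheses (inn_lin : linear inn) (inn_f : forall a, inn (f' a) = f a).
Hypothesis innM : {morph inn : x y / x * y}.
Hypothesis outK : cancel inn out.
Variables (th : R -> R) (rth : retraction f th).
Hypothesis th_out : forall x, th x = inn (out x).
Variables (H : nat -> lmodType k) (W : words f H).
Variables (H' : nat -> lmodType k) (W' : words f' H').

(** The kernel of the map induced by a split surjection [out] of algebras under
    [K] is that of the operator [Pi] of the retraction [inn \o out]. *)
Lemma base_kernel n (e : {linear H n -> H' n}) :
  (forall g, e (word W n g) = word W' n (out \o g)) ->
  forall z, e z = 0 <-> opPi th W n z = 0.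
Proof.
move=> eE; have [G GE] := word_map_ex inn_lin inn_f innM W' W n.
have cF := cmf_word W n; have cF' := cmf_word W' n.
have e1 z : opPi th W n z = G (e z).
  apply: (word_ext (w := W) (F := opPi th W n) (G := G \o e)) => g /=.
  by rewrite (opPiE rth) eE GE; apply: (cm_ext cF) => l _ /=; rewrite th_out.
have e2 z : e z = e (opPi th W n z).
  apply: (word_ext (w := W) (F := e) (G := e \o opPi th W n)) => g /=.
  rewrite (opPiE rth) !eE; apply: (cm_ext cF') => l _ /=.
  by rewrite th_out outK.
by move=> z; split=> h; [rewrite e1 h linear0 | rewrite e2 h linear0].
Qed.
End BaseKernel.

Section Restriction.
Variables (k : comNzRingType) (U U' V V' : lmodType k).
Variables (v : {linear U -> V}) (v' : {linear U' -> V'}) (F : {linear V -> V'}).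
Variables (w : U -> V) (w' : U' -> V').
Hypotheses (v_inj : injective v') (vE : forall x, v x = w x) (vE' : forall x, v' x = w' x).

(** The map characterized by being a restriction of [F] exists as soon as [F]
    maps the image of [v] to that of [v']. *)
Lemma the_restriction : (forall x, exists y, v' y = F (v x)) ->
  forall x, v' ((the_linear (fun g : {linear U -> U'} =>
    forall x, w' (g x) = F (w x))) x) = F (v x).
Proof.
move=> ex x; rewrite vE vE'; move: x.
pose g x := projT1 (cid (ex x)).
have gE x : v' (g x) = F (v x) by rewrite /g; case: cid.
have lg : linear g.
  by move=> c x y; apply: v_inj; rewrite linearP !gE !linearP.
apply: (the_linearP (P := fun g : {linear U -> U'} => forall x, w' (g x) = F (w x))).
by have [G GE] := linear_ext lg; exists G => x; rewrite GE -vE' gE vE.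
Qed.
End Restriction.

Lemma kerp_val (k : comNzRingType) (U V : lmodType k) (e : {linear U -> V}) z :
  e z = 0 -> exists x : submod (kerp e), \val x = z.
Proof.
move=> ez; have zk : z \in kerp e by rewrite inE ez.
by exists (Sub z zk); rewrite SubK.
Qed.

Section Relative.
Variables (k : comNzRingType) (A : algType k) (M : bimod A) (nabla : bimod_product M).
Variables (K : algType k) (f : {lrmorphism K -> A}).
Local Notation E := (ext nabla).
Local Notation fE := (Defs.fE nabla f).
Local Notation CE := (hochschild fE).
Local Notation CA := (hochschild f).
Local Notation W := (hoch_words fE).
Local Notation WA := (hoch_words f).
Local Notation th := (@eproj _ _ _ nabla).
Local Notation rth := (eproj_retraction nabla f).
Local Notation Pi := (opPi th W).

Lemma ext_to_base_word n g :
  ext_to_base nabla f n (word W n g) = word WA n (@ext_out _ _ _ nabla \o g).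
Proof.
have lin : linear (@ext_out _ _ _ nabla) by [].
have outf a : @ext_out _ _ _ nabla (fE a) = f a by [].
have outM : {morph @ext_out _ _ _ nabla : x y / x * y} by [].
have [G GE] := @word_map_ex k K E A fE f _ lin outf outM _ W _ WA n.
pose Q (G : {linear CE n -> CA n}) := forall s : seq E, size s = n.+1 ->
  G (hword fE n s) = hword f n (map (@ext_out _ _ _ nabla) s).
have QG : Q G.
  move=> s ss; rewrite (hwordE fE ss) GE (@hwordE _ _ _ f n (map _ s)); last first.
    by rewrite size_map.
  by apply: eq_word => l ll; rewrite (nth_map 0) ?ss.
have Qe : Q (ext_to_base nabla f n) by apply: the_linearP; exists G.
have sg : size (mkseq g n.+1) = n.+1 by rewrite size_mkseq.
have e : hword fE n (mkseq g n.+1) = word W n g by [].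
by rewrite -GE -e (Qe _ sg) (QG _ sg).
Qed.

Lemma ext_to_base_Pi n z : ext_to_base nabla f n z = 0 <-> Pi n z = 0.
Proof.
apply: (@base_kernel k K E A fE f (@ext_out _ _ _ nabla) (ext_in nabla)
  (linearP (ext_in nabla)) (fun=> erefl) (rmorphM (ext_in nabla)) (fun=> erefl)
  th rth (fun=> erefl) _ W _ WA n (ext_to_base nabla f n)).
exact: ext_to_base_word.
Qed.

Lemma rel_val_ex n : exists v : {linear relC nabla f n -> CE n}, forall x, v x = \val x.
Proof. by exists (\val : {linear submod (kerp (ext_to_base nabla f n)) -> CE n}). Qed.

(** The inclusion of the relative complex. *)
Definition rel_val n : {linear relC nabla f n -> CE n} := projT1 (cid (rel_val_ex n)).
Lemma rel_valE n x : rel_val n x = \val x.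
Proof. by rewrite /rel_val; case: cid. Qed.

Lemma rel_val_inj n : injective (rel_val n).
Proof. by move=> x y; rewrite !rel_valE => /val_inj. Qed.

Lemma rel_val_Pi n x : Pi n (rel_val n x) = 0.
Proof.
by apply/ext_to_base_Pi; rewrite rel_valE; apply/eqP; have := valP x; rewrite inE.
Qed.

Lemma rel_val_surj n z : Pi n z = 0 -> exists x, rel_val n x = z.
Proof.
move=> /ext_to_base_Pi /kerp_val [x xz].
by exists x; exact: etrans (rel_valE x) xz.
Qed.

Lemma rel_bE n x : rel_val n (rel_b nabla f n x) = opb W id n (rel_val n.+1 x).
Proof.
rewrite -hochschild_bE.
apply: (the_restriction (@rel_val_inj n) (@rel_valE n.+1) (@rel_valE n)) => y.
apply: rel_val_surj; rewrite hochschild_bE.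
by apply: etrans (Pi_bid rth W _) _; rewrite rel_val_Pi linear0.
Qed.

Lemma rel_BE n x : rel_val n.+1 (rel_B nabla f n x) = opB W n (rel_val n x).
Proof.
rewrite -connes_BE.
apply: (the_restriction (@rel_val_inj n.+1) (@rel_valE n) (@rel_valE n.+1)) => y.
apply: rel_val_surj; rewrite connes_BE.
by apply: etrans (Pi_B rth W _) _; rewrite rel_val_Pi linear0.
Qed.

End Relative.

Section ColumnComplex.
Variables (k : comNzRingType) (A : algType k) (M : bimod A) (nabla : bimod_product M).
Variables (K : algType k) (f : {lrmorphism K -> A}).
Local Notation fE := (Defs.fE nabla f).
Local Notation W := (hoch_words fE).
Local Notation th := (@eproj _ _ _ nabla).
Local Notation letter := (letter M).
Local Notation X := (X nabla f).

(** The projection of the Hochschild module onto [X n w]. *)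
Definition restrict n w : {linear hochschild fE n -> X n w} :=
  projT1 (cid (restrict_ex nabla f n w)).
Lemma restrictE n w (s : seq letter) : size s = n.+1 ->
  restrict n w (hl W n s) = xword nabla f n w s.
Proof. by rewrite /restrict; case: cid => r rE; apply: rE. Qed.

Lemma xword_form n w (s : seq letter) : ~~ xform n w s -> xword nabla f n w s = 0.
Proof. by rewrite /xword; case: s => [|[a|m] s] // /negPf ->. Qed.

(** The modules [X n w] as summands of the Hochschild modules of [E]. *)
Definition hoch_columns : columns W X :=
  Columns xword_form (@col_incl_xword k A M nabla K f) restrictE (@X_ext k A M nabla K f).

Local Notation C := hoch_columns.
Local Notation G := (columns_grading C).

(** The maximum over all positions in [M] is attained at the last one. *)
Lemma lastM_cat (s1 s2 : seq letter) m : ~~ has (@inM _ _ M) s2 ->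
  lastM (s1 ++ inr m :: s2) = size s1.
Proof.
move=> s2A; rewrite /lastM; apply/eqP; rewrite eqn_leq; apply/andP; split.
  apply/bigmax_leqP => -[/= i]; rewrite size_cat /= => lti.
  rewrite nth_cat; case: ltnP => [/ltnW //|li].
  case: (eqVneq (size s1) i) => [->//|ne].
  have sl : (size s1 < i)%N by rewrite ltn_neqAle ne li.
  rewrite -(subnSK sl) /= => iM; case/negP: s2A; apply/(has_nthP (inl 0)).
  exists (i - (size s1).+1)%N => //.
  by rewrite ltn_subLR // addSnnS.
have ls : (size s1 < size (s1 ++ inr m :: s2))%N.
  by rewrite size_cat /= addnS ltnS leq_addr.
apply: (@bigmax_sup _ (Ordinal ls)) => //=.
by rewrite nth_cat ltnn subnn.
Qed.

Lemma XtE n w x : Xt nabla f n w x = xt G n w x.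
Proof.
pose Q (F : {linear X n w -> X n w}) := forall s, xform n w s ->
  F (xword nabla f n w s) =
  (-1) ^+ (lastM s * n) *: xword nabla f n w (rot (lastM s) s).
have Qt : Q (xt G n w).
  move=> s xs; have ss := xform_size xs; have cs := xform_count xs.
  change (restrict n w (opT th W n (coli C n w (colw C n w s))) =
    (-1) ^+ (lastM s * n) *: xword nabla f n w (rot (lastM s) s)).
  have /has_last [s1 [y [s2 [es yM s2A]]]] : has (@inM _ _ M) s by rewrite has_count cs.
  case: y es yM => [//|m] es _; rewrite es in ss xs *.
  rewrite (coli_colw C xs) (T_letters W ss s2A) linearZ (lastM_cat s1 m s2A) mulnC.
  rewrite rot_size_cat restrictE //.
  by rewrite -ss -cat_cons !size_cat addnC.
have Qx : Q (Xt nabla f n w) by apply: the_linearP; exists (xt G n w).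
apply: (colw_ext (c := C) (F := Xt nabla f n w) (G := xt G n w)) => s xs.
by rewrite (Qx _ xs) (Qt _ xs).
Qed.

Lemma XbE n w x : Xb nabla f n w x =
  cxr G n w (opb W id n (cxi G n.+1 w x)).
Proof.
pose Q (F : {linear X n.+1 w -> X n w}) := forall s, xform n.+1 w s ->
    F (xword nabla f n.+1 w s) =
      \sum_(j < n.+1) (-1) ^+ j *: xword nabla f n w (merge_at (inl 0) (@letter_mul _ _ M) j s)
      + (-1) ^+ n.+1 *: xword nabla f n w (merge_around (inl 0) (@letter_mul _ _ M) s).
pose F : {linear X n.+1 w -> X n w} := colr C n w \o (opb W id n \o coli C n.+1 w).
have QF : Q F.
  move=> s xs; change (colr C n w (opb W id n (coli C n.+1 w (colw C n.+1 w s))) =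
     \sum_(j < n.+1) (-1) ^+ j *: colw C n w (merge_at (inl 0) (@letter_mul _ _ M) j s)
      + (-1) ^+ n.+1 *: colw C n w (merge_around (inl 0) (@letter_mul _ _ M) s)).
  by rewrite (coli_colw C xs) (colr_b_same C xs).
have Qx : Q (Xb nabla f n w) by apply: the_linearP; exists F.
apply: (colw_ext (c := C) (F := Xb nabla f n w) (G := F)) => s xs.
by rewrite (Qx _ xs) (QF _ xs).
Qed.

Lemma XdE n w x : Xd nabla f n w x =
  cxr G n w (opb W id n (cxi G n.+1 w.+1 x)).
Proof.
pose Q (F : {linear X n.+1 w.+1 -> X n w}) := forall s, xform n.+1 w.+1 s ->
    F (xword nabla f n.+1 w.+1 s) =
      \sum_(j < n.+1) (-1) ^+ j *: xword nabla f n w (merge_at (inl 0) (letter_nab nabla) j s)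
      + (-1) ^+ n.+1 *: xword nabla f n w (merge_around (inl 0) (letter_nab nabla) s).
pose F : {linear X n.+1 w.+1 -> X n w} := colr C n w \o (opb W id n \o coli C n.+1 w.+1).
have QF : Q F.
  move=> s xs; change (colr C n w (opb W id n (coli C n.+1 w.+1 (colw C n.+1 w.+1 s))) =
     \sum_(j < n.+1) (-1) ^+ j *: colw C n w (merge_at (inl 0) (letter_nab nabla) j s)
      + (-1) ^+ n.+1 *: colw C n w (merge_around (inl 0) (letter_nab nabla) s)).
  by rewrite (coli_colw C xs) (colr_b_down C xs).
have Qx : Q (Xd nabla f n w) by apply: the_linearP; exists F.
apply: (colw_ext (c := C) (F := Xd nabla f n w) (G := F)) => s xs.
by rewrite (Qx _ xs) (QF _ xs).
Qed.

Lemma XpiP n w x : Xpi nabla f n w x = 0 <-> exists u, x = u - xt G n w u.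
Proof.
split=> [/qpi_eq0 /asboolP [u <-]|[u ->]].
  by exists u; rewrite -XtE.
by apply/qpi_eq0/asboolP; exists u; rewrite -XtE.
Qed.

Lemma XbarbE n w x : Xbarb nabla f n w (Xpi nabla f n.+1 w x) =
  Xpi nabla f n w (cxr G n w (opb W id n (cxi G n.+1 w x))).
Proof.
pose Q (F : {linear Xbar nabla f n.+1 w -> Xbar nabla f n w}) :=
  forall x, F (Xpi nabla f n.+1 w x) = Xpi nabla f n w (Xb nabla f n w x).
have Qx : Q (Xbarb nabla f n w).
  apply: the_linearP; apply: (qlift_ex (f := Xpi nabla f n w \o Xb nabla f n w)) => y.
  move=> /asboolP [u <-]; change (Xpi nabla f n w (Xb nabla f n w (u - Xt nabla f n.+1 w u)) = 0).
  by apply/XpiP; rewrite XtE XbE; exact: (quot_b (eproj_retraction nabla f)).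
by rewrite Qx XbE.
Qed.

Lemma XbardE n w x : Xbard nabla f n w (Xpi nabla f n.+1 w.+1 x) =
  Xpi nabla f n w (cxr G n w (opb W id n (cxi G n.+1 w.+1 x))).
Proof.
pose Q (F : {linear Xbar nabla f n.+1 w.+1 -> Xbar nabla f n w}) :=
  forall x, F (Xpi nabla f n.+1 w.+1 x) = Xpi nabla f n w (Xd nabla f n w x).
have Qx : Q (Xbard nabla f n w).
  apply: the_linearP; apply: (qlift_ex (f := Xpi nabla f n w \o Xd nabla f n w)) => y.
  move=> /asboolP [u <-].
  change (Xpi nabla f n w (Xd nabla f n w (u - Xt nabla f n.+1 w.+1 u)) = 0).
  by apply/XpiP; rewrite XtE XdE; exact: (quot_b (eproj_retraction nabla f)).
by rewrite Qx XdE.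
Qed.

(** The theorem for an arbitrary morphism of algebras [K -> A] instead of the
    inclusion of a subalgebra. *)
Theorem relative_cyclic_homology_iso (Qk : {rmorphism rat -> k}) n :
  isomorphic (relative_HC nabla f n) (homology (Xtot_diff nabla f) n).
Proof.
apply: (@cyclic_homology_iso k Qk _ _ _ _ (eproj_retraction nabla f) _ W _ G
  _ (relC nabla f) (rel_val nabla f) (@rel_val_inj _ _ _ nabla _ f)
  (@rel_val_Pi _ _ _ nabla _ f) (@rel_val_surj _ _ _ nabla _ f)
  (rel_b nabla f) (rel_B nabla f) (@rel_bE _ _ _ nabla _ f) (@rel_BE _ _ _ nabla _ f)
  (Xbar nabla f) (Xpi nabla f) _ XpiP (Xbarb nabla f) (Xbard nabla f) XbarbE XbardE
  (Xtot_diff nabla f)).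
- by move=> m w z lw Pz; apply: (colr_b_sum C).
- by move=> m w y; have [x ->] := qpi_surj y; exists x.
- by move=> m y w; apply: etrans (dcompE _ _) _.
Qed.

End ColumnComplex.

Theorem theorem2p4 (k : comNzRingType) (Qk : {rmorphism rat -> k})
    (A : algType k) (M : bimod A) (nabla : bimod_product M)
    (K : subalgClosed A) (n : nat) :
  isomorphic (relative_HC nabla (subalg_incl K) n)
             (homology (Xtot_diff nabla (subalg_incl K)) n).
Proof. exact: relative_cyclic_homology_iso Qk n. Qed.
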